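(* Assume that the uncertain time-delay system described in the context is internally exponentially stable for all admissible uncertainties, i.e. for every $\delta\in\hat\delta$ all characteristic roots of $\lambda I_n-\tilde A_0(\delta)-\sum_{k=1}^K\tilde A_k(\delta)e^{-\lambda\tau_k}$ lie in the open left half-plane. Then its robust strong $\mathcal H_\infty$-norm is equal to the reciprocal of the robust structured complex distance to instability of the characteristic matrix $M(\lambda;\delta,\Delta,\vec\tau)$: \[ |||T(\cdot;\cdot,\vec\tau)|||^{\hat\delta}_{\mathcal H_\infty}=\frac{1}{\mathrm{dist}_{INS}(\hat\delta)} . \]
   Context: **Uncertain system.** Let $n,m,p,K,L$ be positive integers, $\vec\tau=(\tau_1,\dots,\tau_K)\in(\mathbb R^+)^K$ delays ($\mathbb R^+$ the positive reals). The uncertainties are $\delta=(\delta_1,\dots,\delta_L)$, confined to $\hat\delta=\{\delta\in\mathbb R^{q_1\times r_1}\times\dots\times\mathbb R^{q_L\times r_L}:\|\delta_l\|_F\le\bar\delta_l,\ l=1,\dots,L\}$ with given bounds $\bar\delta_l$ ($\|\cdot\|_F$ the Frobenius norm). The system is \[ \begin{aligned} \dot x(t)&=\tilde A_0(\delta)x(t)+\sum_{k=1}^K\tilde A_k(\delta)x(t-\tau_k)+\tilde B_0(\delta)w(t)+\sum_{k=1}^K\tilde B_k(\delta)w(t-\tau_k),\\ z(t)&=\tilde C_0(\delta)x(t)+\sum_{k=1}^K\tilde C_k(\delta)x(t-\tau_k)+\tilde D_0(\delta)w(t)+\sum_{k=1}^K\tilde D_k(\delta)w(t-\tau_k), \end{aligned}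 \] with $x\in\mathbb R^n$, $w\in\mathbb R^m$, $z\in\mathbb R^p$, and $\tilde A_k(\delta)=A_k+\sum_{l=1}^L\sum_{s=1}^{S_l^{A_k}}G_{l,s}^{A_k}\delta_lH_{l,s}^{A_k}$ for fixed real matrices $A_k,G_{l,s}^{A_k},H_{l,s}^{A_k}$ of appropriate dimension; $\tilde B_k,\tilde C_k,\tilde D_k$ are defined analogously with their own real matrices. **Norms.** The transfer function is \[ T(s;\delta,\vec\tau)=\Big(\tilde C_0(\delta)+\sum_{k=1}^K\tilde C_k(\delta)e^{-s\tau_k}\Big)\Big(sI-\tilde A_0(\delta)-\sum_{k=1}^K\tilde A_k(\delta)e^{-s\tau_k}\Big)^{-1}\Big(\tilde B_0(\delta)+\sum_{k=1}^K\tilde B_k(\delta)e^{-s\tau_k}\Big)+\tilde D_0(\delta)+\sum_{k=1}^K\tilde D_k(\delta)e^{-s\tau_k}. \] With $\sigma_1$ the largest singular value and $\jmath$ the imaginary unit, $\|T(\cdot;\delta,\vec\tau)\|_{\mathcal H_\infty}=\sup_{\omega\in\mathbb R}\sigma_1(T(\jmath\omega;\delta,\vec\tau))$ (for an exponentially stable realisation). The strong norm is \[ |||T(\cdot;\delta,\vec\tau)|||_{\mathcal H_\infty}=\limsup_{\gamma\to0+}\{\|T(\cdot;\delta,\vec\tau_\gamma)\|_{\mathcal H_\infty}:\vec\tau_\gamma\in\mathcal B(\vec\tau,\gamma)\cap(\mathbb R^+)^K\}, \] i.e. the limit as $\gamma\to0+$ of the supremum of this set, $\mathcal B(\vec\tau,\gamma)$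 being the ball in $\mathbb R^K$ of radius $\gamma$ centred at $\vec\tau$. The robust strong norm is $|||T(\cdot;\cdot,\vec\tau)|||^{\hat\delta}_{\mathcal H_\infty}=\max_{\delta\in\hat\delta}|||T(\cdot;\delta,\vec\tau)|||_{\mathcal H_\infty}$. **Characteristic matrix.** For $\Delta\in\mathbb C^{m\times p}$, \[ M(\lambda;\delta,\Delta,\vec\tau)=Q\lambda-\tilde P_0(\delta,\Delta)-\sum_{k=1}^K\tilde P_k(\delta)e^{-\lambda\tau_k},\quad Q=\begin{bmatrix}I_n&0&0\\0&0&0\\0&0&0\end{bmatrix}, \] \[ \tilde P_0(\delta,\Delta)=\begin{bmatrix}\tilde A_0(\delta)&\tilde B_0(\delta)&0\\0&-I_m&\Delta\\\tilde C_0(\delta)&\tilde D_0(\delta)&-I_p\end{bmatrix},\quad \tilde P_k(\delta)=\begin{bmatrix}\tilde A_k(\delta)&\tilde B_k(\delta)&0\\0&0&0\\\tilde C_k(\delta)&\tilde D_k(\delta)&0\end{bmatrix}\ (k\ge1). \] Its characteristic roots are the zeros $\lambda\in\mathbb C$ of $\det M(\lambda;\delta,\Delta,\vec\tau)$. **Well-posedness.** $M(\cdot;\delta,\Delta,\vec\tau)$ is regular if $\det(Q\lambda-\tilde P_0(\delta,\Delta))$ is not identically zero in $\lambda$. In that case there are nonsingular $W,Z$ with $WQZ=\mathrm{diag}(I_\mu,N)$, $W\tilde P_0(\delta,\Delta)Z=\mathrm{diag}(J,I)$, where $J$ is in Jordan form and $N$ is nilpotent in Jordan form (Weierstrass–Kronecker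 form); the index is the smallest integer $\nu$ with $N^\nu=0$ (and $0$ if $N$ is void). $M$ is well-posed if it is regular with index at most $1$. **Strong stability and distance to instability.** For well-posed $M(\cdot;\delta,\Delta,\vec\tau)$ the spectral abscissa is $\alpha(\delta,\Delta,\vec\tau)=\sup\{\Re(\lambda):\det M(\lambda;\delta,\Delta,\vec\tau)=0\}$, and the strong spectral abscissa is $\alpha_s(\delta,\Delta,\vec\tau)=\limsup_{\gamma\to0+}\{\alpha(\delta,\Delta,\vec\tau_\gamma):\vec\tau_\gamma\in\mathcal B(\vec\tau,\gamma)\cap(\mathbb R^+)^K\}$ (same meaning of $\limsup$). $M$ is strongly stable if it is well-posed and its strong spectral abscissa is strictly negative. The robust structured complex distance to instability $\mathrm{dist}_{INS}(\hat\delta)$ is the smallest $\epsilon\ge 0$ such that there exists $\Delta\in\mathbb C^{m\times p}$ with $\|\Delta\|_2\le\epsilon$ for which $M(\lambda;\delta,\Delta,\vec\tau)$ is not strongly stable for at least one $\delta\in\hat\delta$; it is $+\infty$ if no such $\epsilon$ exists. Convention: $1/(+\infty)=0$. *)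

(* Defs.v *)
(* MathComp / MathComp-Analysis, with the complex numbers R[i] of
   mathcomp-real-closed over an arbitrary R : realType. *)
From HB Require Import structures.
From mathcomp Require Import all_boot all_order all_algebra.
From mathcomp Require Import all_classical all_reals all_analysis.
From mathcomp Require Import complex.

Set Implicit Arguments.
Unset Strict Implicit.
Unset Printing Implicit Defensive.
Import Order.TTheory GRing.Theory Num.Theory.
Import numFieldNormedType.Exports.
Local Open Scope classical_set_scope.
Local Open Scope ring_scope.
Local Open Scope complex_scope.

Definition cexp (R : realType) (z : R[i]) : R[i] :=
  (expR (complex.Re z))%:C * (cos (complex.Im z) +i* sin (complex.Im z)).

Definition frobenius (R : realType) (a b : nat) (A : 'M[R]_(a, b)) : R :=
  Num.sqrt (\sum_i \sum_j A i j ^+ 2).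

Definition enorm (R : realType) (k : nat) (v : 'cV[R[i]]_k) : R :=
  Num.sqrt (\sum_i Normc.normc (v i 0) ^+ 2).

(* The matrix norm induced by the Euclidean norms. The supremum is taken over a
   nonempty bounded set as soon as b > 0. *)
Definition norm2 (R : realType) (a b : nat) (A : 'M[R[i]]_(a, b)) : R :=
  sup [set enorm (A *m v) | v in [set v : 'cV[R[i]]_b | enorm v = 1]].

Definition ctrmx (R : realType) (a b : nat) (A : 'M[R[i]]_(a, b)) :
    'M[R[i]]_(b, a) :=
  map_mx (@conjc R) A^T.

Definition singular_values (R : realType) (a b : nat) (A : 'M[R[i]]_(a, b)) :
    set R :=
  [set s | 0 <= s /\ eigenvalue (ctrmx A *m A) ((s ^+ 2)%:C)].

(* The set of singular values is finite, and nonempty as soon as b > 0, so that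
   its supremum is its largest element. *)
Definition sigma1 (R : realType) (a b : nat) (A : 'M[R[i]]_(a, b)) : R :=
  sup (singular_values A).

(* Data of  U + \sum_l \sum_(s < S_l) G_(l,s) delta_l H_(l,s). *)
Record uncertain_mx (R : realType) (L : nat) (q r : 'I_L -> nat) (a b : nat) :=
  UncertainMx {
    um_nominal : 'M[R]_(a, b);
    um_count : 'I_L -> nat;
    um_left : forall l, 'I_(um_count l) -> 'M[R]_(a, q l);
    um_right : forall l, 'I_(um_count l) -> 'M[R]_(r l, b)
  }.

Definition uncertainty (R : realType) (L : nat) (q r : 'I_L -> nat) :=
  forall l : 'I_L, 'M[R]_(q l, r l).

Definition um_eval (R : realType) (L : nat) (q r : 'I_L -> nat) (a b : nat)
    (U : uncertain_mx R q r a b) (delta : uncertainty R q r) :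
    'M[R[i]]_(a, b) :=
  map_mx (real_complex R)
    (um_nominal U +
     \sum_(l < L) \sum_(s < um_count U l)
       um_left s *m delta l *m um_right s).

Definition admissible (R : realType) (L : nat) (q r : 'I_L -> nat)
    (dbar : 'I_L -> R) : set (uncertainty R q r) :=
  [set delta | forall l, frobenius (delta l) <= dbar l].

(* The index ord0 is the undelayed coefficient; lift ord0 k is the coefficient
   attached to the delay tau 0 k, for k : 'I_K. *)
Record uncertain_system (R : realType) (n m p K L : nat) (q r : 'I_L -> nat) :=
  UncertainSystem {
    sysA : 'I_K.+1 -> uncertain_mx R q r n n;
    sysB : 'I_K.+1 -> uncertain_mx R q r n m;
    sysC : 'I_K.+1 -> uncertain_mx R q r p n;
    sysD : 'I_K.+1 -> uncertain_mx R q r p m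
  }.

(* U_0(delta) + \sum_k U_k(delta) e^(- lam tau_k) *)
Definition delay_eval (R : realType) (K L : nat) (q r : 'I_L -> nat)
    (a b : nat) (U : 'I_K.+1 -> uncertain_mx R q r a b)
    (delta : uncertainty R q r) (tau : 'rV[R]_K) (lam : R[i]) :
    'M[R[i]]_(a, b) :=
  um_eval (U ord0) delta +
  \sum_(k < K) cexp (- lam * (tau 0 k)%:C) *: um_eval (U (lift ord0 k)) delta.

Definition internal_char (R : realType) (n m p K L : nat) (q r : 'I_L -> nat)
    (S : uncertain_system R n m p K q r) (delta : uncertainty R q r)
    (tau : 'rV[R]_K) (lam : R[i]) : 'M[R[i]]_n :=
  lam%:M - delay_eval (sysA S) delta tau lam.

Definition internally_exp_stable (R : realType) (n m p K L : nat)
    (q r : 'I_L -> nat) (S : uncertain_system R n m p K q r)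
    (delta : uncertainty R q r) (tau : 'rV[R]_K) : Prop :=
  forall lam : R[i], \det (internal_char S delta tau lam) = 0 -> complex.Re lam < 0.

Definition transfer (R : realType) (n m p K L : nat) (q r : 'I_L -> nat)
    (S : uncertain_system R n m p K q r) (delta : uncertainty R q r)
    (tau : 'rV[R]_K) (s : R[i]) : 'M[R[i]]_(p, m) :=
  delay_eval (sysC S) delta tau s *m invmx (internal_char S delta tau s)
    *m delay_eval (sysB S) delta tau s
  + delay_eval (sysD S) delta tau s.

(* Only meaningful for exponentially stable realisations, where the matrix
   inverted in transfer is nonsingular on the imaginary axis. *)
Definition Hinf_norm (R : realType) (n m p K L : nat) (q r : 'I_L -> nat)
    (S : uncertain_system R n m p K q r) (delta : uncertainty R q r)
    (tau : 'rV[R]_K) : \bar R :=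
  ereal_sup (range (fun omega : R =>
    (sigma1 (transfer S delta tau (0 +i* omega)))%:E)).

Definition delay_ball (R : realType) (K : nat) (tau : 'rV[R]_K) (gamma : R) :
    set 'rV[R]_K :=
  [set tau' | frobenius (tau' - tau) < gamma /\ forall k, 0 < tau' 0 k].

(* The limit as gamma -> 0+ of the supremum of f over the perturbed delays; the
   supremum is monotone in gamma, so the limit exists in \bar R. *)
Definition delay_limsup (R : realType) (K : nat) (f : 'rV[R]_K -> \bar R)
    (tau : 'rV[R]_K) : \bar R :=
  lim (ereal_sup (f @` delay_ball tau gamma) @[gamma --> (0 : R)^'+]).

Definition strong_Hinf_norm (R : realType) (n m p K L : nat)
    (q r : 'I_L -> nat) (S : uncertain_system R n m p K q r)
    (delta : uncertainty R q r) (tau : 'rV[R]_K) : \bar R :=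
  delay_limsup (Hinf_norm S delta) tau.

Definition is_robust_strong_Hinf_norm (R : realType) (n m p K L : nat)
    (q r : 'I_L -> nat) (S : uncertain_system R n m p K q r)
    (dbar : 'I_L -> R) (tau : 'rV[R]_K) (v : \bar R) : Prop :=
  let V := [set strong_Hinf_norm S delta tau
             | delta in @admissible R L q r dbar] in
  V v /\ ubound V v.

Definition mxQ (R : realType) (n m p : nat) : 'M[R[i]]_(n + (m + p)) :=
  block_mx 1%:M 0 0 0.

Definition mxP0 (R : realType) (n m p K L : nat) (q r : 'I_L -> nat)
    (S : uncertain_system R n m p K q r) (delta : uncertainty R q r)
    (Delta : 'M[R[i]]_(m, p)) : 'M[R[i]]_(n + (m + p)) :=
  block_mx
    (um_eval (sysA S ord0) delta) (row_mx (um_eval (sysB S ord0) delta) 0)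
    (col_mx 0 (um_eval (sysC S ord0) delta))
      (block_mx (- 1%:M) Delta
                (um_eval (sysD S ord0) delta) (- 1%:M)).

Definition mxP (R : realType) (n m p K L : nat) (q r : 'I_L -> nat)
    (S : uncertain_system R n m p K q r) (delta : uncertainty R q r)
    (k : 'I_K) : 'M[R[i]]_(n + (m + p)) :=
  block_mx
    (um_eval (sysA S (lift ord0 k)) delta)
      (row_mx (um_eval (sysB S (lift ord0 k)) delta) 0)
    (col_mx 0 (um_eval (sysC S (lift ord0 k)) delta))
      (block_mx 0 0
                (um_eval (sysD S (lift ord0 k)) delta) 0).

Definition charM (R : realType) (n m p K L : nat) (q r : 'I_L -> nat)
    (S : uncertain_system R n m p K q r) (delta : uncertainty R q r)
    (Delta : 'M[R[i]]_(m, p)) (tau : 'rV[R]_K) (lam : R[i]) :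
    'M[R[i]]_(n + (m + p)) :=
  lam *: mxQ R n m p - mxP0 S delta Delta
  - \sum_(k < K) cexp (- lam * (tau 0 k)%:C) *: mxP S delta k.

Definition regular_pencil (F : fieldType) (N : nat) (E A : 'M[F]_N) : Prop :=
  exists lam : F, \det (lam *: E - A) != 0.

(* Block-diagonal with (upper) Jordan blocks, stated on entries: two consecutive
   indices lie in the same block exactly when the superdiagonal entry is 1. *)
Definition jordan_form (F : fieldType) (k : nat) (J : 'M[F]_k) : Prop :=
  (forall i j : 'I_k, j != i :> nat -> j != i.+1 :> nat -> J i j = 0) /\
  (forall i j : 'I_k, j = i.+1 :> nat ->
     J i j = 0 \/ (J i j = 1 /\ J i i = J j j)).

Definition weierstrass_form (F : fieldType) (N mu eta : nat)
    (eN : (mu + eta)%N = N) (E A : 'M[F]_N) (J : 'M[F]_mu) (Nil : 'M[F]_eta) :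
    Prop :=
  [/\ jordan_form J, jordan_form Nil, (exists k : nat, Nil ^+ k = 0) &
   exists W Z : 'M[F]_N,
    [/\ W \in unitmx, Z \in unitmx,
        W *m E *m Z = castmx (eN, eN) (block_mx 1%:M 0 0 Nil) &
        W *m A *m Z = castmx (eN, eN) (block_mx J 0 0 1%:M)]].

(* When eta = 0 the nilpotent part is void, every power of it is 0, and the
   index is 0. *)
Definition pencil_index (F : fieldType) (N : nat) (E A : 'M[F]_N) (nu : nat) :
    Prop :=
  exists (mu eta : nat) (eN : (mu + eta)%N = N)
         (J : 'M[F]_mu) (Nil : 'M[F]_eta),
    [/\ weierstrass_form eN E A J Nil, Nil ^+ nu = 0 &
        forall k : nat, Nil ^+ k = 0 -> (nu <= k)%N].

Definition well_posed (R : realType) (n m p K L : nat) (q r : 'I_L -> nat)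
    (S : uncertain_system R n m p K q r) (delta : uncertainty R q r)
    (Delta : 'M[R[i]]_(m, p)) : Prop :=
  regular_pencil (mxQ R n m p) (mxP0 S delta Delta) /\
  exists2 nu : nat, pencil_index (mxQ R n m p) (mxP0 S delta Delta) nu
                  & (nu <= 1)%N.

Definition abscissa (R : realType) (n m p K L : nat) (q r : 'I_L -> nat)
    (S : uncertain_system R n m p K q r) (delta : uncertainty R q r)
    (Delta : 'M[R[i]]_(m, p)) (tau : 'rV[R]_K) : \bar R :=
  ereal_sup [set (complex.Re lam)%:E
              | lam in [set lam | \det (charM S delta Delta tau lam) = 0]].

Definition strong_abscissa (R : realType) (n m p K L : nat)
    (q r : 'I_L -> nat) (S : uncertain_system R n m p K q r)
    (delta : uncertainty R q r) (Delta : 'M[R[i]]_(m, p)) (tau : 'rV[R]_K) :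
    \bar R :=
  delay_limsup (abscissa S delta Delta) tau.

Definition strongly_stable (R : realType) (n m p K L : nat)
    (q r : 'I_L -> nat) (S : uncertain_system R n m p K q r)
    (delta : uncertainty R q r) (Delta : 'M[R[i]]_(m, p)) (tau : 'rV[R]_K) :
    Prop :=
  well_posed S delta Delta /\ (strong_abscissa S delta Delta tau < 0)%E.

Definition destabilizing_levels (R : realType) (n m p K L : nat)
    (q r : 'I_L -> nat) (S : uncertain_system R n m p K q r)
    (dbar : 'I_L -> R) (tau : 'rV[R]_K) : set R :=
  [set eps | 0 <= eps /\
    exists2 Delta : 'M[R[i]]_(m, p), norm2 Delta <= eps &
    exists2 delta : uncertainty R q r, admissible dbar delta &
      ~ strongly_stable S delta Delta tau].

Definition is_dist_ins (R : realType) (n m p K L : nat)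
    (q r : 'I_L -> nat) (S : uncertain_system R n m p K q r)
    (dbar : 'I_L -> R) (tau : 'rV[R]_K) (d : \bar R) : Prop :=
  let X := destabilizing_levels S dbar tau in
  (exists eps : R, [/\ d = eps%:E, X eps & lbound X eps]) \/
  (X = set0 /\ d = +oo%E).

(* Main.v *)
Require Import Defs.
From HB Require Import structures.
From mathcomp Require Import all_boot all_order all_algebra.
From mathcomp Require Import all_classical all_reals all_analysis.
From mathcomp Require Import complex.
From mathcomp Require Import zify ring lra.

(** Why the theorem is true. Fix an uncertainty. When the delays tend to tau,
    values of the transfer function on the imaginary axis accumulate at two kinds
    of matrices ([limit_transfer]): at bounded frequency, at values of the nominal
    transfer function; at unbounded frequency, where the resolvent vanishes and
    arbitrarily small delay changes make the phases omega tau_k arbitrary modulo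
    2 pi, at matrices D_0 + sum_k e_k D_k with |e_k| = 1. The strong norm is the
    largest gain of these limits, and by compactness one limit N, attached to one
    uncertainty, has the largest gain v over all uncertainties
    ([limit_transfer_le_strong], [worst_limit_transfer]). Eliminating the state
    from the characteristic matrix leaves the loop w = Delta T(lambda) w
    ([charM_rootP]), and the same elimination at infinity says that the system is
    well-posed exactly when Delta D_0 does not have the eigenvalue 1
    ([well_posedP]).

    If |Delta| v < 1, then for delays near tau the gain of T stays below 1 / |Delta|
    on a vertical line slightly to the left of the imaginary axis, hence on the
    half-plane to its right by the maximum principle of Phragmen and Lindelof, and
    the loop equation has no solution there; moreover D_0 is the mean of two limits
    with opposite phases, so its gain is at most v and the system is well-posed
    ([small_gain_strongly_stable]).

    Conversely, let N w = v u with unit vectors u and w. The perturbation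
    Delta = v^-1 w u^* has norm 1 / v and closes the loop around N. If N is a value
    T(j omega), then j omega is a root ([critical_finite_frequency]). If N is a
    limit at unbounded frequency, roots come arbitrarily close to the imaginary axis
    by an argument of Hurwitz type ([critical_infinite_frequency]).

    The proof uses only elementary means. Convergence is convergence of real and
    imaginary parts along filters, and limits along ultrafilters replace the
    extraction of subsequences. The maximum principle needs no integration: at a
    maximum of |f|^2 + eta |z|^2 a second-order expansion of f in four directions
    gives a contradiction ([maximum_principle]). Singular values are handled as
    maximal gains ([sigma1_attained]), and well-posedness requires the Jordan normal
    form ([jordan_normal_form]), obtained by splitting off one Jordan block at a
    time. *)

Set Implicit Arguments.
Unset Strict Implicit.
Unset Printing Implicit Defensive.
Import Order.TTheory GRing.Theory Num.Theory.
Import numFieldNormedType.Exports.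
Import Normc.
Local Open Scope classical_set_scope.
Local Open Scope ring_scope.
Local Open Scope complex_scope.
Local Notation Re := complex.Re.
Local Notation Im := complex.Im.

Section ComplexParts.
Context {R : realType}.
Implicit Types z w : R[i].

Lemma ReD z w : Re (z + w) = Re z + Re w. Proof. by case: z w => ? ? []. Qed.
Lemma ImD z w : Im (z + w) = Im z + Im w. Proof. by case: z w => ? ? []. Qed.
Lemma ReN z : Re (- z) = - Re z. Proof. by case: z. Qed.
Lemma ImN z : Im (- z) = - Im z. Proof. by case: z. Qed.
Lemma ReM z w : Re (z * w) = Re z * Re w - Im z * Im w.
Proof. by case: z w => ? ? []. Qed.
Lemma ImM z w : Im (z * w) = Re z * Im w + Im z * Re w.
Proof. by case: z w => ? ? []. Qed.
Lemma ReV z : Re z^-1 = Re z / (Re z ^+ 2 + Im z ^+ 2).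
Proof. by case: z. Qed.
Lemma ImV z : Im z^-1 = - (Im z / (Re z ^+ 2 + Im z ^+ 2)).
Proof. by case: z. Qed.
Lemma Re_conj z : Re (conjc z) = Re z. Proof. by case: z. Qed.
Lemma Im_conj z : Im (conjc z) = - Im z. Proof. by case: z. Qed.

Lemma complex_ext z w : Re z = Re w -> Im z = Im w -> z = w.
Proof. by case: z w => ? ? [? ?] /= -> ->. Qed.

Lemma real_complexM (a b : R) : (a * b)%:C = a%:C * b%:C.
Proof. exact: rmorphM. Qed.
Lemma real_complexN (a : R) : (- a)%:C = - a%:C.
Proof. exact: rmorphN. Qed.

Lemma normc_ge0 z : 0 <= normc z.
Proof. by case: z => a b /=; exact: sqrtr_ge0. Qed.

Lemma sqr_normcE z : normc z ^+ 2 = Re z ^+ 2 + Im z ^+ 2.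
Proof. by case: z => a b /=; rewrite sqr_sqrtr // addr_ge0 ?sqr_ge0. Qed.

Lemma normc_eq0 z : (normc z == 0) = (z == 0).
Proof.
by apply/eqP/eqP => [/eq0_normc //|->]; exact: normc0.
Qed.

Lemma normc_gt0 z : (0 < normc z) = (z != 0).
Proof. by rewrite lt_def normc_ge0 andbT normc_eq0. Qed.

Lemma ler_normc_Re z : `|Re z| <= normc z.
Proof.
rewrite -(@ler_pXn2r _ 2) ?nnegrE ?normr_ge0 ?normc_ge0 //.
by rewrite sqr_normcE real_normK ?num_real // lerDl sqr_ge0.
Qed.

Lemma ler_normc_Im z : `|Im z| <= normc z.
Proof.
rewrite -(@ler_pXn2r _ 2) ?nnegrE ?normr_ge0 ?normc_ge0 //.
by rewrite sqr_normcE real_normK ?num_real // lerDr sqr_ge0.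
Qed.

Lemma ler_normcD z w : normc (z + w) <= normc z + normc w.
Proof. exact: le_normcD. Qed.

Lemma normc_conj z : normc (conjc z) = normc z.
Proof. by case: z => a b /=; rewrite sqrrN. Qed.

Lemma mulc_conj z : z * conjc z = (normc z ^+ 2)%:C.
Proof.
by apply: complex_ext; rewrite ?ReM ?ImM Re_conj Im_conj ?sqr_normcE /=; ring.
Qed.

Lemma normc_real (x : R) : normc x%:C = `|x|.
Proof. by rewrite /= expr0n addr0 sqrtr_sqr. Qed.

Lemma normcX z k : normc (z ^+ k) = normc z ^+ k.
Proof. by elim: k => [|k IH]; rewrite ?expr0 ?normc1 // !exprS normcM IH. Qed.

Lemma normc_cexp z : normc (cexp z) = expR (Re z).
Proof.
rewrite /cexp normcM normc_real ger0_norm ?expR_ge0 //=.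
by rewrite cos2Dsin2 sqrtr1 mulr1.
Qed.

Lemma cexpD z w : cexp (z + w) = cexp z * cexp w.
Proof.
rewrite /cexp ReD ImD expRD cosD sinD.
by apply: complex_ext; rewrite !(ReM, ImM) /=; ring.
Qed.

Lemma cexp0 : cexp 0 = 1 :> R[i].
Proof.
by rewrite /cexp /= expR0 cos0 sin0; apply: complex_ext; rewrite !(ReM, ImM) /=; ring.
Qed.

End ComplexParts.

(** * Convergence of complex numbers and matrices along a filter *)

Section ComplexConvergence.
Context {R : realType} {I : Type}.
Implicit Types (F : set_system I) (z w : I -> R[i]) (l k : R[i]).

Definition ccvg F z l : Prop :=
  (fun x => Re (z x)) @ F --> Re l /\ (fun x => Im (z x)) @ F --> Im l.

Variable F : set_system I.
Context {FF : Filter F}.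

Lemma ccvg_cst l : ccvg F (fun=> l) l.
Proof. by split; exact: cvg_cst. Qed.

Lemma ccvg_near z w l : (\forall x \near F, z x = w x) -> ccvg F z l -> ccvg F w l.
Proof.
move=> zw [zr zi]; split; [apply: cvg_trans zr | apply: cvg_trans zi];
  by apply: near_eq_cvg; apply: filterS zw => x ->.
Qed.

Lemma ccvg_eq z w l : z =1 w -> ccvg F z l -> ccvg F w l.
Proof. by move=> zw; apply: ccvg_near; exact: nearW. Qed.

Lemma ccvg_real (f : I -> R) (a : R) :
  f @ F --> a -> ccvg F (fun x => (f x)%:C) a%:C.
Proof. by move=> fa; split => //=; exact: cvg_cst. Qed.

Lemma ccvgD z w l k :
  ccvg F z l -> ccvg F w k -> ccvg F (fun x => z x + w x) (l + k).
Proof.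
move=> [zr zi] [wr wi]; split.
- by under eq_fun do rewrite ReD; rewrite ReD; exact: cvgD.
- by under eq_fun do rewrite ImD; rewrite ImD; exact: cvgD.
Qed.

Lemma ccvgN z l : ccvg F z l -> ccvg F (fun x => - z x) (- l).
Proof.
move=> [zr zi]; split.
- by under eq_fun do rewrite ReN; rewrite ReN; exact: cvgN.
- by under eq_fun do rewrite ImN; rewrite ImN; exact: cvgN.
Qed.

Lemma ccvgB z w l k :
  ccvg F z l -> ccvg F w k -> ccvg F (fun x => z x - w x) (l - k).
Proof. by move=> zl wk; apply: ccvgD => //; exact: ccvgN. Qed.

Lemma ccvgM z w l k :
  ccvg F z l -> ccvg F w k -> ccvg F (fun x => z x * w x) (l * k).
Proof.
move=> [zr zi] [wr wi]; split.
- by under eq_fun do rewrite ReM; rewrite ReM; apply: cvgB; exact: cvgM.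
- by under eq_fun do rewrite ImM; rewrite ImM; apply: cvgD; exact: cvgM.
Qed.

Lemma ccvg_conj z l : ccvg F z l -> ccvg F (fun x => conjc (z x)) (conjc l).
Proof.
move=> [zr zi]; split.
- by under eq_fun do rewrite Re_conj; rewrite Re_conj.
- by under eq_fun do rewrite Im_conj; rewrite Im_conj; exact: cvgN.
Qed.

Lemma cvg_sqr_normc z l :
  ccvg F z l -> (fun x => normc (z x) ^+ 2) @ F --> normc l ^+ 2.
Proof.
move=> [zr zi]; under eq_fun do rewrite sqr_normcE !expr2.
by rewrite sqr_normcE !expr2; apply: cvgD; exact: cvgM.
Qed.

Lemma cvg_normc z l : ccvg F z l -> (fun x => normc (z x)) @ F --> normc l.
Proof.
move=> zl; have E y : normc y = Num.sqrt (normc y ^+ 2) :> R.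
  by rewrite sqrtr_sqr ger0_norm ?normc_ge0.
under eq_fun do rewrite E; rewrite E.
apply: continuous_cvg; [exact: sqrt_continuous | exact: cvg_sqr_normc].
Qed.

Lemma ccvgV z l : l != 0 -> ccvg F z l -> ccvg F (fun x => (z x)^-1) l^-1.
Proof.
move=> l0 zl; have n0 : Re l ^+ 2 + Im l ^+ 2 != 0.
  by rewrite -sqr_normcE expf_neq0 // normc_eq0.
have nV : (fun x => (Re (z x) ^+ 2 + Im (z x) ^+ 2)^-1) @ F
            --> (Re l ^+ 2 + Im l ^+ 2)^-1.
  apply: cvgV => //; rewrite -sqr_normcE.
  by under eq_fun do rewrite -sqr_normcE; exact: cvg_sqr_normc.
case: zl => zr zi; split.
- by under eq_fun do rewrite ReV; rewrite ReV; exact: cvgM.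
- by under eq_fun do rewrite ImV; rewrite ImV; apply: cvgN; exact: cvgM.
Qed.

Lemma ccvg_sum (J : Type) (s : seq J) (P : pred J) (z : J -> I -> R[i]) (l : J -> R[i]) :
  (forall j, P j -> ccvg F (z j) (l j)) ->
  ccvg F (fun x => \sum_(j <- s | P j) z j x) (\sum_(j <- s | P j) l j).
Proof.
move=> zl; elim: s => [|j s IH].
  by rewrite big_nil; apply: ccvg_eq (ccvg_cst 0) => x; rewrite big_nil.
rewrite big_cons; case: ifPn => Pj; last first.
  by apply: ccvg_eq IH => x; rewrite big_cons (negPf Pj).
by apply: ccvg_eq (ccvgD (zl j Pj) IH) => x; rewrite big_cons Pj.
Qed.

Lemma ccvg_prod (J : Type) (s : seq J) (P : pred J) (z : J -> I -> R[i]) (l : J -> R[i]) :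
  (forall j, P j -> ccvg F (z j) (l j)) ->
  ccvg F (fun x => \prod_(j <- s | P j) z j x) (\prod_(j <- s | P j) l j).
Proof.
move=> zl; elim: s => [|j s IH].
  by rewrite big_nil; apply: ccvg_eq (ccvg_cst 1) => x; rewrite big_nil.
rewrite big_cons; case: ifPn => Pj; last first.
  by apply: ccvg_eq IH => x; rewrite big_cons (negPf Pj).
by apply: ccvg_eq (ccvgM (zl j Pj) IH) => x; rewrite big_cons Pj.
Qed.

Lemma ccvg_cexp z l : ccvg F z l -> ccvg F (fun x => cexp (z x)) (cexp l).
Proof.
move=> [zr zi]; apply: ccvgM.
  by apply: ccvg_real; apply: continuous_cvg zr; exact: continuous_expR.
split => /=; apply: continuous_cvg zi; [exact: continuous_cos | exact: continuous_sin].
Qed.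

Lemma ccvg_neq0 z l : l != 0 -> ccvg F z l -> \forall x \near F, z x != 0.
Proof.
move=> l0 /cvg_normc; rewrite -normc_gt0 in l0 => /cvgr_gt /(_ _ l0).
by apply: filterS => x; rewrite normc_gt0.
Qed.

Lemma ccvg0P z : ((fun x => normc (z x)) @ F --> 0) <-> ccvg F z 0.
Proof.
split=> [z0|/cvg_normc]; last by rewrite normc0.
split; apply/cvgr0Pnorm_lt => e e0; move/cvgr0Pnorm_lt : z0 => /(_ e e0);
  apply: filterS => x; apply: le_lt_trans;
  by rewrite (ger0_norm (normc_ge0 _)) ?ler_normc_Re ?ler_normc_Im.
Qed.

End ComplexConvergence.

Section MatrixConvergence.
Context {R : realType} {I : Type}.

Definition mcvg (F : set_system I) a b (M : I -> 'M[R[i]]_(a, b)) (N : 'M[R[i]]_(a, b)) :=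
  forall i j, ccvg F (fun x => M x i j) (N i j).

Variable F : set_system I.
Context {FF : Filter F}.

Lemma mcvg_cst a b (N : 'M[R[i]]_(a, b)) : mcvg F (fun=> N) N.
Proof. by move=> i j; exact: ccvg_cst. Qed.

Lemma mcvg_near a b (M M' : I -> 'M[R[i]]_(a, b)) N :
  (\forall x \near F, M x = M' x) -> mcvg F M N -> mcvg F M' N.
Proof.
move=> MM' MN i j; apply: ccvg_near (MN i j).
by apply: filterS MM' => x ->.
Qed.

Lemma mcvg_eq a b (M M' : I -> 'M[R[i]]_(a, b)) N :
  (forall x, M x = M' x) -> mcvg F M N -> mcvg F M' N.
Proof. by move=> MM'; apply: mcvg_near; exact: nearW. Qed.

Lemma mcvgD a b (M M' : I -> 'M[R[i]]_(a, b)) N N' :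
  mcvg F M N -> mcvg F M' N' -> mcvg F (fun x => M x + M' x) (N + N').
Proof.
move=> MN MN' i j; rewrite mxE.
by apply: ccvg_eq (ccvgD (MN i j) (MN' i j)) => x; rewrite mxE.
Qed.

Lemma mcvgN a b (M : I -> 'M[R[i]]_(a, b)) N :
  mcvg F M N -> mcvg F (fun x => - M x) (- N).
Proof.
move=> MN i j; rewrite mxE.
by apply: ccvg_eq (ccvgN (MN i j)) => x; rewrite mxE.
Qed.

Lemma mcvgB a b (M M' : I -> 'M[R[i]]_(a, b)) N N' :
  mcvg F M N -> mcvg F M' N' -> mcvg F (fun x => M x - M' x) (N - N').
Proof. by move=> MN MN'; apply: mcvgD => //; exact: mcvgN. Qed.

Lemma mcvgZ a b (z : I -> R[i]) l (M : I -> 'M[R[i]]_(a, b)) N :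
  ccvg F z l -> mcvg F M N -> mcvg F (fun x => z x *: M x) (l *: N).
Proof.
move=> zl MN i j; rewrite mxE.
by apply: ccvg_eq (ccvgM zl (MN i j)) => x; rewrite mxE.
Qed.

Lemma mcvgM a b c (M : I -> 'M[R[i]]_(a, b)) (M' : I -> 'M[R[i]]_(b, c)) N N' :
  mcvg F M N -> mcvg F M' N' -> mcvg F (fun x => M x *m M' x) (N *m N').
Proof.
move=> MN MN' i j; rewrite mxE.
apply: (@ccvg_eq _ _ _ _ (fun x => \sum_k M x i k * M' x k j)) => [x|]; first by rewrite mxE.
by apply: ccvg_sum => k _; exact: ccvgM.
Qed.

Lemma mcvg_sum a b (J : Type) (s : seq J) (P : pred J)
    (M : J -> I -> 'M[R[i]]_(a, b)) (N : J -> 'M[R[i]]_(a, b)) :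
  (forall j, P j -> mcvg F (M j) (N j)) ->
  mcvg F (fun x => \sum_(j <- s | P j) M j x) (\sum_(j <- s | P j) N j).
Proof.
move=> MN i j; rewrite summxE.
apply: (@ccvg_eq _ _ _ _ (fun x => \sum_(k <- s | P k) M k x i j)) => [x|].
  by rewrite summxE.
by apply: ccvg_sum => k Pk; exact: MN.
Qed.

Lemma mcvg_scalar a (z : I -> R[i]) l :
  ccvg F z l -> @mcvg F a a (fun x => (z x)%:M) l%:M.
Proof.
move=> zl i j; rewrite mxE; case: eqP => ij /=; rewrite ?mulr1n ?mulr0n.
  by apply: ccvg_eq zl => x; rewrite mxE ij eqxx.
by apply: ccvg_eq (ccvg_cst 0) => x; rewrite mxE; move/eqP/negPf: ij => ->.
Qed.

Lemma ccvg_det a (M : I -> 'M[R[i]]_a) N :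
  mcvg F M N -> ccvg F (fun x => \det (M x)) (\det N).
Proof.
by move=> MN; apply: ccvg_sum => s _; apply: ccvgM;
  [exact: ccvg_cst | apply: ccvg_prod => i _].
Qed.

Lemma mcvg_inv a (M : I -> 'M[R[i]]_a) N :
  N \in unitmx -> mcvg F M N -> mcvg F (fun x => invmx (M x)) (invmx N).
Proof.
move=> Nu MN; have dN : \det N != 0 by rewrite -unitfE -unitmxE.
have adjE (A : 'M[R[i]]_a) : \det A != 0 -> invmx A = (\det A)^-1 *: \adj A.
  by rewrite -unitfE -unitmxE /invmx => ->.
rewrite adjE //; apply: (@mcvg_near _ _ (fun x => (\det (M x))^-1 *: \adj (M x))).
  by apply: filterS (ccvg_neq0 dN (ccvg_det MN)) => x dx; rewrite adjE.
apply: mcvgZ; first by apply: ccvgV => //; exact: ccvg_det.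
move=> i j; rewrite mxE.
apply: (@ccvg_eq _ _ _ _ (fun x => cofactor (M x) j i)) => [x|]; first by rewrite mxE.
apply: ccvgM; first exact: ccvg_cst.
apply: ccvg_det => k l; rewrite !mxE.
by apply: ccvg_eq (MN _ _) => x; rewrite !mxE.
Qed.

Lemma mcvg_ctrmx a b (M : I -> 'M[R[i]]_(a, b)) N :
  mcvg F M N -> mcvg F (fun x => ctrmx (M x)) (ctrmx N).
Proof.
move=> MN i j; rewrite !mxE.
by apply: ccvg_eq (ccvg_conj (MN j i)) => x; rewrite !mxE.
Qed.

End MatrixConvergence.

(** * Ultrafilters *)

Section Ultrafilters.
Context {R : realType} {I : Type}.
Implicit Types V : set_system I.

Lemma ultra_fmap V (J : Type) (f : I -> J) : UltraFilter V -> UltraFilter (f @ V).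
Proof.
move=> UV; split; first exact: fmap_proper_filter.
move=> G PG VG; rewrite predeqE => A; split; last exact: VG.
move=> GA; have [//|VnA] := in_ultra_setVsetC (f @^-1` A) UV.
have GnA : G (~` A) by exact: VG.
by have /filter_ex [? []] : G (A `&` ~` A) by exact: filterI.
Qed.

(** Every compactness argument below goes through this lemma: limits along an
    ultrafilter spare the extraction of subsequences. *)
Lemma ultra_cvg V (f : I -> R) (b : R) : UltraFilter V ->
  (\forall x \near V, `|f x| <= b) -> exists l : R, f @ V --> l.
Proof.
move=> UV fb; have := @segment_compact R (- b) b; rewrite compact_ultra.
case/(_ (f @ V) (ultra_fmap f UV)) => [|l [_ fl]]; last by exists l.
by apply: filterS fb => x; rewrite /= in_itv /= ler_norml.
Qed.

Lemma ultra_ccvg V (z : I -> R[i]) (b : R) : UltraFilter V ->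
  (\forall x \near V, normc (z x) <= b) -> exists l, ccvg V z l.
Proof.
move=> UV zb.
have [r rV] : exists r : R, (fun x => Re (z x)) @ V --> r.
  by apply: (@ultra_cvg _ _ b) => //; apply: filterS zb => x; exact: le_trans (ler_normc_Re _).
have [s sV] : exists s : R, (fun x => Im (z x)) @ V --> s.
  by apply: (@ultra_cvg _ _ b) => //; apply: filterS zb => x; exact: le_trans (ler_normc_Im _).
by exists (r +i* s).
Qed.

Lemma cvg_near_ge (F : set_system I) {FF : ProperFilter F} (f : I -> R) (l b : R) :
  f @ F --> l -> (\forall x \near F, b <= f x) -> b <= l.
Proof.
move=> fl fb; rewrite leNgt; apply/negP => lb.
move/cvgr_lt/(_ _ lb) : fl => fl; have [x [] /=] := filter_ex (filterI fl fb).
by rewrite ltNge => /negP.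
Qed.

Lemma cvg_near_le (F : set_system I) {FF : ProperFilter F} (f : I -> R) (l b : R) :
  f @ F --> l -> (\forall x \near F, f x <= b) -> l <= b.
Proof.
move=> fl fb; rewrite leNgt; apply/negP => lb.
move/cvgr_gt/(_ _ lb) : fl => fl; have [x [] /=] := filter_ex (filterI fl fb).
by rewrite ltNge => /negP.
Qed.

Lemma cvg_near_eq (F : set_system I) {FF : ProperFilter F} (f : I -> R) (l b : R) :
  f @ F --> l -> (\forall x \near F, f x = b) -> l = b.
Proof.
move=> fl fb; apply/eqP; rewrite eq_le; apply/andP; split.
  by apply: cvg_near_le fl _; apply: filterS fb => x ->.
by apply: cvg_near_ge fl _; apply: filterS fb => x ->.
Qed.

Lemma ultra_dichotomy V (f : I -> R) : UltraFilter V ->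
  (exists b, \forall x \near V, f x <= b) \/ (forall b, \forall x \near V, b < f x).
Proof.
move=> UV; have [?|nb] := pselect (exists b, \forall x \near V, f x <= b); [by left|right].
move=> b; have [Vb|Vnb] := in_ultra_setVsetC [set x | f x <= b] UV.
  by exfalso; apply: nb; exists b.
by apply: filterS Vnb => x /= /negP; rewrite -ltNge.
Qed.

(** Existence of maxima: if the ultrafilter converges to a point where f is
    continuous, that point maximises f; no bound on f is needed beforehand. *)
Lemma ultra_maximizing (D : set I) (f : I -> R) : D !=set0 ->
  exists V : set_system I, [/\ UltraFilter V, V D &
    forall x, D x -> \forall y \near V, f x <= f y].
Proof.
move=> [x0 Dx0]; pose B x := [set y | D y /\ f x <= f y].
have PF : ProperFilter (filter_from D B).
  apply: filter_from_proper; last by move=> x Dx; exists x; split.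
  apply: filter_from_filter; first by exists x0.
  move=> x y Dx Dy; have [xy|yx] := leP (f x) (f y).
    by exists y => // t [Dt yt]; split; split => //; exact: le_trans yt.
  by exists x => // t [Dt xt]; split; split => //; apply: le_trans xt; exact: ltW.
have [V [UV FV]] := ultraFilterLemma PF; exists V; split => //.
- by apply: FV; exists x0 => // y [].
- by move=> x Dx; apply: FV; exists x => // y [].
Qed.

End Ultrafilters.

Lemma ultra_infty : exists V : set_system nat, UltraFilter V /\ \oo `<=` V.
Proof. exact: ultraFilterLemma. Qed.

Lemma ultra_mcvg {R : realType} {I : Type} (V : set_system I) a c
    (M : I -> 'M[R[i]]_(a, c)) (b : R) : UltraFilter V ->
  (forall i j, \forall x \near V, normc (M x i j) <= b) ->
  exists N, mcvg V M N.
Proof.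
move=> UV Mb; have /choice [l lP] (ij : 'I_a * 'I_c) :
    exists l, ccvg V (fun x => M x ij.1 ij.2) l by exact: ultra_ccvg (Mb _ _).
by exists (\matrix_(i, j) l (i, j)) => i j; rewrite mxE; exact: (lP (i, j)).
Qed.

(** * Euclidean norm and largest singular value *)

Section EuclideanNorm.
Context {R : realType}.

Lemma ctrmxM a b c (A : 'M[R[i]]_(a, b)) (B : 'M[R[i]]_(b, c)) :
  ctrmx (A *m B) = ctrmx B *m ctrmx A.
Proof. by rewrite /ctrmx trmx_mul map_mxM. Qed.

Lemma ctrmxK a b (A : 'M[R[i]]_(a, b)) : ctrmx (ctrmx A) = A.
Proof. by apply/matrixP => i j; rewrite !mxE conjcK. Qed.

Lemma ctrmxZ a b (x : R[i]) (A : 'M[R[i]]_(a, b)) :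
  ctrmx (x *: A) = conjc x *: ctrmx A.
Proof. by apply/matrixP => i j; rewrite !mxE rmorphM. Qed.

Definition inner k (y x : 'cV[R[i]]_k) : R[i] := (ctrmx y *m x) 0 0.

Lemma innerE k (y x : 'cV[R[i]]_k) : inner y x = \sum_i conjc (y i 0) * x i 0.
Proof. by rewrite /inner mxE; apply: eq_bigr => i _; rewrite !mxE. Qed.

Lemma innerDr k (y x z : 'cV[R[i]]_k) : inner y (x + z) = inner y x + inner y z.
Proof. by rewrite /inner mulmxDr mxE. Qed.

Lemma innerZr k a (y x : 'cV[R[i]]_k) : inner y (a *: x) = a * inner y x.
Proof. by rewrite /inner -scalemxAr mxE. Qed.

Lemma inner_conj k (y x : 'cV[R[i]]_k) : conjc (inner y x) = inner x y.
Proof.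
rewrite !innerE rmorph_sum; apply: eq_bigr => i _.
by rewrite rmorphM /= conjcK mulrC.
Qed.

Lemma innerZl k a (y x : 'cV[R[i]]_k) : inner (a *: y) x = conjc a * inner y x.
Proof. by rewrite -inner_conj innerZr rmorphM /= inner_conj. Qed.

Lemma innerDl k (y x z : 'cV[R[i]]_k) : inner (x + z) y = inner x y + inner z y.
Proof. by rewrite -inner_conj innerDr rmorphD /= !inner_conj. Qed.

Lemma inner_mulmx a b (A : 'M[R[i]]_(a, b)) y x :
  inner y (A *m x) = inner (ctrmx A *m y) x.
Proof. by rewrite /inner ctrmxM ctrmxK mulmxA. Qed.

Lemma enorm_ge0 k (v : 'cV[R[i]]_k) : 0 <= enorm v.
Proof. exact: sqrtr_ge0. Qed.

Lemma sqr_enormE k (v : 'cV[R[i]]_k) : enorm v ^+ 2 = \sum_i normc (v i 0) ^+ 2.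
Proof. by rewrite sqr_sqrtr // sumr_ge0 // => i _; rewrite sqr_ge0. Qed.

Lemma inner_self k (v : 'cV[R[i]]_k) : inner v v = (enorm v ^+ 2)%:C.
Proof.
rewrite sqr_enormE rmorph_sum innerE; apply: eq_bigr => i _.
by rewrite mulrC mulc_conj.
Qed.

Lemma enorm_eq0 k (v : 'cV[R[i]]_k) : (enorm v == 0) = (v == 0).
Proof.
rewrite -sqrf_eq0 sqr_enormE psumr_eq0; last by move=> i _; exact: sqr_ge0.
apply/allP/eqP => [v0|-> i _ /=]; last by rewrite mxE normc0 expr0n.
apply/colP => i; have /(_ _)/implyP := v0 i.
by rewrite mem_index_enum expf_eq0 normc_eq0 mxE => /(_ isT isT) /eqP.
Qed.

Lemma enorm0 k : enorm (0 : 'cV[R[i]]_k) = 0.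
Proof. by apply/eqP; rewrite enorm_eq0. Qed.

Lemma enorm_gt0 k (v : 'cV[R[i]]_k) : (0 < enorm v) = (v != 0).
Proof. by rewrite lt_def enorm_ge0 andbT enorm_eq0. Qed.

Lemma enormZ k a (v : 'cV[R[i]]_k) : enorm (a *: v) = normc a * enorm v.
Proof.
apply/eqP; rewrite -(@eqrXn2 _ 2) ?mulr_ge0 ?enorm_ge0 ?normc_ge0 //.
rewrite exprMn !sqr_enormE mulr_sumr; apply/eqP/eq_bigr => i _.
by rewrite mxE normcM exprMn.
Qed.

Lemma sqr_enormD k (u w : 'cV[R[i]]_k) :
  enorm (u + w) ^+ 2 = enorm u ^+ 2 + enorm w ^+ 2 + 2 * Re (inner u w).
Proof.
have E (v : 'cV[R[i]]_k) : enorm v ^+ 2 = Re (inner v v) by rewrite inner_self.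
by rewrite !E innerDr !innerDl !ReD -[inner w u]inner_conj Re_conj; ring.
Qed.

Lemma cauchy_schwarz k (y x : 'cV[R[i]]_k) :
  normc (inner y x) <= enorm y * enorm x.
Proof.
have [->|x0] := eqVneq x 0.
  by rewrite -(scale0r 0) innerZr mul0r normc0 mulr_ge0 ?enorm_ge0.
rewrite -(@ler_pXn2r _ 2) ?nnegrE ?mulr_ge0 ?normc_ge0 ?enorm_ge0 //.
have := sqr_ge0 (enorm ((enorm x ^+ 2)%:C *: y + (- inner x y) *: x)).
rewrite sqr_enormD !enormZ innerZr innerZl conjc_real normcN normc_real.
have -> : normc (inner x y) = normc (inner y x) by rewrite -inner_conj normc_conj.
have -> : - inner x y * ((enorm x ^+ 2)%:C * inner y x)
    = - (enorm x ^+ 2 * normc (inner y x) ^+ 2)%:C.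
  by rewrite real_complexM -mulc_conj inner_conj; ring.
rewrite ReN /= [`|_|]ger0_norm ?sqr_ge0 // !exprMn.
have : 0 < enorm x ^+ 2 by rewrite exprn_gt0 // enorm_gt0.
move: (enorm x ^+ 2) (enorm y ^+ 2) (normc (inner y x) ^+ 2) => a b c a0 h.
have : 0 <= a * (b * a - c) by move: h; nra.
by rewrite pmulr_rge0 // subr_ge0.
Qed.

Lemma exists_unit k : (0 < k)%N -> exists v : 'cV[R[i]]_k, enorm v = 1.
Proof.
case: k => // k _; exists (delta_mx 0 0).
rewrite /enorm (bigD1 ord0) //= big1 ?addr0 => [|i /negPf i0].
  by rewrite mxE !eqxx normc1 expr1n sqrtr1.
by rewrite mxE i0 andFb mulr0n normc0 expr0n.
Qed.

Lemma normc_le_enorm k (v : 'cV[R[i]]_k) i : normc (v i 0) <= enorm v.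
Proof.
rewrite -(@ler_pXn2r _ 2) ?nnegrE ?normc_ge0 ?enorm_ge0 // sqr_enormE (bigD1 i) //=.
by rewrite lerDl sumr_ge0 // => j _; rewrite sqr_ge0.
Qed.

Lemma cvg_enorm {I : Type} (F : set_system I) {FF : Filter F} k
    (M : I -> 'cV[R[i]]_k) N :
  mcvg F M N -> (fun x => enorm (M x)) @ F --> enorm N.
Proof.
move=> MN; rewrite /enorm; apply: continuous_cvg; first exact: sqrt_continuous.
elim: (index_enum _) => [|i s IH].
  by under eq_fun do rewrite big_nil; rewrite big_nil; exact: cvg_cst.
under eq_fun do rewrite big_cons; rewrite big_cons.
by apply: cvgD IH; exact: cvg_sqr_normc.
Qed.

Lemma ccvg_inner {I : Type} (F : set_system I) {FF : Filter F} k
    (M : I -> 'cV[R[i]]_k) N (M' : I -> 'cV[R[i]]_k) N' :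
  mcvg F M N -> mcvg F M' N' -> ccvg F (fun x => inner (M x) (M' x)) (inner N N').
Proof. by move=> MN MN'; apply: (mcvgM (mcvg_ctrmx MN) MN'). Qed.

End EuclideanNorm.

Section LargestSingularValue.
Context {R : realType}.

(** A maximiser w of |T w| on the unit sphere is an eigenvector of T^* T: the
    first variation of mu^2 |w|^2 - |T w|^2, nonnegative and zero at w, in the
    direction T^* T w - mu^2 w is the squared norm of that direction. *)
Lemma sigma1_attained a b (T : 'M[R[i]]_(a, b)) : (0 < b)%N ->
  exists w : 'cV[R[i]]_b, [/\ enorm w = 1, enorm (T *m w) = sigma1 T &
    forall x, enorm (T *m x) <= sigma1 T * enorm x].
Proof.
move=> b0; pose f (w : 'cV[R[i]]_b) := enorm (T *m w).
have [w1 w1E] := @exists_unit R _ b0.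
have [|V [UV Vu Vf]] := @ultra_maximizing R _ [set w | enorm w = 1] f; first by exists w1.
have [|w Vw] := @ultra_mcvg R _ V b 1 id 1 UV.
  move=> i j; rewrite (ord1 j); apply: filterS Vu => x /= <-; exact: normc_le_enorm.
have wE : enorm w = 1.
  by apply: cvg_near_eq (cvg_enorm Vw) _; exact: Vu.
have wmax x : enorm x = 1 -> f x <= f w.
  by move=> x1; apply: cvg_near_ge (Vf x x1); apply: cvg_enorm; exact: mcvgM (mcvg_cst _) Vw.
pose mu := f w; have mu0 : 0 <= mu by exact: enorm_ge0.
have gain x : f x <= mu * enorm x.
  have [->|x0] := eqVneq x 0; first by rewrite /f mulmx0 !enorm0 mulr0.
  have x_gt0 : 0 < enorm x by rewrite enorm_gt0.
  have := wmax ((enorm x)^-1%:C *: x).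
  rewrite /f -scalemxAr !enormZ normc_real ger0_norm ?invr_ge0 ?enorm_ge0 //.
  by rewrite mulVf ?gt_eqF // mulrC ler_pdivrMr // => /(_ erefl).
pose H := ctrmx T *m T.
have gram x : inner x (H *m x) = (f x ^+ 2)%:C.
  by rewrite -mulmxA inner_mulmx ctrmxK inner_self.
have Hw : H *m w = (mu ^+ 2)%:C *: w.
  apply/eqP; rewrite -subr_eq0; set y := _ - _.
  have yE : Re (inner (T *m w) (T *m y)) - mu ^+ 2 * Re (inner w y) = enorm y ^+ 2.
    have yy : inner y y = inner (H *m w) y + - (mu ^+ 2)%:C * inner w y.
      by rewrite {1}/y innerDl -scaleNr innerZl -real_complexN conjc_real.
    have -> : enorm y ^+ 2 = Re (inner y y) by rewrite inner_self.
    by rewrite yy ReD inner_mulmx mulmxA -/H -real_complexN ReM /= mul0r subr0 mulNr.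
  pose t := (mu ^+ 2 + 1)^-1.
  have m2 : 0 <= mu ^+ 2 by exact: sqr_ge0.
  have t_gt0 : 0 < t by rewrite invr_gt0; lra.
  have : f (w + t%:C *: y) ^+ 2 <= (mu * enorm (w + t%:C *: y)) ^+ 2.
    by rewrite ler_pXn2r ?nnegrE ?mulr_ge0 ?enorm_ge0.
  rewrite /f mulmxDr -scalemxAr exprMn !sqr_enormD !innerZr !ReM /= !mul0r !subr0.
  rewrite -/(f w) -/mu wE !enormZ !normc_real ger0_norm ?(ltW t_gt0) // !exprMn.
  move=> h; have h2 : 2 * t * enorm y ^+ 2 <= t ^+ 2 * mu ^+ 2 * enorm y ^+ 2.
    rewrite -yE; move: h; have := mulr_ge0 (sqr_ge0 t) (sqr_ge0 (enorm (T *m y))).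
    rewrite yE; nra.
  have tm : t * mu ^+ 2 <= 1.
    by rewrite mulrC ler_pdivrMr ?mul1r; lra.
  have h3 : 2 * enorm y ^+ 2 <= enorm y ^+ 2.
    have h4 : t * (2 * enorm y ^+ 2) <= t * ((t * mu ^+ 2) * enorm y ^+ 2) by lra.
    rewrite ler_pM2l // in h4; apply: le_trans h4 _.
    by rewrite ler_piMl ?sqr_ge0.
  have y0 : enorm y ^+ 2 == 0 by rewrite eq_le sqr_ge0 andbT; lra.
  by rewrite -enorm_eq0 -sqrf_eq0.
have Hself : ctrmx H = H by rewrite /H ctrmxM ctrmxK.
have w0 : w != 0 by rewrite -enorm_gt0 wE.
have mem_mu : singular_values T mu.
  split => //; apply/eigenvalueP; exists (ctrmx w).
    by rewrite -[X in _ *m X]Hself -ctrmxM Hw ctrmxZ conjc_real.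
  by apply: contraNneq w0 => w0; rewrite -[w]ctrmxK w0; apply/eqP/matrixP => i j; rewrite !mxE conjc0.
have ub_mu s : singular_values T s -> s <= mu.
  move=> [s0 /eigenvalueP [v vH v0]]; pose x := ctrmx v.
  have x0 : x != 0.
    by apply: contraNneq v0 => x0; rewrite -[v]ctrmxK -/x x0; apply/eqP/matrixP => i j; rewrite !mxE conjc0.
  have Hx : H *m x = (s ^+ 2)%:C *: x by rewrite -[X in X *m _]Hself -ctrmxM vH ctrmxZ conjc_real.
  have x_gt0 : 0 < enorm x by rewrite enorm_gt0.
  have : f x ^+ 2 = (s * enorm x) ^+ 2.
    have := gram x; rewrite Hx innerZr inner_self -real_complexM => /complexI <-.
    by rewrite exprMn.
  move/eqP; rewrite eqrXn2 ?mulr_ge0 ?enorm_ge0 // => /eqP fx.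
  by have := gain x; rewrite fx ler_pM2r.
have sE : sigma1 T = mu.
  apply/eqP; rewrite eq_le; apply/andP; split.
    by apply: ge_sup; [exists mu | move=> s /ub_mu].
  by apply: ub_le_sup => //; exists mu => s /ub_mu.
by exists w; rewrite sE; split.
Qed.

Lemma enorm_mulmx_sigma1 a b (T : 'M[R[i]]_(a, b)) x :
  enorm (T *m x) <= sigma1 T * enorm x.
Proof.
case: b T x => [|b] T x; last by have [w [_ _]] := @sigma1_attained a b.+1 T isT.
by rewrite (_ : x = 0) ?mulmx0 ?enorm0 ?mulr0 //; apply/matrixP => -[].
Qed.

Lemma sigma1_ge0 a b (T : 'M[R[i]]_(a, b)) : (0 < b)%N -> 0 <= sigma1 T.
Proof. by move=> b0; have [w [_ <- _]] := sigma1_attained T b0; exact: enorm_ge0. Qed.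

Lemma bilinear_sigma1 a b (T : 'M[R[i]]_(a, b)) y x :
  normc (inner y (T *m x)) <= sigma1 T * (enorm y * enorm x).
Proof.
apply: le_trans (cauchy_schwarz _ _) _.
by rewrite mulrCA ler_wpM2l ?enorm_ge0 // enorm_mulmx_sigma1.
Qed.

Lemma enorm_mulmx_bilinear a b (T : 'M[R[i]]_(a, b)) c x : 0 <= c ->
  (forall y, normc (inner y (T *m x)) <= c * (enorm y * enorm x)) ->
  enorm (T *m x) <= c * enorm x.
Proof.
move=> c0 /(_ (T *m x)); rewrite inner_self normc_real ger0_norm ?sqr_ge0 //.
have [->|Tx] := eqVneq (T *m x) 0; first by rewrite enorm0 mulr_ge0 ?enorm_ge0.
have Tx0 : 0 < enorm (T *m x) by rewrite enorm_gt0.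
by rewrite expr2 [c * _]mulrCA ler_pM2l.
Qed.

(** Upper semicontinuity, by passing to the limit in the maximal vectors. *)
Lemma cvg_sigma1_ge {I : Type} (V : set_system I) a b (M : I -> 'M[R[i]]_(a, b)) N c :
  (0 < b)%N -> UltraFilter V -> mcvg V M N ->
  (\forall x \near V, c <= sigma1 (M x)) -> c <= sigma1 N.
Proof.
move=> b0 UV MN Mc.
have /choice [w wP] (x : I) := sigma1_attained (M x) b0.
have [|w0 Vw] := @ultra_mcvg R _ V b 1 w 1 UV.
  move=> i j; rewrite (ord1 j); apply: nearW => x.
  by have [<- _ _] := wP x; exact: normc_le_enorm.
have w0E : enorm w0 = 1.
  by apply: cvg_near_eq (cvg_enorm Vw) _; apply: nearW => x; have [] := wP x.
have := enorm_mulmx_sigma1 N w0; rewrite w0E mulr1; apply: le_trans.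
apply: cvg_near_ge (cvg_enorm (mcvgM MN Vw)) _.
by apply: filterS Mc => x; have [_ -> _] := wP x.
Qed.

Lemma norm2_bounded a b (T : 'M[R[i]]_(a, b)) x :
  (0 < b)%N -> enorm (T *m x) <= norm2 T * enorm x.
Proof.
move=> b0; have [->|x0] := eqVneq x 0; first by rewrite mulmx0 !enorm0 mulr0.
have x_gt0 : 0 < enorm x by rewrite enorm_gt0.
pose u := (enorm x)^-1%:C *: x.
have u1 : enorm u = 1.
  by rewrite enormZ normc_real ger0_norm ?invr_ge0 ?enorm_ge0 // mulVf ?gt_eqF.
have : enorm (T *m u) <= norm2 T.
  apply: ub_le_sup; last by exists u.
  exists (sigma1 T) => _ [v /= v1 <-].
  by have := enorm_mulmx_sigma1 T v; rewrite v1 mulr1.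
rewrite -scalemxAr enormZ normc_real ger0_norm ?invr_ge0 ?enorm_ge0 //.
by rewrite mulrC ler_pdivrMr.
Qed.

Lemma norm2_le a b (T : 'M[R[i]]_(a, b)) c : (0 < b)%N ->
  (forall x, enorm x = 1 -> enorm (T *m x) <= c) -> norm2 T <= c.
Proof.
move=> b0 Tc; apply: ge_sup; last by move=> _ [v /= v1 <-]; exact: Tc.
by have [v v1] := @exists_unit R _ b0; exists (enorm (T *m v)), v.
Qed.

End LargestSingularValue.

(** * Maximum principle *)

Section SecondOrderExpansion.
Context {R : realType}.
Implicit Types (f g : R[i] -> R[i]) (z d : R[i]).

(** Complex second-order expansions at z, along the four directions d with
    d^4 = 1 only. The sums of d and of d^2 over these directions vanish, which is
    all that the maximum principle needs from holomorphy. *)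
Definition taylor2 f z := exists a b, forall d, d ^+ 4 = 1 ->
  ccvg (0 : R)^'+
    (fun t => (f (z + t%:C * d) - f z - a * (t%:C * d)) / (t ^+ 2)%:C) (b * d ^+ 2).

Lemma at_right0_neq0 : \forall t \near (0 : R)^'+, t%:C != 0 :> R[i].
Proof.
near=> t; rewrite (_ : 0 = (0 : R)%:C) // (inj_eq (@complexI R)) gt_eqF //.
Unshelve. all: by end_near. Qed.

Lemma ccvg_at_right0 : ccvg (0 : R)^'+ (fun t => t%:C) 0.
Proof. by apply: ccvg_real; exact: cvg_at_right_filter. Qed.

Lemma sqr_real_complex (t : R) : (t ^+ 2)%:C = t%:C ^+ 2.
Proof. by rewrite !expr2 real_complexM. Qed.

Lemma taylor2_cst c z : taylor2 (fun=> c) z.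
Proof.
exists 0, 0 => d _; rewrite mul0r.
by apply: (@ccvg_eq _ _ _ _ (fun=> 0)) => [t|]; [rewrite subrr mul0r subr0 mul0r | exact: ccvg_cst].
Qed.

Lemma taylor2_id z : taylor2 id z.
Proof.
exists 1, 0 => d _; rewrite mul0r.
apply: (@ccvg_eq _ _ _ _ (fun=> 0)) => [t|]; last exact: ccvg_cst.
rewrite /= [X in X / _](_ : _ = 0) ?mul0r //; ring.
Qed.

Lemma taylor2D f g z : taylor2 f z -> taylor2 g z -> taylor2 (fun x => f x + g x) z.
Proof.
move=> [a [b fab]] [a' [b' gab]]; exists (a + a'), (b + b') => d d4; rewrite mulrDl.
by apply: ccvg_eq (ccvgD (fab d d4) (gab d d4)) => t; ring.
Qed.

Lemma taylor2M f g z : taylor2 f z -> taylor2 g z -> taylor2 (fun x => f x * g x) z.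
Proof.
move=> [a [b fab]] [a' [b' gab]].
exists (a * g z + f z * a'), (f z * b' + a * a' + b * g z) => d d4.
have {}fab := fab d d4; have {}gab := gab d d4.
set phi := (X in ccvg _ X _) in fab; set psi := (X in ccvg _ X _) in gab.
have t0 := ccvg_at_right0.
have cst (l : R[i]) : ccvg (0 : R)^'+ (fun=> l) l by exact: ccvg_cst.
have gz : ccvg (0 : R)^'+ (fun t => g z + a' * d * t%:C + psi t * (t%:C * t%:C)) (g z).
  rewrite -[X in ccvg _ _ X](_ : g z + a' * d * 0 + b' * d ^+ 2 * (0 * 0) = _); last by ring.
  apply: ccvgD; first by apply: ccvgD => //; apply: (ccvgM (cst _) t0).
  by apply: ccvgM => //; exact: ccvgM.
apply: (@ccvg_near _ _ _ _ (fun t => f z * psi t + a * d * (a' * d + psi t * t%:C)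
   + phi t * (g z + a' * d * t%:C + psi t * (t%:C * t%:C)))).
  apply: filterS at_right0_neq0 => t tn0; rewrite /phi /psi sqr_real_complex.
  by field.
rewrite (_ : _ * d ^+ 2 = f z * (b' * d ^+ 2) + a * d * (a' * d + b' * d ^+ 2 * 0)
    + b * d ^+ 2 * g z); last by ring.
apply: ccvgD; last exact: ccvgM.
apply: ccvgD; first exact: ccvgM.
by apply: ccvgM => //; apply: ccvgD => //; exact: ccvgM.
Qed.

Lemma taylor2V f z : f z != 0 -> taylor2 f z -> taylor2 (fun x => (f x)^-1) z.
Proof.
move=> fz0 [a [b fab]].
exists (- a / f z ^+ 2), ((a ^+ 2 - f z * b) / f z ^+ 3) => d d4.
have {}fab := fab d d4; set phi := (X in ccvg _ X _) in fab.
have t0 := ccvg_at_right0.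
have cst (l : R[i]) : ccvg (0 : R)^'+ (fun=> l) l by exact: ccvg_cst.
have fE : \forall t \near (0 : R)^'+,
    f (z + t%:C * d) = f z + a * d * t%:C + phi t * (t%:C * t%:C).
  by apply: filterS at_right0_neq0 => t tn0; rewrite /phi sqr_real_complex; field.
have fl : ccvg (0 : R)^'+ (fun t => f z + a * d * t%:C + phi t * (t%:C * t%:C)) (f z).
  rewrite -[X in ccvg _ _ X](_ : f z + a * d * 0 + b * d ^+ 2 * (0 * 0) = _); last by ring.
  apply: ccvgD; first by apply: ccvgD => //; apply: (ccvgM (cst _) t0).
  by apply: ccvgM => //; exact: ccvgM.
apply: (@ccvg_near _ _ _ _ (fun t => (a * d * (a * d + phi t * t%:C) - f z * phi t)
   * (f z + a * d * t%:C + phi t * (t%:C * t%:C))^-1 * (f z ^+ 2)^-1)).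
  apply: filterS3 at_right0_neq0 fE (ccvg_neq0 fz0 fl) => t tn0 ft fn0.
  rewrite -ft; rewrite -ft in fn0; rewrite sqr_real_complex.
  have -> : a * d * (a * d + phi t * t%:C) - f z * phi t =
     (a * d * t%:C * f (z + t%:C * d) + f z ^+ 2 - f z * f (z + t%:C * d)) / t%:C ^+ 2.
    by rewrite ft; field.
  by field; rewrite fz0 fn0 tn0.
rewrite (_ : _ * d ^+ 2 = (a * d * (a * d + b * d ^+ 2 * 0) - f z * (b * d ^+ 2))
   * (f z)^-1 * (f z ^+ 2)^-1); last by field.
apply: ccvgM => //; apply: ccvgM; last exact: ccvgV.
apply: ccvgB; last exact: ccvgM.
by apply: ccvgM => //; apply: ccvgD => //; exact: ccvgM.
Qed.

Lemma taylor2_ext f g z : f =1 g -> taylor2 f z -> taylor2 g z.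
Proof. by move=> /funext ->. Qed.

Lemma taylor2_sum (J : Type) (s : seq J) (P : pred J) (F : J -> R[i] -> R[i]) z :
  (forall j, P j -> taylor2 (F j) z) ->
  taylor2 (fun x => \sum_(j <- s | P j) F j x) z.
Proof.
move=> Fz; elim: s => [|j s IH].
  by apply: (@taylor2_ext (fun=> 0)) (taylor2_cst _ _) => x; rewrite big_nil.
case Pj : (P j); last by apply: taylor2_ext IH => x; rewrite big_cons Pj.
by apply: taylor2_ext (taylor2D (Fz j Pj) IH) => x; rewrite big_cons Pj.
Qed.

Lemma taylor2_prod (J : Type) (s : seq J) (P : pred J) (F : J -> R[i] -> R[i]) z :
  (forall j, P j -> taylor2 (F j) z) ->
  taylor2 (fun x => \prod_(j <- s | P j) F j x) z.
Proof.
move=> Fz; elim: s => [|j s IH].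
  by apply: (@taylor2_ext (fun=> 1)) (taylor2_cst _ _) => x; rewrite big_nil.
case Pj : (P j); last by apply: taylor2_ext IH => x; rewrite big_cons Pj.
by apply: taylor2_ext (taylor2M (Fz j Pj) IH) => x; rewrite big_cons Pj.
Qed.

(** Two mean value theorems bring the second-order remainder down to a value of
    the second derivative at an intermediate point. *)
Lemma real_taylor2 (f f1 f2 : R -> R) :
  (forall x : R, is_derive x 1 f (f1 x)) -> (forall x : R, is_derive x 1 f1 (f2 x)) ->
  {for 0, continuous f2} ->
  (fun t => (f t - f 0 - f1 0 * t) / t ^+ 2) @ 0^'+ --> f2 0 / 2.
Proof.
move=> df df1 cf2.
have cont (h h1 : R -> R) (a b : R) : (forall x : R, is_derive x 1 h (h1 x)) ->
    {within `[a, b], continuous h}.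
  move=> dh; apply: continuous_subspaceT => x.
  by apply: differentiable_continuous; apply/derivable1_diffP; apply: ex_derive; exact: dh.
pose g t := f t - f 0 - f1 0 * t - f2 0 / 2 * t ^+ 2.
pose g1 t := f1 t - f1 0 - f2 0 * t.
have dg (x : R) : is_derive x 1 g (g1 x).
  rewrite /g /g1; apply: is_derive_eq.
  by rewrite /GRing.scale /=; lra.
have dg1 (x : R) : is_derive x 1 g1 (f2 x - f2 0).
  rewrite /g1; apply: is_derive_eq.
  by rewrite /GRing.scale /=; ring.
apply/cvgrPdist_lt => eps eps0.
have /cvgrPdist_lt /(_ _ eps0) [e /= e0 He] := cf2.
near=> t.
have t0 : 0 < t by [].
have te : t < e by near: t; exact: nbhs_right_lt.
have [c] := MVT t0 (fun x _ => dg x) (cont g g1 0 t dg).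
rewrite in_itv /= => /andP[c0 ct].
have [c'] := MVT c0 (fun x _ => dg1 x) (cont g1 _ 0 c dg1).
rewrite in_itv /= => /andP[c'0 c'c].
have g10 : g1 0 = 0 by rewrite /g1; ring.
have g0 : g 0 = 0 by rewrite /g; ring.
rewrite g10 !subr0 => g1c; rewrite g0 !subr0 g1c => gt.
have -> : f2 0 / 2 - (f t - f 0 - f1 0 * t) / t ^+ 2 = - (g t / t ^+ 2).
  by rewrite /g; field; rewrite gt_eqF.
rewrite normrN gt.
have -> : (f2 c' - f2 0) * c * t / t ^+ 2 = (f2 c' - f2 0) * (c / t).
  by field; rewrite gt_eqF.
have H1 : `|f2 0 - f2 c'| < eps.
  by apply: He; rewrite /= sub0r normrN gtr0_norm //; lra.
rewrite normrM distrC [`|c / t|]ger0_norm ?divr_ge0 ?ltW //.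
apply: le_lt_trans H1; rewrite ler_piMr ?normr_ge0 //.
by rewrite ler_pdivrMr // mul1r ltW.
Unshelve. all: by end_near. Qed.


End SecondOrderExpansion.

Section ExpExpansion.
Context {R : realType}.
Implicit Types (f g : R[i] -> R[i]) (z d : R[i]).

Lemma real_complexV (s : R) : (s^-1)%:C = (s%:C)^-1.
Proof. exact: fmorphV. Qed.

Lemma real_taylor2_exp_cos_sin (k : R) :
  [/\ (fun t => (expR (k * t) - 1 - k * t) / t ^+ 2) @ 0^'+ --> k ^+ 2 / 2,
      (fun t => (cos (k * t) - 1) / t ^+ 2) @ 0^'+ --> - k ^+ 2 / 2 &
      (fun t => (sin (k * t) - k * t) / t ^+ 2) @ 0^'+ --> (0 : R)].
Proof.
have dmul (h h1 : R -> R) (x : R) : (forall x : R, is_derive x 1 h (h1 x)) ->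
    is_derive x 1 (fun t => h (k * t)) (k * h1 (k * x)).
  move=> dh; have dk : is_derive x 1 (fun t : R => k * t) k.
    by apply: is_derive_eq; rewrite /GRing.scale /= mulr1.
  by have := @is_derive1_comp _ h (fun t : R => k * t) x _ _ (dh _) dk; rewrite mulrC.
have ck (h : R -> R) : continuous h -> {for 0, continuous (fun t : R => k * (k * h (k * t)))}.
  move=> ch; rewrite /continuous_at; apply: cvgM; first exact: cvg_cst.
  apply: cvgM; first exact: cvg_cst.
  by apply: continuous_cvg; [exact: ch | apply: cvgM; [exact: cvg_cst | exact: cvg_id]].
have dZ (h h1 : R -> R) (x : R) : (forall x : R, is_derive x 1 h (h1 x)) ->
    is_derive x 1 (fun t => k * h t) (k * h1 x).
  by move=> dh; apply: is_derive_eq.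
have Nsin : forall x : R, is_derive x 1 (fun t => - sin t) (- cos x).
  by move=> x; apply: is_derive_eq.
have cNcos : continuous (fun t : R => - cos t).
  by move=> x; apply: cvgN; exact: continuous_cos.
have cNsin : continuous (fun t : R => - sin t).
  by move=> x; apply: cvgN; exact: continuous_sin.
have E := @real_taylor2 R (fun t => expR (k * t)) _ _ (fun x => dmul _ _ x (@is_derive_expR R))
  (fun x => dZ _ _ x (fun x => dmul _ _ x (@is_derive_expR R))) (ck _ (@continuous_expR R)).
have Cc := @real_taylor2 R (fun t => cos (k * t)) _ _ (fun x => dmul _ _ x (@is_derive_cos R))
  (fun x => dZ _ _ x (fun x => dmul _ _ x Nsin)) (ck _ cNcos).
have Sc := @real_taylor2 R (fun t => sin (k * t)) _ _ (fun x => dmul _ _ x (@is_derive_sin R))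
  (fun x => dZ _ _ x (fun x => dmul _ _ x (@is_derive_cos R))) (ck _ cNsin).
move: E Cc Sc => /=; rewrite !mulr0 expR0 cos0 sin0 !mulr1 !oppr0 !mulr0 !mul0r => E Cc Sc.
split => //.
- rewrite (_ : - k ^+ 2 / 2 = k * (k * -1) / 2); last by ring.
  by apply: cvg_trans Cc; apply: near_eq_cvg; apply: nearW => t; rewrite mul0r subr0.
- by apply: cvg_trans Sc; apply: near_eq_cvg; apply: nearW => t; rewrite addr0.
Qed.

Lemma taylor2_cexp (k : R) z : taylor2 (fun x => cexp (k%:C * x)) z.
Proof.
pose P (k : R) d := ccvg (0 : R)^'+
  (fun t => (cexp (k%:C * (t%:C * d)) - 1 - k%:C * (t%:C * d)) / (t ^+ 2)%:C)
  ((k ^+ 2 / 2)%:C * d ^+ 2).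
have PN k' d : P (- k') d -> P k' (- d).
  rewrite /P sqrrN (_ : (- d) ^+ 2 = d ^+ 2) ?sqrrN //; apply: ccvg_eq => t.
  by rewrite real_complexN !mulrN !mulNr.
have P1 k' : P k' 1.
  have [E _ _] := real_taylor2_exp_cos_sin k'.
  rewrite /P expr1n mulr1; apply: ccvg_eq (ccvg_real E) => t.
  rewrite !mulr1 -real_complexM /cexp /= cos0 sin0 -real_complexV.
  by apply: complex_ext; rewrite !(ReM, ImM, ReD, ImD, ReN, ImN) /=; ring.
have Pi k' : P k' 'i.
  have [_ Cc Sc] := real_taylor2_exp_cos_sin k'.
  rewrite /P; have -> : (k' ^+ 2 / 2)%:C * 'i ^+ 2 = (- k' ^+ 2 / 2) +i* 0.
    by apply: complex_ext; rewrite !(ReM, ImM) /=; ring.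
  have : ccvg 0^'+ (fun t => ((cos (k' * t) - 1) / t ^+ 2) +i* ((sin (k' * t) - k' * t) / t ^+ 2))
    (- k' ^+ 2 / 2 +i* 0) by split.
  apply: ccvg_eq => t.
  have -> : k'%:C * (t%:C * 'i) = 0 +i* (k' * t).
    by apply: complex_ext; rewrite !(ReM, ImM) /=; ring.
  rewrite /cexp /= expR0 -real_complexV.
  by apply: complex_ext; rewrite !(ReM, ImM, ReD, ImD, ReN, ImN) /=; ring.
exists (k%:C * cexp (k%:C * z)), ((k ^+ 2 / 2)%:C * cexp (k%:C * z)) => d d4.
have Pd : P k d.
  have : (d - 1) * (d + 1) * ((d - 'i) * (d + 'i)) == 0.
    have -> : (d - 1) * (d + 1) * ((d - 'i) * (d + 'i)) = (d ^+ 2 - 1) * (d ^+ 2 - 'i ^+ 2) by ring.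
    by rewrite sqr_i -d4; apply/eqP; ring: d4.
  rewrite !mulf_eq0 !subr_eq0 !addr_eq0 => /orP[/orP[]|/orP[]] /eqP ->.
  - exact: P1.
  - exact/PN/P1.
  - exact: Pi.
  - exact/PN/Pi.
rewrite mulrAC; apply: ccvg_eq (ccvgM Pd (ccvg_cst (cexp (k%:C * z)))) => t.
by rewrite mulrDr cexpD; ring.
Qed.

End ExpExpansion.

Section MaximumPrinciple.
Context {R : realType}.
Implicit Types (f g : R[i] -> R[i]) (z d : R[i]) (D : set R[i]).

Definition ccontinuous f z := forall F : set_system R[i], Filter F ->
  ccvg F id z -> ccvg F f (f z).

Definition ccompact D := forall V : set_system R[i], UltraFilter V -> V D ->
  exists z, D z /\ ccvg V id z.

Lemma fourth_roots :
  [/\ 'i ^+ 4 = 1 :> R[i], (- 'i) ^+ 4 = 1 :> R[i] & (- 1) ^+ 4 = 1 :> R[i]].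
Proof.
by split; rewrite -[4%N]/(2 * 2)%N exprM ?sqrrN ?sqr_i ?sqrrN !expr1n.
Qed.

Lemma sqr_normcD (u v : R[i]) :
  normc (u + v) ^+ 2 = normc u ^+ 2 + normc v ^+ 2 + 2 * Re (conjc u * v).
Proof. by rewrite !sqr_normcE ReM Re_conj Im_conj !(ReD, ImD); ring. Qed.

Lemma Re_realM (x : R) z : Re (x%:C * z) = x * Re z.
Proof. by rewrite ReM [Im x%:C]/= mul0r subr0. Qed.

(** Summed over the four directions, |f|^2 exceeds four times its value at z up to
    o(t^2), whereas |x|^2 gains exactly 4 t^2. *)
Lemma laplacian_gt0 f z (eta : R) : 0 < eta -> taylor2 f z ->
  let G x := normc (f x) ^+ 2 + eta * normc x ^+ 2 in
  \forall t \near (0 : R)^'+, 4 * G z <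
    G (z + t%:C * 1) + G (z + t%:C * -1) + (G (z + t%:C * 'i) + G (z + t%:C * - 'i)).
Proof.
move=> eta0 [a [b fab]] G.
have f1 := fab _ (expr1n _ 4).
have [i4 Ni4 N14] := fourth_roots.
have f2 := fab _ N14; have f3 := fab _ i4; have f4 := fab _ Ni4.
set p1 := (X in ccvg _ X _) in f1; set p2 := (X in ccvg _ X _) in f2.
set p3 := (X in ccvg _ X _) in f3; set p4 := (X in ccvg _ X _) in f4.
have [lim0 _] := ccvgM (ccvg_cst (conjc (f z))) (ccvgD (ccvgD f1 f2) (ccvgD f3 f4)).
rewrite !sqrrN sqr_i expr1n (_ : _ + _ = 0) ?mulr0 in lim0; last by ring.
have near0 : \forall t \near (0 : R)^'+, - eta < Re (conjc (f z) * (p1 t + p2 t + (p3 t + p4 t))).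
  by apply: (cvgr_gt _ lim0); rewrite oppr_lt0.
have tpos : \forall t \near (0 : R)^'+, 0 < t by exact: nbhs_right_gt.
apply: filterS3 near0 tpos (@at_right0_neq0 R) => t near_t t0 tn0.
have sq d : d ^+ 4 = 1 -> normc (t%:C * d) ^+ 2 = t ^+ 2.
  move=> d4; rewrite normcM normc_real gtr0_norm // exprMn -[X in _ = X]mulr1; congr (_ * _).
  have nd4 : normc d ^+ 4 = 1 by rewrite -normcX d4 normc1.
  apply/eqP; rewrite -(@eqrXn2 _ 2) // ?sqr_ge0 // -exprM nd4 expr1n //.
have step d (y : R[i]) : d ^+ 4 = 1 ->
    f (z + t%:C * d) = f z + (a * (t%:C * d) + (t ^+ 2)%:C * y) ->
    normc (f z) ^+ 2 + eta * normc z ^+ 2 + eta * t ^+ 2 +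
      t * (2 * Re (conjc (f z) * (a * d)) + eta * (2 * Re (conjc z * d)))
      + t ^+ 2 * (2 * Re (conjc (f z) * y)) <= G (z + t%:C * d).
  move=> d4 fE; rewrite /G fE (sqr_normcD (f z)) (sqr_normcD z) sq //.
  have -> : Re (conjc z * (t%:C * d)) = t * Re (conjc z * d).
    by rewrite mulrCA Re_realM.
  have -> : conjc (f z) * (a * (t%:C * d) + (t ^+ 2)%:C * y)
    = t%:C * (conjc (f z) * (a * d)) + (t ^+ 2)%:C * (conjc (f z) * y) by ring.
  rewrite ReD !Re_realM.
  have := sqr_ge0 (normc (a * (t%:C * d) + (t ^+ 2)%:C * y)); lra.
have fE d (y : R[i]) : y = (f (z + t%:C * d) - f z - a * (t%:C * d)) / (t ^+ 2)%:C ->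
    f (z + t%:C * d) = f z + (a * (t%:C * d) + (t ^+ 2)%:C * y).
  by move=> ->; rewrite sqr_real_complex; field.
have s1 := step 1 (p1 t) (expr1n _ 4) (fE _ _ erefl).
have s2 := step (-1) (p2 t) N14 (fE _ _ erefl).
have s3 := step 'i (p3 t) i4 (fE _ _ erefl).
have s4 := step (- 'i) (p4 t) Ni4 (fE _ _ erefl).
have N d (u : R[i]) : Re (conjc (f z) * (u * - d)) = - Re (conjc (f z) * (u * d)).
  by rewrite !mulrN ReN.
have M d : Re (conjc z * - d) = - Re (conjc z * d) by rewrite mulrN ReN.
rewrite !N !M in s2 s4; rewrite mulrDr !ReD !(mulrDr (conjc _)) !ReD in near_t.
clear N M step fE.
have {}near_t : 0 < t ^+ 2 * (Re (conjc (f z) * p1 t) + Re (conjc (f z) * p2 t) +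
    (Re (conjc (f z) * p3 t) + Re (conjc (f z) * p4 t)) + eta).
  by rewrite mulr_gt0 ?exprn_gt0 //; lra.
have t2 : 0 < eta * t ^+ 2 by rewrite mulr_gt0 ?exprn_gt0.
rewrite {1}/G; lra.
Qed.

(** A point of D where the bound may fail is interior, at least in the four
    directions; there |f|^2 + eta |x|^2 cannot be maximal. *)
Theorem maximum_principle D f (B : R) : ccompact D -> 0 <= B ->
  (exists rho : R, forall z, D z -> normc z <= rho) ->
  (forall z, D z -> ccontinuous f z) ->
  (forall z, D z -> normc (f z) <= B \/
     taylor2 f z /\ (forall d, d ^+ 4 = 1 -> \forall t \near (0 : R)^'+, D (z + t%:C * d))) ->
  forall z, D z -> normc (f z) <= B.
Proof.
move=> cD B0 [rho Drho] cf fD z Dz; rewrite leNgt; apply/negP => fz.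
have rho0 : 0 <= rho by apply: le_trans (Drho z Dz); exact: normc_ge0.
have gap : 0 < normc (f z) ^+ 2 - B ^+ 2.
  by rewrite subr_gt0 ltr_pXn2r ?nnegrE ?normc_ge0.
pose eta := (normc (f z) ^+ 2 - B ^+ 2) / (rho ^+ 2 + 1).
have r1 : 0 < rho ^+ 2 + 1 by have := sqr_ge0 rho; lra.
have eta0 : 0 < eta by rewrite divr_gt0.
have etaE : eta * (rho ^+ 2 + 1) = normc (f z) ^+ 2 - B ^+ 2 by rewrite divfK ?gt_eqF.
pose G x := normc (f x) ^+ 2 + eta * normc x ^+ 2.
have [|V [UV VD Vmax]] := @ultra_maximizing R _ D G; first by exists z.
have [z0 [Dz0 Vz0]] := cD V UV VD.
have max0 x : D x -> G x <= G z0.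
  move=> Dx; apply: cvg_near_ge (Vmax x Dx); apply: cvgD.
    by apply: cvg_sqr_normc; exact: cf.
  by apply: cvgM; [exact: cvg_cst | exact: cvg_sqr_normc].
have [fz0|[fz0 int]] := fD z0 Dz0.
  have := max0 z Dz; rewrite /G.
  have : normc (f z0) ^+ 2 <= B ^+ 2 by rewrite ler_pXn2r ?nnegrE ?normc_ge0.
  have : normc z0 ^+ 2 <= rho ^+ 2 by rewrite ler_pXn2r ?nnegrE ?normc_ge0 // Drho.
  have := sqr_ge0 (normc z).
  have := eta0; move: etaE; move: (normc z0 ^+ 2) => u; nra.
have [i4 Ni4 N14] := fourth_roots.
have [t [[h [d1 d2]] [d3 d4]]] := filter_ex (filterI (filterI (laplacian_gt0 eta0 fz0)
  (filterI (int _ (expr1n _ 4)) (int _ N14))) (filterI (int _ i4) (int _ Ni4))).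
have := max0 _ d1; have := max0 _ d2; have := max0 _ d3; have := max0 _ d4.
have {}h : 4 * G z0 < G (z0 + t%:C * 1) + G (z0 + t%:C * -1)
    + (G (z0 + t%:C * 'i) + G (z0 + t%:C * - 'i)) := h.
by move: h; lra.
Qed.

End MaximumPrinciple.

Section Rectangles.
Context {R : realType}.
Implicit Types (f g : R[i] -> R[i]) (z d : R[i]).

Lemma ccontinuousM f g z : ccontinuous f z -> ccontinuous g z ->
  ccontinuous (fun x => f x * g x) z.
Proof. by move=> cf cg F FF Fz; apply: ccvgM; [exact: cf | exact: cg]. Qed.

Lemma ccontinuousV f z : f z != 0 -> ccontinuous f z -> ccontinuous (fun x => (f x)^-1) z.
Proof. by move=> fz cf F FF Fz; apply: ccvgV => //; exact: cf. Qed.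

Definition rect (a a' b b' : R) : set R[i] :=
  [set z | [/\ a <= Re z, Re z <= a', b <= Im z & Im z <= b']].

Lemma normc_le_ReIm z : normc z <= `|Re z| + `|Im z|.
Proof.
rewrite -(@ler_pXn2r _ 2) ?nnegrE ?addr_ge0 ?normc_ge0 //.
rewrite sqr_normcE sqrrD !real_normK ?num_real // lerD2r lerDl.
by rewrite mulrn_wge0 // mulr_ge0.
Qed.

Lemma ccompact_rect a a' b b' : ccompact (rect a a' b b').
Proof.
move=> V UV VD.
have near_re : \forall x \near V, a <= Re x <= a' by apply: filterS VD => x [-> ->].
have near_im : \forall x \near V, b <= Im x <= b' by apply: filterS VD => x [_ _ -> ->].
have [u uV] : exists u : R, (fun x => Re x) @ V --> u.
  by apply: (@ultra_cvg _ _ _ _ (`|a| + `|a'|)) => //; apply: filterS near_re => x xa;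
    rewrite ler_norml; have := ler_norm a'; have := ler_norm (- a); rewrite normrN;
    have := normr_ge0 a; have := normr_ge0 a'; lra.
have [v vV] : exists u : R, (fun x => Im x) @ V --> u.
  by apply: (@ultra_cvg _ _ _ _ (`|b| + `|b'|)) => //; apply: filterS near_im => x xa;
    rewrite ler_norml; have := ler_norm b'; have := ler_norm (- b); rewrite normrN;
    have := normr_ge0 b; have := normr_ge0 b'; lra.
exists (u +i* v); split; last by split.
by split; [apply: cvg_near_ge uV _ | apply: cvg_near_le uV _ |
    apply: cvg_near_ge vV _ | apply: cvg_near_le vV _];
  apply: filterS VD => x [].
Qed.

Lemma rect_maximum_principle a a' b b' f (B : R) : 0 <= B ->
  let D := rect a a' b b' in
  (forall z, D z -> ccontinuous f z /\ taylor2 f z) ->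
  (forall z, D z -> [\/ Re z = a, Re z = a', Im z = b | Im z = b'] -> normc (f z) <= B) ->
  forall z, D z -> normc (f z) <= B.
Proof.
move=> B0 D fD bd; apply: (maximum_principle (@ccompact_rect a a' b b') B0).
- exists (`|a| + `|a'| + (`|b| + `|b'|)) => z [h1 h2 h3 h4].
  apply: le_trans (normc_le_ReIm z) _.
  have := ler_norm a'; have := ler_norm (- a); have := ler_norm b'; have := ler_norm (- b).
  have := normr_ge0 a; have := normr_ge0 a'; have := normr_ge0 b; have := normr_ge0 b'.
  rewrite !normrN => *; apply: lerD; rewrite ler_norml; lra.
- by move=> z /fD[].
move=> z Dz; have [h1 h2 h3 h4] := Dz.
have [e1|n1] := eqVneq (Re z) a; first by left; apply: bd => //; constructor 1.
have [e2|n2] := eqVneq (Re z) a'; first by left; apply: bd => //; constructor 2.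
have [e3|n3] := eqVneq (Im z) b; first by left; apply: bd => //; constructor 3.
have [e4|n4] := eqVneq (Im z) b'; first by left; apply: bd => //; constructor 4.
right; split; first by have [] := fD z Dz.
have {}h1 : a < Re z by rewrite lt_neqAle eq_sym n1.
have {}h2 : Re z < a' by rewrite lt_neqAle n2.
have {}h3 : b < Im z by rewrite lt_neqAle eq_sym n3.
have {}h4 : Im z < b' by rewrite lt_neqAle n4.
move=> d d4; have nd : normc d = 1.
  by apply/eqP; rewrite -(@eqrXn2 _ 4) ?normc_ge0 // -normcX d4 normc1 expr1n.
have near_lt (e : R) : 0 < e -> \forall t \near (0 : R)^'+, t < e.
  by move=> e0; exact: nbhs_right_lt.
have tpos : \forall t \near (0 : R)^'+, 0 < t by exact: nbhs_right_gt.
have nre : \forall t \near (0 : R)^'+, t <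
    Num.min (Num.min (Re z - a) (a' - Re z)) (Num.min (Im z - b) (b' - Im z)).
  by apply: near_lt; rewrite !lt_min !subr_gt0 h1 h2 h3 h4.
apply: filterS2 tpos nre => t t0; rewrite !lt_min => /andP[/andP[t1 t2] /andP[t3 t4]].
have : `|Re (t%:C * d)| <= t.
  by apply: le_trans (ler_normc_Re _) _; rewrite normcM normc_real nd mulr1 gtr0_norm.
have : `|Im (t%:C * d)| <= t.
  by apply: le_trans (ler_normc_Im _) _; rewrite normcM normc_real nd mulr1 gtr0_norm.
rewrite !ler_norml => /andP[i1 i2] /andP[r1 r2].
clear -i1 i2 r1 r2 t1 t2 t3 t4.
by split; rewrite ?ReD ?ImD; lra.
Qed.

(** Dividing by 1 + eps (z - c), of modulus at least 1 on the half-plane, makes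
    the bounded function small on the far sides of a large rectangle. *)
Lemma phragmen_lindelof (c : R) f (B : R) : 0 < B ->
  (forall z, c <= Re z -> ccontinuous f z /\ taylor2 f z) ->
  (forall z, Re z = c -> normc (f z) <= B) ->
  (exists rho B', forall z, c <= Re z -> rho <= normc z -> normc (f z) <= B') ->
  forall z, c <= Re z -> normc (f z) <= B.
Proof.
move=> B0 fH fc [rho [B' fB']] z cz; rewrite leNgt; apply/negP => fz.
pose A := normc (f z); pose M := normc (z - c%:C).
have M0 : 0 <= M by exact: normc_ge0.
have AB : B < A by [].
pose eps := (A - B) / ((B + 1) * (M + 1)).
have eps0 : 0 < eps by rewrite divr_gt0 ?mulr_gt0; lra.
pose g x : R[i] := 1 + eps%:C * (x - c%:C).
have Reg x : Re (g x) = 1 + eps * (Re x - c).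
  by rewrite ReD Re_realM ReD ReN.
have Img x : Im (g x) = eps * Im x.
  by rewrite ImD ImM ImD ImN /=; ring.
have g_ge1 x : c <= Re x -> 1 <= normc (g x).
  move=> cx; apply: le_trans (ler_normc_Re _); rewrite Reg.
  by apply: le_trans (ler_norm _); rewrite lerDl mulr_ge0 ?subr_ge0 // ltW.
have g0 x : c <= Re x -> g x != 0.
  by move=> /g_ge1 g1; rewrite -normc_gt0; lra.
pose h x := f x * (g x)^-1.
have gz : B * normc (g z) < A.
  have : normc (g z) <= 1 + eps * M.
    by apply: le_trans (ler_normcD _ _) _; rewrite normc1 normcM normc_real gtr0_norm.
  have epsE : eps * ((B + 1) * (M + 1)) = A - B.
    by rewrite divfK // mulf_neq0 // gt_eqF; lra.
  have : 0 < eps * (B + M + 1) by rewrite mulr_gt0 //; lra.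
  move=> k1 k2; apply: (@le_lt_trans _ _ (B * (1 + eps * M))); last by lra.
  by rewrite ler_pM2l.
have hz : B < normc (h z).
  by rewrite normcM normcV ltr_pdivlMr // (lt_le_trans ltr01) ?g_ge1.
pose r0 : R := `|rho| + `|B'| / (eps * B) + `|c| + normc z + 1.
have e_B : 0 < eps * B by rewrite mulr_gt0.
have q0 : 0 <= `|B'| / (eps * B) by rewrite divr_ge0 // ltW.
have nz0 := normc_ge0 z.
have r0E : [/\ 0 < r0, rho <= r0 - `|c|, `|B'| / (eps * B) <= r0 - `|c| & normc z + `|c| <= r0].
  by rewrite /r0; have := normr_ge0 rho; have := normr_ge0 c; have := ler_norm rho; split; lra.
have [r0_gt0 r0rho r0B r0z] := r0E.
have far x : c <= Re x -> rho <= normc x -> r0 - `|c| <= normc (g x) / eps -> normc (h x) <= B.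
  move=> cx rx gx; have fx := fB' x cx rx.
  have gx0 : 0 < normc (g x) by rewrite (lt_le_trans ltr01) ?g_ge1.
  rewrite normcM normcV ler_pdivrMr //; apply: le_trans (le_trans fx (ler_norm B')) _.
  have := le_trans r0B gx; rewrite ler_pdivrMr // => /le_trans; apply.
  by rewrite mulrA divfK ?gt_eqF // mulrC.
have : normc (h z) <= B.
  apply: (@rect_maximum_principle c (c + r0) (- r0) r0 h B (ltW B0)) => [x [cx _ _ _]|x [cx x2 x3 x4]|].
  - have [cf tf] := fH x cx; split.
      apply: ccontinuousM => //; apply: ccontinuousV; first exact: g0.
      move=> F FF Fx; apply: ccvgD; first exact: ccvg_cst.
      by apply: ccvgM; [exact: ccvg_cst | apply: ccvgB => //; exact: ccvg_cst].
    apply: taylor2M => //; apply: taylor2V; first exact: g0.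
    apply: taylor2D; first exact: taylor2_cst.
    apply: taylor2M; first exact: taylor2_cst.
    by apply: taylor2D; [exact: taylor2_id | exact: taylor2_cst].
  - have hIm : `|Im x| = r0 -> normc (h x) <= B.
      move=> xr; apply: far => //.
        by apply: le_trans (ler_normc_Im x); rewrite xr; have := normr_ge0 c; lra.
      rewrite ler_pdivlMr //; apply: le_trans (ler_normc_Im _).
      rewrite Img normrM xr gtr0_norm // mulrC ler_pM2l //.
      by have := normr_ge0 c; lra.
    case=> [xc|xr|xi|xi].
    + rewrite normcM normcV ler_pdivrMr ?(lt_le_trans ltr01) ?g_ge1 //.
      by apply: le_trans (fc x xc) _; rewrite ler_peMr ?g_ge1 // ltW.
    + apply: far => //.
        apply: le_trans (ler_normc_Re x); apply: le_trans (ler_norm _); rewrite xr.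
        by have := ler_norm (- c); rewrite normrN; lra.
      rewrite ler_pdivlMr //; apply: le_trans (ler_normc_Re _); apply: le_trans (ler_norm _).
      rewrite Reg xr; have : 0 <= eps * `|c| by rewrite mulr_ge0 // ltW.
      by clear; lra.
    + by apply: hIm; rewrite xi normrN gtr0_norm.
    + by apply: hIm; rewrite xi gtr0_norm.
  - have := ler_normc_Re z; have := ler_normc_Im z; rewrite !ler_norml => /andP[i1 i2] /andP[k1 k2].
    have := ler_norm c; have := ler_norm (- c); rewrite normrN => c1 c2.
    clear -i1 i2 k1 k2 r0z c1 c2 cz; split; lra.
by rewrite leNgt hz.
Qed.

Definition square_boundary (rho : R) : set R[i] :=
  [set z | Num.max `|Re z| `|Im z| = rho].

Lemma square_boundary_rect rho z :
  square_boundary rho z -> rect (- rho) rho (- rho) rho z.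
Proof.
move=> zb; have : `|Re z| <= rho by rewrite -zb le_max lexx.
have : `|Im z| <= rho by rewrite -zb le_max lexx orbT.
by rewrite !ler_norml => /andP[? ?] /andP[? ?]; split.
Qed.

Lemma ccompact_square_boundary rho : ccompact (square_boundary rho).
Proof.
move=> V UV VD; have [|z [_ Vz]] := @ccompact_rect (- rho) rho (- rho) rho V UV.
  by apply: filterS VD; exact: square_boundary_rect.
exists z; split => //; apply: cvg_near_eq VD; case: Vz => re im.
rewrite maxr_absE; under eq_fun do rewrite maxr_absE.
have [cre cim] := (cvg_norm re, cvg_norm im).
by apply: cvgM; [apply: cvgD; [exact: cvgD | apply: cvg_norm; exact: cvgB] | exact: cvg_cst].
Qed.

(** The maximum principle for 1/f on a square. *)
Lemma square_minimum_principle f (rho : R) : 0 < rho ->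
  (forall z, rect (- rho) rho (- rho) rho z -> [/\ ccontinuous f z, taylor2 f z & f z != 0]) ->
  exists2 z, square_boundary rho z & normc (f z) <= normc (f 0).
Proof.
move=> rho0 fD; pose h x := normc (f x)^-1.
have bd0 : square_boundary rho !=set0.
  exists (rho%:C); rewrite /square_boundary /= normr0 gtr0_norm //.
  by apply/max_idPl; exact: ltW.
have [V [UV VD Vmax]] := @ultra_maximizing R _ (square_boundary rho) h bd0.
have [z0 [bz0 Vz0]] := ccompact_square_boundary UV VD; exists z0 => //.
have [cf0 _ fz0] := fD z0 (square_boundary_rect bz0).
have max0 x : square_boundary rho x -> h x <= h z0.
  move=> bx; apply: cvg_near_ge (Vmax x bx).
  by apply: cvg_normc; apply: ccvgV => //; exact: cf0.
have D0 : rect (- rho) rho (- rho) rho 0 by split => /=; lra.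
have [_ _ f00] := fD 0 D0.
have : normc (f 0)^-1 <= h z0.
  apply: (@rect_maximum_principle (- rho) rho (- rho) rho (fun x => (f x)^-1)) => //.
  - exact: normc_ge0.
  - move=> x Dx; have [cf tf fx] := fD x Dx.
    by split; [exact: ccontinuousV | exact: taylor2V].
  - move=> x [x1 x2 x3 x4] bx; apply: max0.
    have re : `|Re x| <= rho by rewrite ler_norml x1.
    have im : `|Im x| <= rho by rewrite ler_norml x3.
    apply/eqP; rewrite eq_le ge_max re im /= le_max.
    by case: bx => ->; rewrite ?normrN (gtr0_norm rho0) lexx ?orbT.
by rewrite /h !normcV lef_pV2 ?posrE ?normc_gt0.
Qed.

End Rectangles.

(** * Upper limits over perturbed delays *)

Section DelayLimsup.
Context {R : realType} {K : nat}.
Implicit Types (f : 'rV[R]_K -> \bar R) (tau : 'rV[R]_K).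

Lemma delay_limsupE f tau :
  delay_limsup f tau =
    ereal_inf [set ereal_sup (f @` delay_ball tau g) | g in [set g : R | 0 < g]].
Proof.
pose h g := ereal_sup (f @` delay_ball tau g).
have hcvg : h g @[g --> 0^'+] --> ereal_inf (h @` [set` `]0, +oo[]).
  apply: nondecreasing_at_right_cvge => // g1 g2 _ _ g12.
  apply: ereal_sup_le => _ [t [tg t0] <-].
  by exists t => //; split => //; exact: lt_le_trans g12.
have -> : delay_limsup f tau = ereal_inf (h @` [set` `]0, +oo[]) by exact/cvg_lim.
congr ereal_inf; apply/seteqP; split=> _ /= [g g0 <-]; exists g => //;
  by move: g0; rewrite /= in_itv /= andbT.
Qed.

Lemma delay_limsup_le f tau g : 0 < g ->
  (delay_limsup f tau <= ereal_sup (f @` delay_ball tau g))%E.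
Proof. by move=> g0; rewrite delay_limsupE; apply: ereal_inf_lbound; exists g. Qed.

Lemma le_delay_limsup f tau b :
  (forall g : R, 0 < g -> (b <= ereal_sup (f @` delay_ball tau g))%E) ->
  (b <= delay_limsup f tau)%E.
Proof.
move=> bf; rewrite delay_limsupE; apply: le_ereal_inf_tmp => _ [g g0 <-].
exact: bf.
Qed.

Lemma normr_le_frobenius a b (A : 'M[R]_(a, b)) i j : `|A i j| <= frobenius A.
Proof.
rewrite -sqrtr_sqr ler_wsqrtr // (bigD1 i) //= (bigD1 j) //= -addrA lerDl.
by rewrite addr_ge0 ?sumr_ge0 // => k _; rewrite ?sqr_ge0 ?sumr_ge0 // => l _; exact: sqr_ge0.
Qed.

Lemma frobenius_lt (A : 'rV[R]_K) (e g : R) : 0 < g ->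
  (forall k, `|A 0 k| <= e) -> e * K%:R < g -> frobenius A < g.
Proof.
move=> g0 Ae eK; apply: le_lt_trans eK.
case: K A Ae => [|k] A Ae; first by rewrite /frobenius big_ord1 big_ord0 sqrtr0 mulr0.
have e0 : 0 <= e by apply: le_trans (Ae ord0); exact: normr_ge0.
rewrite -[X in _ <= X]ger0_norm ?mulr_ge0 // -sqrtr_sqr ler_wsqrtr // big_ord1.
apply: (@le_trans _ _ (\sum_(j < k.+1) e ^+ 2)).
  by apply: ler_sum => j _; rewrite -real_normK ?num_real // ler_pXn2r ?nnegrE.
rewrite sumr_const card_ord exprMn -[X in X <= _]mulr_natr ler_wpM2l ?sqr_ge0 // -natrX ler_nat.
by rewrite -{1}[k.+1]expn1 leq_pexp2l.
Qed.

Lemma delay_ball_center tau g : 0 < g -> (forall k, 0 < tau 0 k) -> delay_ball tau g tau.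
Proof.
move=> g0 t0; split=> //; apply: (@frobenius_lt _ 0) => // [k|]; last by rewrite mul0r.
by rewrite subrr mxE normr0.
Qed.

Lemma sub_delay_ball tau g1 g2 : g1 <= g2 -> delay_ball tau g1 `<=` delay_ball tau g2.
Proof. by move=> g12 t [tg t0]; split => //; exact: lt_le_trans g12. Qed.

End DelayLimsup.

(** * Limits of transfer matrices *)

Section UncertaintyConvergence.
Context {R : realType} {L : nat} {q r : 'I_L -> nat} {I : Type}.

Definition dcvg (F : set_system I) (d : I -> uncertainty R q r)
    (delta : uncertainty R q r) :=
  forall l i j, (fun x => d x l i j) @ F --> delta l i j.

Lemma dcvg_cst (F : set_system I) {FF : Filter F} delta : dcvg F (fun=> delta) delta.
Proof. by move=> l i j; exact: cvg_cst. Qed.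

Lemma mcvg_um_eval (F : set_system I) {FF : Filter F} a b (U : uncertain_mx R q r a b)
    d delta : dcvg F d delta ->
  mcvg F (fun x => um_eval U (d x)) (um_eval U delta).
Proof.
have E D : um_eval U D = map_mx (real_complex R) (um_nominal U)
    + \sum_(l < L) \sum_(s < um_count U l)
       map_mx (real_complex R) (um_left s) *m map_mx (real_complex R) (D l)
         *m map_mx (real_complex R) (um_right s).
  rewrite /um_eval map_mxD; congr (_ + _); rewrite map_mx_sum; apply: eq_bigr => l _.
  by rewrite map_mx_sum; apply: eq_bigr => s _; rewrite !map_mxM.
move=> dd; rewrite E; apply: (mcvg_eq (fun x => esym (E (d x)))).
apply: mcvgD; first exact: mcvg_cst.
apply: mcvg_sum => l _; apply: mcvg_sum => s _.
apply: mcvgM; [apply: mcvgM; first exact: mcvg_cst | exact: mcvg_cst].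
move=> i j; rewrite mxE.
by apply: ccvg_eq (ccvg_real (dd l i j)) => x; rewrite mxE.
Qed.

Lemma cvg_frobenius (F : set_system I) {FF : Filter F} a b
    (M : I -> 'M[R]_(a, b)) (N : 'M[R]_(a, b)) :
  (forall i j, (fun x => M x i j) @ F --> N i j) ->
  (fun x => frobenius (M x)) @ F --> frobenius N.
Proof.
move=> MN; rewrite /frobenius; apply: continuous_cvg; first exact: sqrt_continuous.
have sumc (J : Type) (s : seq J) (f : J -> I -> R) (g : J -> R) :
    (forall j, f j @ F --> g j) ->
    (fun x => \sum_(j <- s) f j x) @ F --> \sum_(j <- s) g j.
  move=> fg; elim: s => [|j s IH].
    by under eq_fun do rewrite big_nil; rewrite big_nil; exact: cvg_cst.
  by under eq_fun do rewrite big_cons; rewrite big_cons; exact: cvgD (fg j) IH.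
apply: (sumc) => i; apply: (sumc) => j.
by under eq_fun do rewrite expr2; rewrite expr2; exact: cvgM.
Qed.

(** The uncertainties form a dependent family of matrices; entrywise limits give
    their compactness without a topology on the family. *)
Lemma ultra_uncertainty (V : set_system I) (dbar : 'I_L -> R)
    (d : I -> uncertainty R q r) : UltraFilter V ->
  (\forall x \near V, admissible dbar (d x)) ->
  exists delta, admissible dbar delta /\ dcvg V d delta.
Proof.
move=> UV dV.
have mE l : exists m : 'M[R]_(q l, r l),
    forall i j, (fun x => d x l i j) @ V --> m i j.
  have /choice [f fP] (ij : 'I_(q l) * 'I_(r l)) :
      exists y : R, (fun x => d x l ij.1 ij.2) @ V --> y.
    apply: (@ultra_cvg _ _ _ _ (dbar l)) => //; apply: filterS dV => x /(_ l).
    exact/le_trans/normr_le_frobenius.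
  by exists (\matrix_(i, j) f (i, j)) => i j; rewrite mxE; exact: (fP (i, j)).
pose m l := projT1 (cid (mE l)).
have mP l : forall i j, (fun x => d x l i j) @ V --> m l i j := projT2 (cid (mE l)).
exists m; split => // l; apply: cvg_near_le (cvg_frobenius (mP l)) _.
by apply: filterS dV => x; exact.
Qed.

End UncertaintyConvergence.

Section TransferLimits.
Context {R : realType} {n m p K L : nat} {q r : 'I_L -> nat}.
Variable S : uncertain_system R n m p K q r.

(** At high frequency small changes of the delays move the exponentials
    exp(- lambda tau_k) independently of each other, hence the free phases e_k. *)
Definition phased_eval a b (U : 'I_K.+1 -> uncertain_mx R q r a b)
    (delta : uncertainty R q r) (e : 'I_K -> R[i]) : 'M[R[i]]_(a, b) :=
  um_eval (U ord0) delta + \sum_(k < K) e k *: um_eval (U (lift ord0 k)) delta.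

(** The possible limits of transfer S delta tau' (j omega) as tau' tends to tau:
    along bounded frequencies the values of the nominal transfer function, along
    unbounded ones those of its direct feedthrough with arbitrary phases. *)
Definition limit_transfer (delta : uncertainty R q r) (tau : 'rV[R]_K)
    (N : 'M[R[i]]_(p, m)) : Prop :=
  (exists omega : R, N = transfer S delta tau (0 +i* omega)) \/
  (exists e : 'I_K -> R[i],
     (forall k, normc (e k) = 1) /\ N = phased_eval (sysD S) delta e).

Context {I : Type}.
Variable F : set_system I.
Context {FF : Filter F}.
Variables (d : I -> uncertainty R q r) (delta : uncertainty R q r).
Variables (t : I -> 'rV[R]_K) (lam : I -> R[i]).
Hypothesis dF : dcvg F d delta.

Lemma mcvg_delay_eval a b (U : 'I_K.+1 -> uncertain_mx R q r a b) e :
  (forall k, ccvg F (fun x => cexp (- lam x * (t x 0 k)%:C)) (e k)) ->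
  mcvg F (fun x => delay_eval U (d x) (t x) (lam x)) (phased_eval U delta e).
Proof.
move=> eF; apply: mcvgD; first exact: mcvg_um_eval.
by apply: mcvg_sum => k _; apply: mcvgZ => //; exact: mcvg_um_eval.
Qed.

Lemma ccvg_phases (tau : 'rV[R]_K) (l : R[i]) :
  (forall k, (fun x => t x 0 k) @ F --> tau 0 k) -> ccvg F lam l ->
  forall k, ccvg F (fun x => cexp (- lam x * (t x 0 k)%:C)) (cexp (- l * (tau 0 k)%:C)).
Proof.
move=> tF lF k; apply: ccvg_cexp; apply: ccvgM; first exact: ccvgN.
by apply: ccvg_real; exact: tF.
Qed.

Lemma transfer_limit_finite (tau : 'rV[R]_K) (l : R[i]) :
  (forall k, (fun x => t x 0 k) @ F --> tau 0 k) -> ccvg F lam l ->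
  \det (internal_char S delta tau l) != 0 ->
  (\forall x \near F, \det (internal_char S (d x) (t x) (lam x)) != 0) /\
  mcvg F (fun x => transfer S (d x) (t x) (lam x)) (transfer S delta tau l).
Proof.
move=> tF lF ld; have eF := ccvg_phases tF lF.
have intF : mcvg F (fun x => internal_char S (d x) (t x) (lam x))
                  (internal_char S delta tau l).
  by apply: mcvgB; [exact: mcvg_scalar | exact: mcvg_delay_eval eF].
split; first exact: ccvg_neq0 (ccvg_det intF).
apply: mcvgD; last exact: mcvg_delay_eval eF.
apply: mcvgM; last exact: mcvg_delay_eval eF.
apply: mcvgM; first exact: mcvg_delay_eval eF.
by apply: mcvg_inv => //; rewrite unitmxE unitfE.
Qed.

(** At high frequency the resolvent lam^-1 (1 - lam^-1 A)^-1 vanishes. *)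
Lemma transfer_limit_infinite (e : 'I_K -> R[i]) :
  (forall b : R, \forall x \near F, b < normc (lam x)) ->
  (forall k, ccvg F (fun x => cexp (- lam x * (t x 0 k)%:C)) (e k)) ->
  (\forall x \near F, \det (internal_char S (d x) (t x) (lam x)) != 0) /\
  mcvg F (fun x => transfer S (d x) (t x) (lam x)) (phased_eval (sysD S) delta e).
Proof.
move=> lF eF.
have lam0 : \forall x \near F, lam x != 0.
  by apply: filterS (lF 0) => x; rewrite normc_gt0.
have lamV : ccvg F (fun x => (lam x)^-1) 0.
  apply/ccvg0P/cvgr0Pnorm_lt => eps eps0; apply: filterS (lF eps^-1) => x lx.
  have lx0 : 0 < normc (lam x) by apply: lt_trans lx; rewrite invr_gt0.
  by rewrite ger0_norm ?normc_ge0 // normcV invf_plt ?posrE.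
pose G x := 1%:M - (lam x)^-1 *: delay_eval (sysA S) (d x) (t x) (lam x).
have GF : mcvg F G 1%:M.
  rewrite -[X in mcvg F G X]subr0 -(scale0r (phased_eval (sysA S) delta e)).
  by apply: mcvgB; [exact: mcvg_cst | apply: mcvgZ => //; exact: mcvg_delay_eval].
have GE x : lam x != 0 -> internal_char S (d x) (t x) (lam x) = lam x *: G x.
  by move=> l0; rewrite scalerBr scalerA divff // scale1r scalemx1.
have G0 : \forall x \near F, \det (G x) != 0.
  by apply: ccvg_neq0 (ccvg_det GF); rewrite det1 oner_neq0.
split.
  apply: filterS2 lam0 G0 => x l0 g0.
  by rewrite (GE _ l0) detZ; apply: mulf_neq0 g0; exact: expf_neq0.
rewrite -[X in mcvg F _ X]add0r.
apply: mcvgD; last exact: mcvg_delay_eval eF.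
have -> : 0 = phased_eval (sysC S) delta e *m 0 *m phased_eval (sysB S) delta e.
  by rewrite mulmx0 mul0mx.
apply: mcvgM; last exact: mcvg_delay_eval eF.
apply: mcvgM; first exact: mcvg_delay_eval eF.
apply: (@mcvg_near _ _ _ _ _ _ (fun x => (lam x)^-1 *: invmx (G x))).
  apply: filterS2 lam0 G0 => x l0 g0; rewrite (GE _ l0) invmxZ //.
  by rewrite unitmxE unitfE detZ; apply: mulf_neq0 g0; exact: expf_neq0.
rewrite -(scale0r (invmx 1%:M)); apply: mcvgZ => //.
by apply: mcvg_inv => //; exact: unitmx1.
Qed.

End TransferLimits.

Section DelayUltrafilters.
Context {R : realType} {K : nat} {I : Type}.

Lemma near_delay_ball (F : set_system I) {FF : Filter F} (t : I -> 'rV[R]_K)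
    (tau : 'rV[R]_K) (g : R) :
  0 < g -> (forall k, 0 < tau 0 k) ->
  (forall k, (fun x => t x 0 k) @ F --> tau 0 k) ->
  \forall x \near F, delay_ball tau g (t x).
Proof.
move=> g0 tau0 tF; pose e := g / (K.+1)%:R.
have e0 : 0 < e by rewrite divr_gt0 // ltr0n.
have H : \forall x \near F, forall k, 0 < t x 0 k /\ `|t x 0 k - tau 0 k| <= e.
  apply: filter_forall => k.
  have t0 : \forall x \near F, 0 < t x 0 k by exact: (cvgr_gt _ (tF k)).
  have tk : \forall x \near F, `|tau 0 k - t x 0 k| <= e.
    by move/cvgrPdist_le : (tF k) => /(_ e e0).
  by apply: filterS2 t0 tk => x x0; rewrite distrC.
apply: filterS H => x xH; split; last by move=> k; have [] := xH k.
apply: (@frobenius_lt _ _ _ e) => // [k|]; first by rewrite !mxE; have [] := xH k.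
by rewrite /e mulrAC ltr_pdivrMr ?ltr0n // ltr_pM2l // ltr_nat.
Qed.

Lemma cvg_delay_ball (F : set_system I) {FF : Filter F} (t : I -> 'rV[R]_K) (tau : 'rV[R]_K) :
  (forall g : R, 0 < g -> \forall x \near F, delay_ball tau g (t x)) ->
  forall k, (fun x => t x 0 k) @ F --> tau 0 k.
Proof.
move=> tF k; apply/cvgrPdist_lt => e e0; apply: filterS (tF e e0) => x [+ _].
apply: le_lt_trans; rewrite distrC.
by have := normr_le_frobenius (t x - tau) 0 k; rewrite !mxE.
Qed.

(** A lower bound on the real part bounds the exponentials, so that they converge
    along the ultrafilter even when the frequency does not. *)
Lemma frequency_dichotomy (V : set_system I) (t : I -> 'rV[R]_K) (tau : 'rV[R]_K)
    (lam : I -> R[i]) (c : R) : UltraFilter V ->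
  (forall k, 0 < tau 0 k) ->
  (forall k, (fun x => t x 0 k) @ V --> tau 0 k) ->
  (\forall x \near V, c <= Re (lam x)) ->
  (exists l, ccvg V lam l) \/
  ((forall b : R, \forall x \near V, b < normc (lam x)) /\
   exists e : 'I_K -> R[i],
     forall k, ccvg V (fun x => cexp (- lam x * (t x 0 k)%:C)) (e k)).
Proof.
move=> UV tau0 tV cV; have [[b lb]|linf] := ultra_dichotomy (fun x => normc (lam x)) UV.
  by left; exact: ultra_ccvg lb.
right; split => //.
suff /choice [e eP] : forall k, exists l,
    ccvg V (fun x => cexp (- lam x * (t x 0 k)%:C)) l by exists e.
move=> k.
apply: (@ultra_ccvg _ _ _ _ (expR (`|c| * (tau 0 k + 1)))) => //.
have t0 : \forall x \near V, 0 < t x 0 k by exact: cvgr_gt (tV k) _ (tau0 k).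
have t1 : \forall x \near V, t x 0 k < tau 0 k + 1.
  by apply: cvgr_lt (tV k) _ _; rewrite ltrDl.
apply: filterS3 cV t0 t1 => x cx x0 x1.
rewrite normc_cexp ler_expR ReM ReN ImN /= mulr0 subr0.
apply: (@le_trans _ _ (`|c| * t x 0 k)); last by rewrite ler_wpM2l // ltW.
by rewrite ler_wpM2r ?(ltW x0) //; have := ler_norm (- c); rewrite normrN; lra.
Qed.

Lemma phase_angle (e : R[i]) : normc e = 1 -> exists th : R, e = cos th -i* sin th.
Proof.
case: e => a b e1; have ab : a ^+ 2 + b ^+ 2 = 1.
  by have := sqr_normcE (a +i* b); rewrite e1 expr1n /= => ->.
have a1 : -1 <= a <= 1.
  by rewrite -ler_norml -(@ler_pXn2r _ 2) ?nnegrE // real_normK ?num_real // expr1n -ab lerDl sqr_ge0.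
have sb : Num.sqrt (1 - a ^+ 2) = `|b| by rewrite -ab addrC addKr sqrtr_sqr.
have [b0|b0] := leP b 0.
  exists (acos a); rewrite acosK ?in_itv //= sin_acos // sb ler0_norm // opprK //.
exists (- acos a); rewrite cosN sinN acosK ?in_itv //= sin_acos // sb gtr0_norm //.
by rewrite opprK.
Qed.

(** Arbitrarily small changes of the delays realise any prescribed phases at
    high frequency: take tau_k' = (theta_k + 2 pi N_k) / omega. *)
Lemma phase_realization (tau : 'rV[R]_K) (e : 'I_K -> R[i]) :
  (forall k, 0 < tau 0 k) -> (forall k, normc (e k) = 1) ->
  exists t : nat -> 'rV[R]_K,
    (forall k, (fun i => t i 0 k) @ \oo --> tau 0 k) /\
    (forall i k, cexp (- (0 +i* (i.+1%:R)) * (t i 0 k)%:C) = e k).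
Proof.
move=> tau0 e1; have /choice [th thE] k := phase_angle (e1 k).
have twopi : 0 < (pi : R) *+ 2 by rewrite mulrn_wgt0 // pi_gt0.
pose N (i : nat) k := Num.truncn (i.+1%:R * tau 0 k / (pi *+ 2)).
exists (fun i => \row_k ((th k + (pi *+ 2) *+ N i k) / i.+1%:R)); split => [k|i k]; last first.
  have i0 : i.+1%:R != 0 :> R by rewrite pnatr_eq0.
  rewrite mxE; set y := _ / _.
  have -> : - (0 +i* i.+1%:R) * y%:C = 0 +i* (- (i.+1%:R * y)).
    by apply: complex_ext; rewrite ?(ReM, ImM, ReN, ImN) /=; ring.
  rewrite /cexp /= expR0 /y [_ * (_ / _)]mulrC divfK // cosN sinN.
  rewrite (periodicn (@cosD2pi R)) (periodicn (@sinD2pi R)) thE.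
  by apply: complex_ext; rewrite ?(ReM, ImM) /=; ring.
have harm : (fun i : nat => (`|th k| + pi *+ 2) * harmonic i) @ \oo --> (0 : R).
  rewrite -[X in _ --> X](mulr0 (`|th k| + pi *+ 2)).
  by apply: cvgM; [exact: cvg_cst | exact: cvg_harmonic].
apply/cvgrPdist_le => eps eps0.
move/cvgrPdist_le : harm => /(_ eps eps0); apply: filterS => i.
rewrite sub0r normrN => he; apply: le_trans (le_trans (ler_norm _) he).
have i0 : 0 < i.+1%:R :> R by rewrite ltr0n.
rewrite mxE /harmonic /= ler_pdivlMr // -[X in _ * X](ger0_norm (ltW i0)).
rewrite -normrM mulrBl divfK ?gt_eqF //.
have y0 : 0 <= i.+1%:R * tau 0 k / (pi *+ 2).
  by rewrite divr_ge0 ?mulr_ge0 ?(ltW twopi) ?(ltW i0) ?(ltW (tau0 k)).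
have /andP[] := truncn_itv y0.
rewrite -/(N i k) ler_pdivlMr // ltr_pdivrMr // -[(N i k).+1%:R]natr1 mulrDl mul1r => h1 h2.
rewrite -[pi *+ 2 *+ N i k]mulr_natl.
have -> : tau 0 k * i.+1%:R - (th k + (N i k)%:R * (pi *+ 2))
       = (i.+1%:R * tau 0 k - (N i k)%:R * (pi *+ 2)) - th k by ring.
apply: le_trans (ler_normB _ _) _; rewrite addrC lerD2l ger0_norm; lra.
Qed.

End DelayUltrafilters.

(** * The strong norm and its maximisation over the uncertainties *)

Section StrongNorm.
Context {R : realType} {n m p K L : nat} {q r : 'I_L -> nat}.
Variable S : uncertain_system R n m p K q r.
Hypothesis m_gt0 : (0 < m)%N.
Variable tau : 'rV[R]_K.
Hypothesis tau_gt0 : forall k, 0 < tau 0 k.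

Lemma near_frequency_lt (b : R) : \forall i \near \oo, b < i.+1%:R.
Proof.
by apply: filterS (nbhs_infty_ger b) => i /= bi; rewrite (le_lt_trans bi) // ltr_nat.
Qed.

Lemma Hinf_norm_ge delta (t : 'rV[R]_K) (omega : R) :
  ((sigma1 (transfer S delta t (0 +i* omega)))%:E <= Hinf_norm S delta t)%E.
Proof. by apply: ereal_sup_ubound; exists omega. Qed.

(** At a value of the nominal transfer function the delays tau themselves will do;
    a limit with free phases is approached along delays tending to tau. *)
Lemma limit_transfer_le_strong (delta : uncertainty R q r) N :
  limit_transfer S delta tau N -> ((sigma1 N)%:E <= strong_Hinf_norm S delta tau)%E.
Proof.
move=> NX; apply: le_delay_limsup => g g0.
have supP (t : 'rV[R]_K) : delay_ball tau g t ->
    (Hinf_norm S delta t <= ereal_sup (Hinf_norm S delta @` delay_ball tau g))%E.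
  by move=> tg; apply: ereal_sup_ubound; exists t.
case: NX => [[omega ->]|[e [e1 ->]]].
  apply: le_trans (supP _ (delay_ball_center g0 tau_gt0)); exact: Hinf_norm_ge.
have [t [tF te]] := phase_realization tau_gt0 e1.
have [_ TF] : (\forall i \near \oo, \det (internal_char S delta (t i) (0 +i* i.+1%:R)) != 0) /\
    mcvg \oo (fun i => transfer S delta (t i) (0 +i* i.+1%:R)) (phased_eval (sysD S) delta e).
  apply: (@transfer_limit_infinite _ _ _ _ _ _ _ _ S _ _ _ (fun=> delta) delta) => [||k].
  - exact: dcvg_cst.
  - move=> b; apply: filterS (near_frequency_lt b) => i /lt_le_trans; apply.
    by have := ler_normc_Im (0 +i* i.+1%:R : R[i]); rewrite [Im _]/= ger0_norm ?ler0n.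
  - by apply: (@ccvg_eq _ _ _ _ (fun=> e k)) => [i|]; [rewrite te | exact: ccvg_cst].
have [w [w1 wN _]] := sigma1_attained (phased_eval (sysD S) delta e) m_gt0.
apply/lee_addgt0Pr => eps eps0; rewrite -leeBlDr // -EFinB.
have near1 : \forall i \near \oo,
    sigma1 (phased_eval (sysD S) delta e) - eps
      < enorm (transfer S delta (t i) (0 +i* i.+1%:R) *m w).
  by apply: (cvgr_gt _ (cvg_enorm (mcvgM TF (mcvg_cst w)))); rewrite wN gtrBl.
have [i [h1 h2]] := filter_ex (filterI near1 (near_delay_ball g0 tau_gt0 tF)).
apply: le_trans (supP _ h2); apply: le_trans (Hinf_norm_ge _ _ i.+1%:R).
rewrite lee_fin (le_trans (ltW h1)) //.
by have := enorm_mulmx_sigma1 (transfer S delta (t i) (0 +i* i.+1%:R)) w; rewrite w1 mulr1.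
Qed.

(** The limit set misses no accumulation point: a bounded frequency converges to
    a point of the imaginary axis, where stability makes the resolvent continuous,
    and an unbounded one leaves phases of modulus exp(0) = 1. *)
Lemma transfer_cluster {I : Type} (V : set_system I) (d : I -> uncertainty R q r)
    delta (t : I -> 'rV[R]_K) (lam : I -> R[i]) : UltraFilter V ->
  internally_exp_stable S delta tau ->
  dcvg V d delta -> (forall k, (fun x => t x 0 k) @ V --> tau 0 k) ->
  (fun x => Re (lam x)) @ V --> (0 : R) ->
  exists N, limit_transfer S delta tau N /\
    mcvg V (fun x => transfer S (d x) (t x) (lam x)) N.
Proof.
move=> UV st dV tV lam0.
have lamN1 : \forall x \near V, -1 <= Re (lam x).
  have lam1 : \forall x \near V, -1 < Re (lam x) by apply: (cvgr_gt _ lam0); rewrite ltrN10.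
  by apply: filterS lam1 => x /ltW.
have [[l lV]|[linf [e eV]]] := frequency_dichotomy UV tau_gt0 tV lamN1.
  have Rl : Re l = 0 by case: lV => lr _; exact: (cvg_unique _ lr lam0).
  have lE : l = 0 +i* Im l by case: l Rl {lV} => ? ? /= ->.
  have ld : \det (internal_char S delta tau l) != 0.
    by apply/negP => /eqP /st; rewrite Rl ltxx.
  exists (transfer S delta tau l); split; first by left; exists (Im l); rewrite -lE.
  by have [] := transfer_limit_finite dV tV lV ld.
exists (phased_eval (sysD S) delta e); split; last first.
  by have [] := transfer_limit_infinite S dV linf eV.
right; exists e; split => // k.
have ek : (fun x => normc (cexp (- lam x * (t x 0 k)%:C))) @ V --> (1 : R).
  under eq_fun do rewrite normc_cexp ReM ReN ImN /= mulr0 subr0.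
  rewrite -(@expR0 R) -[X in expR X](mul0r (tau 0 k)) -[X in X * _]oppr0.
  apply: continuous_cvg; first exact: continuous_expR.
  by apply: cvgM => //; exact: cvgN.
exact: (cvg_unique _ (cvg_normc (eV k)) ek).
Qed.

Variable dbar : 'I_L -> R.
Hypothesis stable : forall delta : uncertainty R q r,
  admissible dbar delta -> internally_exp_stable S delta tau.

(** The maximum over the uncertainties is attained because near-maximisers, in
    which the uncertainty, the delays and the frequency all vary at the same time,
    accumulate at a limit matrix of a single uncertainty. *)
Lemma worst_limit_transfer (delta0 : uncertainty R q r) : admissible dbar delta0 ->
  exists delta N, [/\ admissible dbar delta, limit_transfer S delta tau N &
    forall delta', admissible dbar delta' ->
      (strong_Hinf_norm S delta' tau <= (sigma1 N)%:E)%E].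
Proof.
move=> adm0.
pose worst t := ereal_sup [set Hinf_norm S delta t | delta in admissible dbar].
pose v := delay_limsup worst tau.
have strong_le delta : admissible dbar delta -> (strong_Hinf_norm S delta tau <= v)%E.
  move=> adm; apply: le_delay_limsup => g g0; apply: le_trans (delay_limsup_le _ _ g0) _.
  apply: ge_ereal_sup => _ [t tg <-]; apply: (@le_trans _ _ (worst t)).
    by apply: ereal_sup_ubound; exists delta.
  by apply: ereal_sup_ubound; exists t.
have v_ge0 : (0 <= v)%E.
  apply: le_trans (strong_le _ adm0).
  apply: le_trans (limit_transfer_le_strong (or_introl (ex_intro _ 0 erefl))).
  by rewrite lee_fin; exact: sigma1_ge0.
(* the near-maximisers form the base of a filter *)
pose B (gb : R * R) := [set x : uncertainty R q r * 'rV[R]_K * R |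
  [/\ admissible dbar x.1.1, delay_ball tau gb.1 x.1.2 &
      gb.2 < sigma1 (transfer S x.1.1 x.1.2 (0 +i* x.2))]].
pose D := [set gb : R * R | 0 < gb.1 /\ (gb.2%:E < v)%E].
have PF : ProperFilter (filter_from D B).
  apply: filter_from_proper.
    apply: filter_from_filter.
      by exists (1, -1); split => //=; apply: lt_le_trans v_ge0; rewrite lte_fin ltrN10.
    move=> [g1 b1] [g2 b2] [/= g1_gt0 b1v] [/= g2_gt0 b2v].
    exists (Num.min g1 g2, Num.max b1 b2).
      by split => /=; [rewrite lt_min g1_gt0 | rewrite EFin_max gt_max b1v].
    move=> x [adm ball /=]; rewrite gt_max => /andP[lt1 lt2]; split; split => //=;
      apply: sub_delay_ball ball; by rewrite /= ge_min lexx ?orbT.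
  move=> [g b] [/= g0 bv].
  have /ereal_sup_gt [_ [t tg <-]] := lt_le_trans bv (delay_limsup_le worst tau g0).
  move=> /ereal_sup_gt [_ [delta adm <-]] /ereal_sup_gt [_ [omega _ <-]] bs.
  by exists (delta, t, omega); split.
have [V [UV FV]] := ultraFilterLemma PF.
have VB g b : 0 < g -> (b%:E < v)%E -> V (B (g, b)) by move=> g0 bv; apply: FV; exists (g, b).
have vN1 : ((-1)%:E < v)%E by apply: lt_le_trans v_ge0; rewrite lte_fin ltrN10.
have [|delta [adm dV]] := @ultra_uncertainty R L q r _ V dbar (fun x => x.1.1) UV.
  by apply: filterS (VB 1 (-1) ltr01 vN1) => x [].
have tV : forall k, (fun x : uncertainty R q r * 'rV[R]_K * R => x.1.2 0 k) @ V --> tau 0 k.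
  apply: cvg_delay_ball => g g0.
  by apply: filterS (VB g (-1) g0 vN1) => x [].
have [|N [NX NV]] := transfer_cluster (lam := fun x => 0 +i* x.2) UV (stable adm) dV tV.
  exact: cvg_cst.
exists delta, N; split => // delta' adm'; apply: le_trans (strong_le _ adm') _.
have N_ge (b : R) : (b%:E < v)%E -> b <= sigma1 N.
  move=> bv; apply: cvg_sigma1_ge NV _ => //.
  by apply: filterS (VB 1 b ltr01 bv) => x [_ _ /ltW].
rewrite leNgt; apply/negP; case: (v) v_ge0 N_ge => [u| |] // _ N_ge.
  rewrite lte_fin => Nu; have : (sigma1 N + u) / 2 <= sigma1 N.
    by apply: N_ge; rewrite lte_fin; lra.
  by lra.
move=> _; have : sigma1 N + 1 <= sigma1 N by apply: N_ge; exact: ltry.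
by lra.
Qed.

End StrongNorm.

(** * Jordan normal form *)

Definition jordan_block (F : fieldType) (k : nat) (a : F) : 'M[F]_k :=
  \matrix_(i, j) (a *+ (j == i :> nat) + (j == i.+1 :> nat)%:R).

Lemma jordan_form_block (F : fieldType) k k' (a : F) (J : 'M[F]_k') :
  jordan_form J -> jordan_form (block_mx (jordan_block k a) 0 0 J).
Proof.
move=> [J0 J1]; split=> x y.
- rewrite -[x]fintype.splitK -[y]fintype.splitK.
  case: (fintype.split x) => i'; case: (fintype.split y) => j' /= ji jSi;
    rewrite ?block_mxEul ?block_mxEur ?block_mxEdl ?block_mxEdr ?mxE //=.
  + by rewrite (negPf ji) (negPf jSi) mulr0n addr0.
  + by apply: J0; [move: ji|move: jSi]; rewrite -?addnS eqn_add2l.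
- rewrite -[x]fintype.splitK -[y]fintype.splitK.
  case: (fintype.split x) => i'; case: (fintype.split y) => j' /= ji;
    rewrite ?block_mxEul ?block_mxEur ?block_mxEdl ?block_mxEdr ?mxE //=.
  + have {}ji : j' = i'.+1 :> nat by [].
    have SnF (c : nat) : (c.+1 == c) = false by rewrite gtn_eqF.
    have nSF (c : nat) : (c == c.+1) = false by rewrite ltn_eqF.
    by right; rewrite ji !eqxx SnF !nSF !addr0 add0r.
  + by left.
  + by left.
  + by apply: J1; move/eqP: ji; rewrite -addnS eqn_add2l => /eqP.
Qed.

(** Pairing the minimal polynomial (X - a)^k.+1 q of A with the square of q
    isolates the generalised eigenspace: since X - a does not divide q, the
    matrix N^k q(A)^2 is nonzero, and q(A) can be shared between a row u and a
    column phi that are both annihilated by N^k.+1. *)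
Lemma longest_chain (F : closedFieldType) n (A : 'M[F]_n.+1) :
  exists (a : F) (k : nat) (u : 'rV[F]_n.+1) (phi : 'cV[F]_n.+1),
    let N := A - a%:M in
    [/\ u *m N ^+ k.+1 = 0, N ^+ k.+1 *m phi = 0 & u *m N ^+ k *m phi != 0].
Proof.
pose mu := mxminpoly A.
have mu0 : mu != 0 by apply: monic_neq0; exact: mxminpoly_monic.
have [a ra] : exists a, root mu a.
  by apply/closed_rootP; rewrite size_mxminpoly eqSS -lt0n mxminpoly_nonconstant.
have [m [q]] := multiplicity_XsubC mu a; rewrite mu0 /= => qa muE.
have m_gt0 : (0 < m)%N.
  by case: m muE ra => // ->; rewrite expr0 mulr1 (negPf qa).
case: m m_gt0 muE => // k _ muE.
pose E := horner_mx A q; pose N := A - a%:M.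
have NE : horner_mx A ('X - a%:P) = N by rewrite rmorphB /= horner_mx_X horner_mx_C.
have NX i : horner_mx A (('X - a%:P) ^+ i) = N ^+ i by rewrite rmorphXn /= NE.
have EN i : E *m N ^+ i = N ^+ i *m E by rewrite -NX; exact: comm_horner_mx2.
have NE0 : N ^+ k.+1 *m E = 0.
  rewrite -NX mulmxE -rmorphM /= mulrC -muE; exact: mx_root_minpoly.
have NEE : E *m N ^+ k *m E != 0.
  apply/eqP; rewrite -NX !mulmxE -!rmorphM /= => /mxminpoly_min.
  rewrite -/mu muE exprS mulrA -[q * _ * q]mulrC mulrA dvdp_mul2r; last first.
    by rewrite expf_neq0 // polyXsubC_eq0.
  move=> qXqq; have q0 : q != 0 by apply: contraNneq qa => ->; rewrite root0.
  by move: qXqq; rewrite dvdp_mul2l // dvdp_XsubCl (negPf qa).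
have [i [j ij]] : exists i j, (E *m N ^+ k *m E) i j != 0.
  by case/matrix0Pn: NEE => i [j ij]; exists i, j.
exists a, k, (delta_mx 0 i *m E), (E *m delta_mx j 0) => /=; rewrite -/N; split.
- by rewrite -mulmxA EN NE0 mulmx0.
- by rewrite mulmxA NE0 mul0mx.
- have -> : delta_mx 0 i *m E *m N ^+ k *m (E *m delta_mx j 0)
          = delta_mx 0 i *m (E *m N ^+ k *m E) *m delta_mx j 0 :> 'M[F]_1.
    by rewrite !mulmxA.
  rewrite -rowE -colE; apply: contraNneq ij => /matrixP /(_ 0 0).
  by rewrite !mxE => ->.
Qed.

(** The span of the chain u, uN, ..., uN^k has the invariant complement
    { x : x N^j phi = 0 for all j <= k }: the matrix of the pairings
    u N^i N^(k-j) phi is triangular with the nonzero entry u N^k phi on its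
    diagonal, so the two subspaces are in direct sum. *)
Lemma jordan_block_split (F : closedFieldType) n (A : 'M[F]_n.+1) :
  exists (k n' : nat) (a : F) (U : 'M[F]_(k.+1, n.+1)) (B : 'M[F]_(n', n.+1))
         (A' : 'M[F]_n'),
    [/\ (k.+1 + n')%N = n.+1, row_free (col_mx U B),
        U *m A = jordan_block k.+1 a *m U & B *m A = A' *m B].
Proof.
have [a [k [u [phi]]]] := longest_chain A; set N := A - _ => /= -[uN Nphi uNphi].
have u_far i : (k < i)%N -> u *m N ^+ i = 0.
  by move=> ki; rewrite -(subnKC ki) exprD -mulmxE mulmxA uN mul0mx.
have phi_far i : (k < i)%N -> N ^+ i *m phi = 0.
  by move=> ki; rewrite -(subnK ki) exprD -mulmxE -mulmxA Nphi mulmx0.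
pose U := \matrix_(i < k.+1) (u *m N ^+ i).
pose G := \matrix_(i < n.+1, j < k.+1) (N ^+ (k - j) *m phi) i 0.
have mulG m (x : 'M[F]_(m, n.+1)) : x *m G = \matrix_(i < m, j < k.+1) (x *m N ^+ (k - j) *m phi) i 0.
  apply/matrixP => i j; rewrite [RHS]mxE -mulmxA !mxE; apply: eq_bigr => l _.
  by rewrite !mxE.
have rowU i (X : 'M[F]_n.+1) : (U *m X *m phi) i 0 = (u *m N ^+ i *m X *m phi) 0 0.
  by rewrite -(rowK (fun i : 'I_k.+1 => u *m N ^+ i) i) -/U -!row_mul [RHS]mxE.
have UG_unit : U *m G \in unitmx.
  rewrite -unitmx_tr unitmxE det_trig.
    rewrite unitfE; apply/prodf_neq0 => i _; rewrite mxE mulG mxE.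
    have -> : (U *m N ^+ (k - i) *m phi) i 0 = (u *m N ^+ k *m phi) 0 0.
      by rewrite rowU -[u *m _ *m _]mulmxA mulmxE -exprD subnKC // -ltnS.
    by apply: contraNneq uNphi => u0; apply/eqP/matrixP => x y; rewrite !ord1 u0 mxE.
  apply/is_trig_mxP => i j ij; rewrite mxE mulG mxE.
  have -> : (U *m N ^+ (k - i) *m phi) j 0 = (u *m N ^+ (k + (j - i)) *m phi) 0 0.
    rewrite rowU -[u *m _ *m _]mulmxA mulmxE -exprD; congr ((_ *m _ ^+ _ *m _) _ _).
    by have := ltn_ord i; have := ij; lia.
  by rewrite u_far ?mul0mx ?mxE // -[X in (X < _)%N]addn0 ltn_add2l subn_gt0.
have rkG : \rank G = k.+1.
  apply/eqP; rewrite eqn_leq rank_leq_col /=.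
  by rewrite -[X in (X <= _)%N](mxrank_unit UG_unit) mxrankM_maxr.
pose B := row_base (kermx G).
have BG : B *m G = 0 by apply/sub_kermxP; rewrite eq_row_base.
have sB m (x : 'M[F]_(m, n.+1)) : x *m G = 0 -> (x <= B)%MS.
  by move=> xG; rewrite eq_row_base; apply/sub_kermxP.
have UA : U *m A = jordan_block k.+1 a *m U.
  have -> : A = N + a%:M by rewrite subrK.
  have -> : jordan_block k.+1 a = jordan_block k.+1 0 + a%:M :> 'M[F]_k.+1.
    by apply/matrixP => i j; rewrite !mxE mul0rn add0r addrC eq_sym.
  rewrite mulmxDr mulmxDl scalar_mxC; congr (_ + _).
  apply/row_matrixP => i; rewrite !row_mul rowK -mulmxA mulmxE -exprSr.
  have [ik|ki] := ltnP i k.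
    have -> : row i (jordan_block k.+1 0) = delta_mx 0 (Ordinal (ik : (i.+1 < k.+1)%N)) :> 'rV[F]_k.+1.
      by apply/rowP => j; rewrite !mxE mul0rn add0r eqxx.
    by rewrite -rowE rowK.
  rewrite u_far ?ltnS //.
  have -> : row i (jordan_block k.+1 0) = 0 :> 'rV[F]_k.+1.
    apply/rowP => j; rewrite !mxE mul0rn add0r.
    by rewrite ltn_eqF // (leq_trans (ltn_ord j)) // ltnS.
  by rewrite mul0mx.
exists k, (\rank (kermx G)), a, U, B, (B *m A *m pinvmx B); split=> //.
- by rewrite mxrank_ker rkG subnKC // -rkG rank_leq_row.
- rewrite -kermx_eq0; apply/eqP/row_matrixP => i; rewrite row0.
  have := mulmx_ker (col_mx U B) => /(congr1 (row i)); rewrite row_mul row0.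
  set w := row i _; rewrite -[w]hsubmxK mul_row_col => wUB.
  have l0 : lsubmx w = 0.
    apply: (can_inj (mulmxK UG_unit)); rewrite mul0mx mulmxA.
    have -> : lsubmx w *m U = - (rsubmx w *m B) by apply/eqP; rewrite -addr_eq0 wUB.
    by rewrite mulNmx -mulmxA BG mulmx0 oppr0.
  have r0 : rsubmx w = 0.
    apply: (row_free_inj (row_base_free (kermx G))); rewrite mul0mx.
    by move: wUB; rewrite l0 mul0mx add0r.
  by rewrite l0 r0 row_mx0.
- rewrite mulmxKpV //; apply: sB.
  have -> : A = N + a%:M by rewrite subrK.
  rewrite mulmxDr mulmxDl mul_mx_scalar -scalemxAl BG scaler0 addr0.
  move: BG; rewrite !mulG => /matrixP BG; apply/matrixP => i j.
  rewrite [LHS]mxE [RHS]mxE -(mulmxA B) mulmxE -exprS.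
  have [j0|j_gt0] := posnP j.
    by rewrite j0 subn0 -mulmxA phi_far // mulmx0 mxE.
  have jk : (j.-1 < k.+1)%N by rewrite (leq_ltn_trans (leq_pred _)).
  have <- : (k - j.-1)%N = (k - j).+1 by have := ltn_ord j; lia.
  by have := BG i (Ordinal jk); rewrite [LHS]mxE [RHS]mxE.
Qed.

Theorem jordan_normal_form (F : closedFieldType) n (A : 'M[F]_n) :
  exists P J : 'M[F]_n, [/\ P \in unitmx, jordan_form J & P *m A = J *m P].
Proof.
have [N] := ubnP n; elim: N n A => // N IH [|n] A ltnN.
  by exists 1%:M, 0; split; [exact: unitmx1 | split=> -[] | apply/matrixP => -[]].
have [k [n' [a [U [B [A' [en free UA BA]]]]]]] := jordan_block_split A.
have [|P' [J' [P'u J'J P'A']]] := IH n' A'.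
  by move: ltnN en; lia.
pose P1 := block_mx 1%:M 0 0 P' *m col_mx U B.
pose J1 := block_mx (jordan_block k.+1 a) 0 0 J'.
have P1A : P1 *m A = J1 *m P1.
  rewrite {1}/P1 -mulmxA (mul_col_mx U) UA BA /J1 /P1 !mul_block_col !mul0mx !mul1mx.
  by rewrite ?mul0mx !addr0 !add0r !mulmxA P'A'.
have P1f : row_free P1.
  rewrite /row_free mxrankMfree // -/(row_free _) row_free_unit unitmxE.
  by rewrite det_ublock det1 mul1r -unitmxE.
have J1J : jordan_form J1 by exact: jordan_form_block.
move: P1 J1 P1A P1f J1J; rewrite en => P1 J1 P1A P1f J1J.
by exists P1, J1; rewrite -row_free_unit.
Qed.

(** * The characteristic matrix *)

Section Pencils.
Context {F : fieldType}.

(** In a Weierstrass form with vanishing nilpotent block the kernel of E is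
    mapped by A onto a complement of the range of E. *)
Lemma index_le1_kernel N (E A : 'M[F]_N) nu (u v : 'cV[F]_N) :
  pencil_index E A nu -> (nu <= 1)%N -> E *m v = 0 -> A *m v = E *m u -> v = 0.
Proof.
move=> [mu [eta [eN [J [Nil [[_ _ _ [W [Z [Wu Zu WEZ WAZ]]]] Nnu _]]]]]] nu1 Ev Av.
have Nil0 : Nil = 0.
  case: nu nu1 Nnu => [|[|//]] _; last by rewrite expr1.
  by rewrite expr0 => N1; rewrite -[Nil]mul1mx -[1%:M]/(1 : 'M[F]_eta) N1 mul0mx.
rewrite {}Nil0 {Nnu} in WEZ.
case: _ / eN E A u v W Z Wu Zu WEZ WAZ Ev Av => E A u v W Z Wu Zu.
rewrite !castmx_id => WEZ WAZ Ev Av.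
pose v' := invmx Z *m v; pose u' := invmx Z *m u.
have vE : v = Z *m v' by rewrite mulKVmx.
have uE : u = Z *m u' by rewrite mulKVmx.
have : W *m E *m Z *m v' = 0 by rewrite -!mulmxA -vE Ev mulmx0.
have : W *m A *m Z *m v' = W *m E *m Z *m u' by rewrite -!mulmxA -vE -uE Av.
rewrite WEZ WAZ -[v']vsubmxK -[u']vsubmxK !mul_block_col !mul0mx !mul1mx !addr0 !add0r.
move=> /eq_col_mx[_ b0]; rewrite -[0 in X in _ = X]vsubmxK => /eq_col_mx[a0 _].
by rewrite vE -[v']vsubmxK b0 a0 linear0 col_mx0 mulmx0.
Qed.

Lemma jordan_form0 n : jordan_form (0 : 'M[F]_n).
Proof. by split=> i j; rewrite mxE // => _; left. Qed.

Lemma det0_kernel N (M : 'M[F]_N) :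
  (\det M == 0) <-> exists2 v : 'cV[F]_N, v != 0 & M *m v = 0.
Proof.
rewrite -det_tr; split=> [/det0P[v v0 vM]|[v v0 Mv]].
  by exists v^T; [rewrite trmx_eq0 | rewrite -[M]trmxK -trmx_mul vM trmx0].
by apply/det0P; exists v^T; [rewrite trmx_eq0 | rewrite -trmx_mul Mv trmx0].
Qed.

End Pencils.

(** A semi-explicit pencil is brought to Weierstrass form by eliminating its
    algebraic variables and putting the resulting Schur complement in Jordan form. *)
Lemma semi_explicit_index1 (F : closedFieldType) n m (A : 'M[F]_n) (B : 'M[F]_(n, m))
    (C : 'M[F]_(m, n)) (E : 'M[F]_m) : (0 < m)%N -> E \in unitmx ->
  regular_pencil (block_mx 1%:M 0 0 0) (block_mx A B C E) /\
  pencil_index (block_mx 1%:M 0 0 0) (block_mx A B C E) 1.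
Proof.
move=> m0 Eu; pose A' := A - B *m invmx E *m C.
have [P [J [Pu JJ PA]]] := jordan_normal_form A'.
pose W := block_mx P (- (P *m B *m invmx E)) 0 (invmx E).
pose Z := block_mx (invmx P) 0 (- (invmx E *m C *m invmx P)) 1%:M.
have Wu : W \in unitmx.
  by rewrite unitmxE det_ublock unitrM -!unitmxE Pu unitmx_inv.
have Zu : Z \in unitmx.
  by rewrite unitmxE det_lblock unitrM -!unitmxE unitmx1 unitmx_inv Pu.
have WQZ : W *m block_mx 1%:M 0 0 0 *m Z = block_mx 1%:M 0 0 0.
  rewrite !mulmx_block !(mulmx0, mulmx1, mul0mx, addr0, add0r) mulmxV //.
have WPZ : W *m block_mx A B C E *m Z = block_mx J 0 0 1%:M.
  rewrite !mulmx_block !mul0mx !add0r mulVmx // !mulmx0 !mulmx1 !add0r !mulNmx.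
  rewrite mulmxKV // subrr mul0mx addr0 mul1mx addrN.
  rewrite -(mulmxA P) -(mulmxA P) -mulmxBr -/A' PA mulmxK //.
split.
  have [a ra] : exists a, ~~ root (char_poly J) a.
    by apply/closed_nonrootP; exact/monic_neq0/char_poly_monic.
  exists a; rewrite -unitfE -unitmxE.
  have : W *m (a *: block_mx 1%:M 0 0 0 - block_mx A B C E) *m Z \in unitmx.
    rewrite mulmxBr mulmxBl -scalemxAr -scalemxAl WQZ WPZ scale_block_mx !scaler0.
    rewrite opp_block_mx add_block_mx !(oppr0, addr0, add0r) scalemx1.
    rewrite unitmxE det_ublock unitrM -!unitmxE -[- 1%:M]scaleN1r.
    rewrite unitmxZ ?unitmx1 ?andbT ?unitrN1 //.
    rewrite unitmxE unitfE; apply: contra ra => /det0P[v v0].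
    rewrite mulmxBr mul_mx_scalar => /eqP; rewrite subr_eq0 => /eqP vJ.
    by rewrite -eigenvalue_root_char; apply/eigenvalueP; exists v.
  by rewrite !unitmx_mul => /andP[/andP[]].
exists n, m, erefl, J, 0; split => //.
  split => //; first exact: jordan_form0.
    by exists 1%N; rewrite expr1.
  by exists W, Z; rewrite !castmx_id.
case=> // /eqP; rewrite expr0 -[1]/(1%:M) => /eqP /matrixP.
by case: m m0 {B C E Eu A' PA W Z Wu Zu WQZ WPZ P J Pu JJ} => // m _ /(_ 0 0); rewrite !mxE => /eqP; rewrite oner_eq0.
Qed.

Section CharacteristicMatrix.
Context {R : realType} {n m p K L : nat} {q r : 'I_L -> nat}.
Variable S : uncertain_system R n m p K q r.
Hypothesis m_gt0 : (0 < m)%N.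
Variables (delta : uncertainty R q r) (Delta : 'M[R[i]]_(m, p)).

Let D0 := um_eval (sysD S ord0) delta.

(** The algebraic block [-I, Delta; D_0, -I] is singular exactly when 1 is an
    eigenvalue of Delta D_0. *)
Lemma well_posedP :
  well_posed S delta Delta <-> (forall w : 'cV_m, Delta *m (D0 *m w) = w -> w = 0).
Proof.
pose Alg : 'M[R[i]]_(m + p) := block_mx (- 1%:M) Delta D0 (- 1%:M).
split=> [[_ [nu idx nu1]] w ww|inj].
  pose v : 'cV[R[i]]_(n + (m + p)) := col_mx 0 (col_mx w (D0 *m w)).
  have v0 : v = 0.
    apply: (@index_le1_kernel _ _ _ _ _ (col_mx (um_eval (sysB S ord0) delta *m w) 0) v idx nu1).
      by rewrite /mxQ mul_block_col !mul0mx mulmx0 !addr0 col_mx0.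
    rewrite /mxQ /mxP0 /v !mul_block_col mul_row_col !mulmx0 !mul0mx !mul1mx.
    by rewrite !mulNmx !mul1mx ww -/D0 addNr subrr !addr0 !add0r col_mx0.
  move: v0; rewrite /v -col_mx0 => /eq_col_mx[_]; rewrite -[0 in X in _ = X]col_mx0.
  by case/eq_col_mx.
have AlgU : Alg \in unitmx.
  rewrite unitmxE unitfE; apply/negP => /det0_kernel[v v0 Av]; move/negP: v0; apply.
  rewrite -[v]vsubmxK in Av *; move: (usubmx v) (dsubmx v) Av => w z.
  rewrite mul_block_col !mulNmx !mul1mx -col_mx0 => /eq_col_mx[/eqP].
  rewrite addrC subr_eq0 => /eqP wz /eqP; rewrite subr_eq0 => /eqP zw.
  have w0 : w = 0 by apply: inj; rewrite zw.
  by rewrite -zw w0 mulmx0 col_mx0.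
have mp0 : (0 < m + p)%N by rewrite addn_gt0 m_gt0.
have [reg idx] := @semi_explicit_index1 _ n (m + p) (um_eval (sysA S ord0) delta)
  (row_mx (um_eval (sysB S ord0) delta) 0) (col_mx 0 (um_eval (sysC S ord0) delta)) Alg mp0 AlgU.
by split => //; exists 1%N.
Qed.

Variables (tau : 'rV[R]_K) (lam : R[i]).

Lemma charM_block :
  charM S delta Delta tau lam = block_mx
    (internal_char S delta tau lam) (row_mx (- delay_eval (sysB S) delta tau lam) 0)
    (col_mx 0 (- delay_eval (sysC S) delta tau lam))
    (block_mx 1%:M (- Delta) (- delay_eval (sysD S) delta tau lam) 1%:M).
Proof.
have sumE (s : seq 'I_K) (e : 'I_K -> R[i]) :
    \sum_(k <- s) e k *: mxP S delta k = block_mx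
      (\sum_(k <- s) e k *: um_eval (sysA S (lift ord0 k)) delta)
      (row_mx (\sum_(k <- s) e k *: um_eval (sysB S (lift ord0 k)) delta) 0)
      (col_mx 0 (\sum_(k <- s) e k *: um_eval (sysC S (lift ord0 k)) delta))
      (block_mx 0 0 (\sum_(k <- s) e k *: um_eval (sysD S (lift ord0 k)) delta) 0).
  elim: s => [|k s IH]; first by rewrite !big_nil row_mx0 col_mx0 !block_mx0.
  rewrite !big_cons IH /mxP scale_block_mx add_block_mx scale_row_mx add_row_mx.
  by rewrite scale_col_mx add_col_mx scale_block_mx add_block_mx !scaler0 !addr0.
rewrite /charM sumE /mxQ /mxP0 scale_block_mx !opp_block_mx !add_block_mx.
rewrite !scaler0 !add0r add_block_mx !opp_row_mx !opp_col_mx !add_row_mx !add_col_mx.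
by rewrite scalemx1 !oppr0 !addr0 !opprK /internal_char /delay_eval !opprD !addrA.
Qed.

(** Eliminating the state from the kernel of the characteristic matrix leaves the
    loop closed by Delta around the transfer matrix. *)
Lemma charM_rootP : \det (internal_char S delta tau lam) != 0 ->
  \det (charM S delta Delta tau lam) = 0 <->
  exists2 w : 'cV_m, w != 0 & Delta *m (transfer S delta tau lam *m w) = w.
Proof.
move=> dI; have Iu : internal_char S delta tau lam \in unitmx by rewrite unitmxE unitfE.
rewrite charM_block; set A := internal_char _ _ _ _; set B := delay_eval _ _ _ _.
set C := delay_eval _ _ _ _; set D := delay_eval _ _ _ _.
have TE w : transfer S delta tau lam *m w = C *m (invmx A *m (B *m w)) + D *m w.
  by rewrite /transfer mulmxDl !mulmxA.
have mulE (x : 'cV_n) (w : 'cV_m) (z : 'cV_p) :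
    block_mx A (row_mx (- B) 0) (col_mx 0 (- C)) (block_mx 1%:M (- Delta) (- D) 1%:M)
      *m col_mx x (col_mx w z)
    = col_mx (A *m x - B *m w) (col_mx (w - Delta *m z) (z - (C *m x + D *m w))).
  rewrite mul_block_col mul_row_col mul_col_mx mul_block_col add_col_mx.
  by rewrite !mul0mx !mul1mx !mulNmx addr0 add0r addrA -opprD addrC.
split=> [/eqP /det0_kernel[v v0 Mv]|[w w0 ww]].
  rewrite -[v]vsubmxK -[dsubmx v]vsubmxK in Mv v0.
  move: (usubmx v) (usubmx (dsubmx v)) (dsubmx (dsubmx v)) Mv v0 => x w z.
  rewrite mulE -[0 in X in X -> _]col_mx0 => /eq_col_mx[/eqP].
  rewrite subr_eq0 => /eqP Ax; rewrite -[0 in X in X -> _]col_mx0 => /eq_col_mx[/eqP].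
  rewrite subr_eq0 => /eqP wz /eqP; rewrite subr_eq0 => /eqP zE v0.
  have xE : x = invmx A *m (B *m w) by rewrite -Ax mulKmx.
  exists w; last by rewrite TE -xE -zE -wz.
  apply: contraNneq v0 => w0; rewrite zE xE w0 !(mulmx0, addr0).
  by rewrite !col_mx0.
apply/eqP/det0_kernel; exists (col_mx (invmx A *m (B *m w)) (col_mx w (transfer S delta tau lam *m w))).
  apply: contraNneq w0; rewrite -[0 in X in X -> _]col_mx0 => /eq_col_mx[_].
  by rewrite -[0 in X in X -> _]col_mx0 => /eq_col_mx[->].
by rewrite mulE mulKVmx // subrr ww subrr -TE subrr !col_mx0.
Qed.

End CharacteristicMatrix.

(** * Loops of small gain are strongly stable *)

Section TransferRegularity.
Context {R : realType} {n m p K L : nat} {q r : 'I_L -> nat}.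
Variable S : uncertain_system R n m p K q r.

Definition mtaylor2 a b (M : R[i] -> 'M[R[i]]_(a, b)) (z : R[i]) :=
  forall i j, taylor2 (fun s => M s i j) z.

Lemma mtaylor2M a b c (M : R[i] -> 'M[R[i]]_(a, b)) (M' : R[i] -> 'M[R[i]]_(b, c)) z :
  mtaylor2 M z -> mtaylor2 M' z -> mtaylor2 (fun s => M s *m M' s) z.
Proof.
move=> tM tM' i j; apply: (@taylor2_ext _ (fun s => \sum_k M s i k * M' s k j)) => [s|].
  by rewrite mxE.
by apply: taylor2_sum => k _; exact: taylor2M.
Qed.

Lemma mtaylor2D a b (M M' : R[i] -> 'M[R[i]]_(a, b)) z :
  mtaylor2 M z -> mtaylor2 M' z -> mtaylor2 (fun s => M s + M' s) z.
Proof.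
move=> tM tM' i j; apply: (@taylor2_ext _ (fun s => M s i j + M' s i j)) => [s|].
  by rewrite mxE.
exact: taylor2D.
Qed.

Lemma mtaylor2Z a b (f : R[i] -> R[i]) (M : R[i] -> 'M[R[i]]_(a, b)) z :
  taylor2 f z -> mtaylor2 M z -> mtaylor2 (fun s => f s *: M s) z.
Proof.
move=> tf tM i j; apply: (@taylor2_ext _ (fun s => f s * M s i j)) => [s|].
  by rewrite mxE.
exact: taylor2M.
Qed.

Lemma mtaylor2_cst a b (M : 'M[R[i]]_(a, b)) z : mtaylor2 (fun=> M) z.
Proof. by move=> i j; exact: taylor2_cst. Qed.

Lemma taylor2_det a (M : R[i] -> 'M[R[i]]_a) z :
  mtaylor2 M z -> taylor2 (fun s => \det (M s)) z.
Proof.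
by move=> tM; apply: taylor2_sum => s _; apply: taylor2M;
  [exact: taylor2_cst | apply: taylor2_prod => i _].
Qed.

Lemma mtaylor2_adj a (M : R[i] -> 'M[R[i]]_a) z :
  mtaylor2 M z -> mtaylor2 (fun s => \adj (M s)) z.
Proof.
move=> tM i j; apply: (@taylor2_ext _ (fun s => cofactor (M s) j i)) => [s|].
  by rewrite mxE.
apply: taylor2M; first exact: taylor2_cst.
apply: taylor2_det => k s; apply: taylor2_ext (tM (lift j k) (lift i s)) => x.
by rewrite !mxE.
Qed.

Lemma mtaylor2_delay_eval a b (U : 'I_K.+1 -> uncertain_mx R q r a b) delta tau z :
  mtaylor2 (delay_eval U delta tau) z.
Proof.
apply: mtaylor2D; first exact: mtaylor2_cst.
move=> i j; apply: (@taylor2_ext _ (fun s =>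
    \sum_(k < K) (cexp ((- tau 0 k)%:C * s) *: um_eval (U (lift ord0 k)) delta) i j)) => [s|].
  by rewrite summxE; apply: eq_bigr => k _; rewrite real_complexN mulNr -mulrN mulrC.
apply: taylor2_sum => k _.
by apply: mtaylor2Z; [exact: taylor2_cexp | exact: mtaylor2_cst].
Qed.

Lemma mtaylor2_internal_char delta tau z : mtaylor2 (internal_char S delta tau) z.
Proof.
apply: mtaylor2D.
  move=> i j; apply: (@taylor2_ext _ (fun s => s * (i == j)%:R)) => [s|].
    by rewrite mxE mulr_natr.
  by apply: taylor2M; [exact: taylor2_id | exact: taylor2_cst].
move=> i j; apply: (@taylor2_ext _ (fun s => (-1) * (delay_eval (sysA S) delta tau s) i j)) => [s|].
  by rewrite [RHS]mxE mulN1r.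
by apply: taylor2M; [exact: taylor2_cst | exact: mtaylor2_delay_eval].
Qed.

Lemma taylor2_near (f g : R[i] -> R[i]) z : f z = g z ->
  (forall d, d ^+ 4 = 1 -> \forall t \near (0 : R)^'+, f (z + t%:C * d) = g (z + t%:C * d)) ->
  taylor2 f z -> taylor2 g z.
Proof.
move=> fg0 fg [a [b fab]]; exists a, b => d d4.
by apply: ccvg_near (fab d d4); apply: filterS (fg d d4) => t ->; rewrite fg0.
Qed.

Lemma ccontinuous_internal_char delta tau z (F : set_system R[i]) : Filter F ->
  ccvg F id z -> mcvg F (internal_char S delta tau) (internal_char S delta tau z).
Proof.
move=> FF Fz; apply: mcvgB; first exact: mcvg_scalar.
apply: (@mcvg_delay_eval _ _ _ _ _ _ F _ (fun=> delta) delta (fun=> tau) id); first exact: dcvg_cst.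
by apply: ccvg_phases => // k; exact: cvg_cst.
Qed.

(** The transfer function is a rational expression of lambda and of exponentials,
    whose denominator is the characteristic function of the system. *)
Lemma transfer_regular delta tau z (y : 'cV_p) (x : 'cV_m) :
  \det (internal_char S delta tau z) != 0 ->
  let f s := inner y (transfer S delta tau s *m x) in ccontinuous f z /\ taylor2 f z.
Proof.
move=> dz f; split.
  move=> F FF Fz; apply: ccvg_inner; first exact: mcvg_cst.
  apply: mcvgM; last exact: mcvg_cst.
  apply: (@transfer_limit_finite _ _ _ _ _ _ _ _ S _ F _ (fun=> delta) delta (fun=> tau) id _ tau z _ Fz dz).2.
    exact: dcvg_cst.
  by move=> k; exact: cvg_cst.
pose I := internal_char S delta tau.
pose T s := delay_eval (sysC S) delta tau s *m ((\det (I s))^-1 *: \adj (I s))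
    *m delay_eval (sysB S) delta tau s + delay_eval (sysD S) delta tau s.
have TE s : \det (I s) != 0 -> transfer S delta tau s = T s.
  by move=> ds; rewrite /transfer /T -/(I s) /invmx unitmxE unitfE ds.
apply: (@taylor2_near (fun s => inner y (T s *m x))).
- by rewrite /f TE.
- move=> d d4.
  have zt : ccvg (0 : R)^'+ (fun t => z + t%:C * d) z.
    rewrite -[X in ccvg _ _ X]addr0 -[X in _ + X](mul0r d).
    apply: ccvgD; first exact: ccvg_cst.
    by apply: ccvgM; [exact: ccvg_at_right0 | exact: ccvg_cst].
  have near_dI : \forall t \near (0 : R)^'+, \det (I (z + t%:C * d)) != 0.
    apply: (@ccvg_neq0 _ _ _ _ _ _ dz); apply: ccvg_det.
    by move: zt => /(ccontinuous_internal_char delta tau (F := fmap _ _)); apply.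
  by apply: filterS near_dI => t dt; rewrite /f TE.
apply: (@taylor2_ext _ (fun s => (ctrmx y *m (T s *m x)) 0 0)) => // {f}.
have tT : mtaylor2 T z.
  apply: mtaylor2D; last exact: mtaylor2_delay_eval.
  apply: mtaylor2M; last exact: mtaylor2_delay_eval.
  apply: mtaylor2M; first exact: mtaylor2_delay_eval.
  apply: mtaylor2Z; last exact/mtaylor2_adj/mtaylor2_internal_char.
  apply: taylor2V; first exact: dz.
  exact/taylor2_det/mtaylor2_internal_char.
have := mtaylor2M (mtaylor2_cst (ctrmx y) z) (mtaylor2M tT (mtaylor2_cst x z)).
exact.
Qed.

End TransferRegularity.

Section SmallGain.
Context {R : realType} {n m p K L : nat} {q r : 'I_L -> nat}.
Variable S : uncertain_system R n m p K q r.
Hypothesis m_gt0 : (0 < m)%N.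
Hypothesis p_gt0 : (0 < p)%N.
Variable tau : 'rV[R]_K.
Hypothesis tau_gt0 : forall k, 0 < tau 0 k.
Variable delta : uncertainty R q r.
Hypothesis stable : internally_exp_stable S delta tau.

Let gap (i : nat) : R := i.+1%:R^-1.

Let gap_gt0 i : 0 < gap i. Proof. by rewrite invr_gt0 ltr0n. Qed.

Let near_gap (V : set_system nat) (e : R) : Filter V -> \oo `<=` V -> 0 < e ->
  \forall i \near V, gap i < e.
Proof.
move=> FV oV e0; apply: oV; apply: filterS (near_frequency_lt e^-1) => i.
by rewrite /gap => ei; rewrite invf_plt ?posrE ?ltr0n.
Qed.

(** The bounds below hold uniformly for delays close to tau and for real parts
    close to 0; if not, violations for smaller and smaller tolerances would have a
    limit along an ultrafilter. *)
Lemma uniform_near_axis (P : 'rV[R]_K -> R[i] -> Prop) :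
  (forall (V : set_system nat) (t : nat -> 'rV[R]_K) (lam : nat -> R[i]),
     UltraFilter V -> \oo `<=` V ->
     (forall k, (fun i => t i 0 k) @ V --> tau 0 k) ->
     (forall i, - gap i <= Re (lam i)) ->
     exists i, P (t i) (lam i)) ->
  exists g : R, 0 < g /\
    forall t lam, delay_ball tau g t -> - g <= Re lam -> P t lam.
Proof.
move=> HP; apply: contrapT => nP.
have /choice [tl tlP] (i : nat) : exists tl : 'rV[R]_K * R[i],
    [/\ delay_ball tau (gap i) tl.1, - gap i <= Re tl.2 & ~ P tl.1 tl.2].
  apply: contrapT => no; apply: nP; exists (gap i); split => // t lam tb lb.
  by apply: contrapT => nPtl; apply: no; exists (t, lam).
have [V [UV oV]] := @ultra_infty.
have [||i] := HP V (fun i => (tl i).1) (fun i => (tl i).2) UV oV.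
- apply: cvg_delay_ball => g g0; apply: filterS (near_gap _ oV g0) => i ig.
  by apply: sub_delay_ball (ltW ig) _ _; have [] := tlP i.
- by move=> i; have [] := tlP i.
- by have [] := tlP i.
Qed.

(** Along bounded roots the limit would be a root of the nominal system in the
    closed right half-plane; unbounded ones are excluded since lambda dominates. *)
Lemma uniform_half_plane : exists g : R, 0 < g /\ forall t lam, delay_ball tau g t ->
  - g <= Re lam -> \det (internal_char S delta t lam) != 0.
Proof.
apply: uniform_near_axis => V t lam UV oV tV lamV.
have lamN1 : \forall i \near V, -1 <= Re (lam i).
  apply: nearW => i; apply: le_trans (lamV i); rewrite lerN2.
  by rewrite invf_le1 ?ltr0n // ler1n.
have dV : dcvg V (fun=> delta) delta by exact: dcvg_cst.
suff : \forall i \near V, \det (internal_char S delta (t i) (lam i)) != 0.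
  by move=> /filter_ex[i di]; exists i.
have [[l lV]|[linf [e eV]]] := frequency_dichotomy UV tau_gt0 tV lamN1.
  suff ld : \det (internal_char S delta tau l) != 0.
    by have [nd _] := transfer_limit_finite dV tV lV ld; exact: nd.
  apply/negP => /eqP /stable; apply/negP; rewrite -leNgt.
  apply/ler_addgt0Pl => e e0; rewrite -lerBlDl sub0r.
  case: lV => lr _; apply: cvg_near_ge lr _.
  by apply: filterS (near_gap _ oV e0) => i ie; apply: le_trans (lamV i); rewrite lerN2 ltW.
by have [nd _] := transfer_limit_infinite S dV linf eV; exact: nd.
Qed.

Variable v : R.
Hypothesis limit_le : forall N, limit_transfer S delta tau N -> sigma1 N <= v.

Lemma uniform_axis_bound v' : v < v' -> exists g : R, 0 < g /\ forall t lam,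
  delay_ball tau g t -> - g <= Re lam ->
  (Re lam <= 0 -> sigma1 (transfer S delta t lam) <= v').
Proof.
move=> vv'; apply: uniform_near_axis => V t lam UV oV tV lamV.
apply: contrapT => /forallNP no.
have lam0 : (fun i => Re (lam i)) @ V --> (0 : R).
  apply/cvgrPdist_lt => e e0; apply: filterS (near_gap _ oV e0) => i ie.
  have {}no := no i; have : Re (lam i) <= 0 by apply: contrapT => nle; apply: no => /nle.
  move=> h; rewrite sub0r normrN ler0_norm //; have := lamV i; lra.
have dV : dcvg V (fun=> delta) delta by exact: dcvg_cst.
have [N [NX NV]] := transfer_cluster tau_gt0 UV stable dV tV lam0.
have : v' <= sigma1 N.
  apply: cvg_sigma1_ge NV _ => //; apply: nearW => i; rewrite leNgt; apply/negP => h.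
  by apply: (no i) => _; exact: ltW.
by have := limit_le NX; lra.
Qed.

(** In a right half-plane T(z) approaches the direct feedthrough at infinity, and
    the exponentials in it are bounded. *)
Lemma transfer_bounded_at_infinity (g : R) (t : 'rV[R]_K) (y : 'cV_p) (x : 'cV_m) :
  (forall k, 0 < t 0 k) ->
  exists rho B' : R, forall z, g <= Re z -> rho <= normc z ->
    normc (inner y (transfer S delta t z *m x)) <= B'.
Proof.
move=> t0; apply: contrapT => no.
have /choice [z zP] (i : nat) : exists z, [/\ g <= Re z, i%:R <= normc z &
    i%:R < normc (inner y (transfer S delta t z *m x))].
  apply: contrapT => noi; apply: no; exists i%:R, i%:R => z gz iz.
  by rewrite leNgt; apply/negP => h; apply: noi; exists z.
have [V [UV oV]] := @ultra_infty.
have tV k : (fun _ : nat => t 0 k) @ V --> t 0 k by exact: cvg_cst.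
have gV : \forall i \near V, g <= Re (z i) by apply: nearW => i; have [] := zP i.
have big (b : R) : \forall i \near V, b < i%:R :> R.
  apply: oV; apply: filterS (nbhs_infty_ger (b + 1)) => i; apply: lt_le_trans.
  by rewrite ltrDl.
have [[l lV]|[linf [e eV]]] := frequency_dichotomy UV t0 tV gV.
  have h : \forall i \near V, normc (z i) < normc l + 1.
    by apply: (cvgr_lt _ (cvg_normc lV)); rewrite ltrDl.
  have [i [h1 h2]] := filter_ex (filterI h (big (normc l + 1))).
  by have [_ h3 _] := zP i; lra.
have dV : dcvg V (fun=> delta) delta by exact: dcvg_cst.
have [_ TV] := transfer_limit_infinite S dV linf eV.
pose l := normc (inner y (phased_eval (sysD S) delta e *m x)).
have fV : (fun i => normc (inner y (transfer S delta t (z i) *m x))) @ V --> l.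
  apply: cvg_normc; apply: ccvg_inner; first exact: mcvg_cst.
  by apply: mcvgM; [exact: TV | exact: mcvg_cst].
have h : \forall i \near V, normc (inner y (transfer S delta t (z i) *m x)) < l + 1.
  by apply: (cvgr_lt _ fV); rewrite ltrDl.
have [i [h1 h2]] := filter_ex (filterI h (big (l + 1))).
by have [_ _ h3] := zP i; lra.
Qed.

(** The maximum principle carries the bound on the imaginary axis to the right
    half-plane. *)
Lemma half_plane_gain v' : 0 <= v -> v < v' -> exists g : R, 0 < g /\
  forall t lam, delay_ball tau g t -> - g <= Re lam ->
    \det (internal_char S delta t lam) != 0 /\
    forall x, enorm (transfer S delta t lam *m x) <= v' * enorm x.
Proof.
move=> v0 vv'; have v'0 : 0 < v' by apply: le_lt_trans vv'.
have [g1 [g1_gt0 reg]] := uniform_half_plane.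
have [g2 [g2_gt0 axis]] := uniform_axis_bound vv'.
exists (Num.min g1 g2); split; first by rewrite lt_min g1_gt0.
set g := Num.min g1 g2; move=> t lam tb lb.
have gg1 : g <= g1 by rewrite ge_min lexx.
have gg2 : g <= g2 by rewrite ge_min lexx orbT.
have g0 : 0 < g by rewrite lt_min g1_gt0.
have regt z : - g <= Re z -> \det (internal_char S delta t z) != 0.
  move=> gz; apply: reg; first exact: sub_delay_ball tb.
  by apply: le_trans gz; rewrite lerN2.
split; first exact: regt.
move=> x; apply: enorm_mulmx_bilinear (ltW v'0) _ => y.
have [xy0|xy0] := eqVneq (enorm y * enorm x) 0.
  by have := bilinear_sigma1 (transfer S delta t lam) y x; rewrite xy0 !mulr0.
have B0 : 0 < v' * (enorm y * enorm x).
  by rewrite mulr_gt0 // lt_def xy0 mulr_ge0 ?enorm_ge0.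
apply: (@phragmen_lindelof R (- g) (fun s => inner y (transfer S delta t s *m x)) _ B0) => //.
- by move=> z gz; exact: transfer_regular (regt z gz).
- move=> z gz; apply: le_trans (bilinear_sigma1 _ _ _) _.
  rewrite ler_wpM2r ?mulr_ge0 ?enorm_ge0 //; apply: axis.
  + exact: sub_delay_ball tb.
  + by rewrite gz lerN2.
  + by rewrite gz oppr_le0 ltW.
- by apply: transfer_bounded_at_infinity; case: tb.
Qed.

Lemma feedthrough_gain (w : 'cV_m) : enorm (um_eval (sysD S ord0) delta *m w) <= v * enorm w.
Proof.
set D0 := um_eval _ _.
(* D_0 is the mean of the limits with all phases 1 and all phases -1. *)
pose lim e := phased_eval (sysD S) delta (fun=> e : R[i]).
have limX e : normc e = 1 -> sigma1 (lim e) <= v.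
  by move=> e1; apply: limit_le; right; exists (fun=> e).
have D0E : 2%:R *: D0 = lim 1 + lim (-1).
  rewrite /lim /phased_eval -/D0 addrACA -big_split /= big1 => [|k _].
    by rewrite addr0 scaler_nat mulr2n.
  by rewrite scale1r scaleN1r subrr.
have v0 : 0 <= v by apply: le_trans (sigma1_ge0 (lim 1) m_gt0) (limX _ (normc1 _)).
apply: enorm_mulmx_bilinear => // y.
have yw0 : 0 <= enorm y * enorm w by rewrite mulr_ge0 ?enorm_ge0.
have b1 := le_trans (bilinear_sigma1 (lim 1) y w) (ler_wpM2r yw0 (limX _ (normc1 _))).
have n1 : normc (-1 : R[i]) = 1 by rewrite normcN normc1.
have b2 := le_trans (bilinear_sigma1 (lim (-1)) y w) (ler_wpM2r yw0 (limX _ n1)).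
have two : 2 * normc (inner y (D0 *m w))
    <= normc (inner y (lim 1 *m w)) + normc (inner y (lim (-1) *m w)).
  apply: le_trans (ler_normcD _ _); rewrite -innerDr -mulmxDl -D0E -scalemxAl innerZr.
  rewrite normcM (_ : normc 2%:R = 2) //.
  have -> : 2%:R = (2 : R)%:C :> R[i] by apply: complex_ext => /=; ring.
  by rewrite normc_real ger0_norm.
lra.
Qed.

(** A solution of the loop equation would satisfy |w| <= |Delta| v' |w| with
    |Delta| v' < 1. *)
Lemma small_gain_strongly_stable (Delta : 'M[R[i]]_(m, p)) : 0 <= v ->
  norm2 Delta * v < 1 -> strongly_stable S delta Delta tau.
Proof.
move=> v0 small; pose eps := norm2 Delta.
have gain z : enorm (Delta *m z) <= eps * enorm z by exact: norm2_bounded.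
have eps0 : 0 <= eps.
  have [z z1] := @exists_unit R _ p_gt0.
  by have := gain z; rewrite z1 mulr1; apply: le_trans; exact: enorm_ge0.
have loop (T : 'M[R[i]]_(p, m)) (v' : R) w : eps * v' < 1 ->
    enorm (T *m w) <= v' * enorm w -> Delta *m (T *m w) = w -> w = 0.
  move=> ev Tw Dw; apply/eqP; rewrite -enorm_eq0; apply/negP => /negP w0.
  have w_gt0 : 0 < enorm w by rewrite lt_def w0 enorm_ge0.
  have := gain (T *m w); rewrite Dw => h.
  have := le_trans h (ler_wpM2l eps0 Tw).
  by rewrite mulrA leNgt gtr_pMl // ev.
split.
  by apply/(well_posedP S m_gt0) => w; apply: loop small _; exact: feedthrough_gain.
(* a bound v' slightly above v with eps v' still below 1 *)
pose v' := v + (1 - eps * v) / (2 * (eps + 1)).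
have e1 : 0 < 2 * (eps + 1) by lra.
have vv' : v < v' by rewrite ltrDl divr_gt0 // subr_gt0.
have ev' : eps * v' < 1.
  have E : (1 - eps * v) / (2 * (eps + 1)) * (2 * (eps + 1)) = 1 - eps * v.
    by rewrite divfK // gt_eqF.
  rewrite /v'; move: E; set u := _ / _ => E.
  have u0 : 0 < u by rewrite divr_gt0 // subr_gt0.
  nra.
have [g [g0 hp]] := half_plane_gain v0 vv'.
apply: (@le_lt_trans _ _ (- g)%:E); last by rewrite lte_fin oppr_lt0.
apply: le_trans (delay_limsup_le _ _ g0) _.
apply: ge_ereal_sup => _ [t tb <-]; apply: ge_ereal_sup => _ [lam /= root <-].
rewrite lee_fin leNgt; apply/negP => /ltW lb.
have [reg bound] := hp t lam tb lb.
move: root => /(charM_rootP Delta reg)[w w0 Dw].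
by move/eqP: w0; apply; exact: loop ev' (bound w) Dw.
Qed.

End SmallGain.

(** * Destabilisation by a perturbation of critical size *)

Section ExpRoots.
Context {R : realType}.

Lemma cexpX (z : R[i]) k : cexp (k%:R * z) = cexp z ^+ k.
Proof.
by elim: k => [|k IH]; rewrite ?mul0r ?cexp0 // -natr1 mulrDl mul1r cexpD IH exprSr.
Qed.

Lemma cexp_inj (z w : R[i]) : `|Im z| <= pi / 2 -> `|Im w| <= pi / 2 ->
  cexp z = cexp w -> z = w.
Proof.
move=> iz iw zw; have re : Re z = Re w.
  by apply: expR_inj; rewrite -!normc_cexp zw.
apply: complex_ext => //; apply: sin_inj; rewrite ?in_itv /= -?ler_norml //.
have /(congr1 (fun x => Im x)) := zw.
by rewrite /cexp re !ImM /= !mul0r !addr0 => /(mulfI (lt0r_neq0 (expR_gt0 _))).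
Qed.

(** P has finitely many roots and exp(- h s) is injective near 0, so only finitely
    many of the nested small squares around 0 have a zero on their boundary. *)
Lemma square_boundary_nonroot (P : {poly R[i]}) (h rho0 : R) : P != 0 -> 0 < h -> 0 < rho0 ->
  exists rho : R, [/\ 0 < rho, rho < rho0 &
    forall s, square_boundary rho s -> P.[cexp (- h%:C * s)] != 0].
Proof.
move=> P0 h0 rho0_gt0; apply: contrapT => no.
pose r1 := Num.min rho0 (pi / 2 / h).
have pi0 : 0 < pi / 2 / h :> R by rewrite !divr_gt0 ?pi_gt0.
have r1_gt0 : 0 < r1 by rewrite lt_min rho0_gt0.
pose rho (j : nat) : R := r1 * (j.+1%:R / (size P).+1%:R).
have inj_rho i j : rho i = rho j -> i = j.
  have nP : ((size P).+1%:R)^-1 != 0 :> R by rewrite invr_eq0 pnatr_eq0.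
  move=> /(mulfI (lt0r_neq0 r1_gt0)) /(mulIf nP) ij.
  by apply/eqP; rewrite -eqSS -(eqr_nat R) ij.
have /choice [s sP] (j : nat) : exists s, (j < size P)%N ->
    square_boundary (rho j) s /\ P.[cexp (- h%:C * s)] = 0.
  have [jP|] := ltnP j (size P); last by exists 0.
  apply: contrapT => nos; apply: no; exists (rho j).
  have j1 : 0 < j.+1%:R / (size P).+1%:R :> R by rewrite divr_gt0 ?ltr0n.
  have j2 : j.+1%:R / (size P).+1%:R < 1 :> R by rewrite ltr_pdivrMr ?ltr0n // mul1r ltr_nat ltnS.
  split; first by rewrite mulr_gt0.
    apply: (@lt_le_trans _ _ r1); last by rewrite ge_min lexx.
    by rewrite /rho gtr_pMr.
  by move=> s bs; apply/negP => /eqP ps; apply: nos; exists s.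
pose z j := cexp (- h%:C * s j).
have inj_z : {in iota 0 (size P) &, injective z}.
  move=> i j; rewrite !mem_iota !add0n /= => iP jP zij.
  have [bi _] := sP i iP; have [bj _] := sP j jP.
  have im k : (k < size P)%N -> square_boundary (rho k) (s k) -> `|Im (- h%:C * s k)| <= pi / 2.
    move=> kP bk; rewrite -real_complexN ImM [Im _%:C]/= mul0r addr0 [Re _%:C]/= normrM normrN (gtr0_norm h0).
    rewrite mulrC -ler_pdivlMr //; apply: (@le_trans _ _ (rho k)).
      by rewrite -bk le_max lexx orbT.
    apply: (@le_trans _ _ r1); last by rewrite ge_min lexx orbT.
    by rewrite /rho ger_pMr // ler_pdivrMr ?ltr0n // mul1r ler_nat ltnS ltnW.
  have nh : - h%:C != 0 by rewrite oppr_eq0; apply/eqP => -[] /eqP; rewrite gt_eqF.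
  have sij := mulfI nh (cexp_inj (im i iP bi) (im j jP bj) zij).
  by apply: inj_rho; rewrite -bi -bj sij.
have : (size [seq z j | j <- iota 0 (size P)] < size P)%N.
  apply: max_poly_roots => //; last by rewrite map_inj_in_uniq ?iota_uniq.
  apply/allP => x /mapP[j]; rewrite mem_iota add0n /= => jP ->.
  by rewrite rootE; have [_ ->] := sP j jP.
by rewrite size_map size_iota ltnn.
Qed.

Lemma taylor2_shift (f : R[i] -> R[i]) c z :
  taylor2 f (c + z) -> taylor2 (fun s => f (c + s)) z.
Proof.
move=> [a [b fab]]; exists a, b => d d4.
by apply: ccvg_eq (fab d d4) => t; rewrite addrA.
Qed.

Lemma ccontinuous_shift (f : R[i] -> R[i]) c z :
  ccontinuous f (c + z) -> ccontinuous (fun s => f (c + s)) z.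
Proof.
move=> cf F FF Fz; apply: (cf (fmap (fun s => c + s) F)).
exact: (ccvgD (ccvg_cst c) Fz).
Qed.

End ExpRoots.

Section CriticalPerturbation.
Context {R : realType} {n m p K L : nat} {q r : 'I_L -> nat}.
Variable S : uncertain_system R n m p K q r.
Hypothesis m_gt0 : (0 < m)%N.
Hypothesis p_gt0 : (0 < p)%N.
Variable tau : 'rV[R]_K.
Hypothesis tau_gt0 : forall k, 0 < tau 0 k.
Variable delta : uncertainty R q r.
Hypothesis stable : internally_exp_stable S delta tau.
Variables (u : 'cV[R[i]]_p) (w : 'cV[R[i]]_m) (v : R).
Hypothesis w1 : enorm w = 1.
Hypothesis u1 : enorm u = 1.
Hypothesis v_gt0 : 0 < v.

(** The smallest perturbation that maps v u back to w: it closes the loop around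
    any T with <u, T w> = v. *)
Definition rank1_perturbation : 'M[R[i]]_(m, p) := v^-1%:C *: (w *m ctrmx u).
Local Notation Delta := rank1_perturbation.

Lemma rank1_mulmx y : Delta *m y = (v^-1%:C * inner u y) *: w.
Proof.
rewrite /rank1_perturbation -scalemxAl -scalerA; congr (_ *: _).
rewrite -mulmxA [ctrmx u *m y]mx11_scalar mul_mx_scalar.
by rewrite /inner.
Qed.

Lemma norm2_rank1 : norm2 Delta <= v^-1.
Proof.
apply: norm2_le => // x x1; rewrite rank1_mulmx enormZ w1 mulr1 normcM normc_real.
rewrite gtr0_norm ?invr_gt0 // -[X in _ <= X]mulr1 ler_wpM2l ?invr_ge0 ?(ltW v_gt0) //.
by have := cauchy_schwarz u x; rewrite u1 x1 mulr1.
Qed.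

Lemma rank1_loop (T : 'M[R[i]]_(p, m)) : inner u (T *m w) = v%:C -> Delta *m (T *m w) = w.
Proof.
by move=> Tw; rewrite rank1_mulmx Tw -real_complexM mulVf ?gt_eqF // scale1r.
Qed.

Let w0 : w != 0. Proof. by rewrite -enorm_gt0 w1. Qed.

Lemma critical_root t lam : \det (internal_char S delta t lam) != 0 ->
  inner u (transfer S delta t lam *m w) = v%:C -> \det (charM S delta Delta t lam) = 0.
Proof. by move=> dI Tw; apply/charM_rootP => //; exists w => //; exact: rank1_loop. Qed.

Lemma critical_finite_frequency (omega : R) :
  inner u (transfer S delta tau (0 +i* omega) *m w) = v%:C ->
  ~ strongly_stable S delta Delta tau.
Proof.
move=> Tw [_]; rewrite ltNge => /negP; apply; apply: le_delay_limsup => g g0.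
apply: (@le_trans _ _ (abscissa S delta Delta tau)).
  apply: ereal_sup_ubound; exists (0 +i* omega) => //=; apply: critical_root => //.
  by apply/negP => /eqP /stable /=; rewrite ltxx.
by apply: ereal_sup_ubound; exists tau => //; exact: delay_ball_center.
Qed.

Lemma inner_phased_eval y (e : 'I_K -> R[i]) x :
  inner y (phased_eval (sysD S) delta e *m x) =
    inner y (um_eval (sysD S ord0) delta *m x)
    + \sum_(k < K) e k * inner y (um_eval (sysD S (lift ord0 k)) delta *m x).
Proof.
rewrite /phased_eval mulmxDl innerDr; congr (_ + _).
elim: (index_enum _) => [|k s IH].
  by rewrite !big_nil mul0mx -(scale0r 0) innerZr mul0r.
by rewrite !big_cons mulmxDl innerDr IH -scalemxAl innerZr.
Qed.

Lemma commensurate_delays (g : R) : 0 < g -> exists (h : R) (N : 'I_K -> nat),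
  0 < h /\ delay_ball tau g (\row_k ((N k).+1%:R * h)).
Proof.
move=> g0; pose h := g / K.+1%:R.
have h0 : 0 < h by rewrite divr_gt0 ?ltr0n.
exists h, (fun k => Num.truncn (tau 0 k / h)); split => //; split; last first.
  by move=> k; rewrite mxE mulr_gt0 ?ltr0n.
apply: (@frobenius_lt _ _ _ h) => // [k|]; last first.
  by rewrite /h mulrAC ltr_pdivrMr ?ltr0n // ltr_pM2l // ltr_nat.
rewrite !mxE; have y0 : 0 <= tau 0 k / h by rewrite divr_ge0 // ltW.
have /andP[] := truncn_itv y0; set N := Num.truncn _.
rewrite ler_pdivlMr // ltr_pdivrMr // -[N.+1%:R]natr1 mulrDl mul1r => k1 k2.
by rewrite ler_norml; lra.
Qed.

(** Suppose that all roots stay to the left of - eps for delays within g of tau.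
    Take commensurate delays tau' there, and delays t_i tending to tau' that realise
    the phases e at the frequencies i + 1. The loop functions f_i around these
    frequencies then vanish nowhere near 0, while f_i(0) tends to 0. By the minimum
    principle |f_i| is at most |f_i(0)| somewhere on the boundary of any small
    square, so the limit of the f_i has a zero there. But that limit is a polynomial
    in exp(- h s), not the zero polynomial since well-posedness makes its constant
    term nonzero. *)
Lemma critical_infinite_frequency (e : 'I_K -> R[i]) : (forall k, normc (e k) = 1) ->
  inner u (phased_eval (sysD S) delta e *m w) = v%:C ->
  ~ strongly_stable S delta Delta tau.
Proof.
move=> e1 Nw [wp abs_lt0].
(* otherwise Delta D_0 w = w *)
have c0 : inner u (um_eval (sysD S ord0) delta *m w) != v%:C.
  apply: contraNneq w0 => c0; apply/eqP.
  by move/(well_posedP S m_gt0): wp; apply; exact: rank1_loop.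
have [g [eps [g0 eps0 noroot]]] : exists g eps : R, [/\ 0 < g, 0 < eps &
    forall t lam, delay_ball tau g t -> - eps <= Re lam -> \det (charM S delta Delta t lam) != 0].
  apply: contrapT => no; move: abs_lt0; rewrite ltNge => /negP; apply.
  apply: le_delay_limsup => g g0; rewrite leNgt; apply/negP => sup_lt0; apply: no.
  have [eps [eps0 sup_le]] : exists eps : R, 0 < eps /\
      (ereal_sup (abscissa S delta Delta @` delay_ball tau g) < (- eps)%:E)%E.
    case: (ereal_sup _) sup_lt0 => [a|//|_]; last by exists 1; split => //; exact: ltNyr.
    by rewrite lte_fin => a0; exists (- a / 2); rewrite lte_fin; split; lra.
  exists g, eps; split => // t lam tg lam_eps; apply/negP => /eqP root.
  move: sup_le; rewrite ltNge => /negP; apply.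
  apply: (@le_trans _ _ (Re lam)%:E); first by rewrite lee_fin.
  apply: (@le_trans _ _ (abscissa S delta Delta t)); apply: ereal_sup_ubound; last by exists t.
  by exists lam.
have [g1 [g1_gt0 reg]] := uniform_half_plane tau_gt0 stable.
have [h [N [h0 tau'_ball]]] := @commensurate_delays (Num.min g g1) (ltac:(by rewrite lt_min g0)).
set tau' := \row_k _ in tau'_ball.
have tau'_gt0 k : 0 < tau' 0 k by case: tau'_ball.
have [t [tF te]] := phase_realization tau'_gt0 e1.
have t_ball : \forall i \near \oo, delay_ball tau g (t i) /\ delay_ball tau g1 (t i).
  have near_frob : \forall i \near \oo, frobenius (t i - tau) < Num.min g g1.
    apply: (cvgr_lt (frobenius (tau' - tau))); last by case: tau'_ball.
    apply: cvg_frobenius => a k; rewrite (ord1 a) !mxE.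
    under eq_fun do rewrite !mxE.
    by apply: cvgB; [have := tF k; rewrite mxE | exact: cvg_cst].
  have pos : \forall i \near \oo, delay_ball tau' 1 (t i) by exact: near_delay_ball.
  apply: filterS2 near_frob pos => i; rewrite lt_min => /andP[f1 f2] [_ ti0].
  by split.
pose c k := e k * inner u (um_eval (sysD S (lift ord0 k)) delta *m w).
pose P : {poly R[i]} := (inner u (um_eval (sysD S ord0) delta *m w) - v%:C)%:P
  + \sum_(k < K) c k *: 'X^((N k).+1).
(* the limit of the f_i below *)
have PE s : inner u (phased_eval (sysD S) delta
    (fun k => e k * cexp (- s * (tau' 0 k)%:C)) *m w) - v%:C = P.[cexp (- h%:C * s)].
  rewrite inner_phased_eval /P hornerD hornerC addrAC; congr (_ + _).
  rewrite horner_sum; apply: eq_bigr => k _.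
  rewrite hornerZ hornerXn -cexpX mxE /c mulrAC; congr (_ * _ * _); congr cexp.
  by rewrite real_complexM (_ : ((N k).+1%:R)%:C = (N k).+1%:R); [ring | exact: rmorph_nat].
have P0 : P != 0.
  apply: contraNneq c0 => /(congr1 (fun x => x.[0])); rewrite horner0 /P hornerD hornerC.
  rewrite horner_sum big1 ?addr0 => [/eqP|k _]; first by rewrite subr_eq0.
  by rewrite hornerZ hornerXn expr0n mulr0.
have [|rho [rho0 rho_lt nz]] := @square_boundary_nonroot R P h (Num.min eps g1) P0 h0.
  by rewrite lt_min eps0.
move: rho_lt; rewrite lt_min => /andP[rho_eps rho_g1].
pose iw (i : nat) : R[i] := 0 +i* (i.+1%:R).
pose f i s := inner u (transfer S delta (t i) (iw i + s) *m w) - v%:C.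
have /choice [s sP] (i : nat) : exists s,
    delay_ball tau g (t i) /\ delay_ball tau g1 (t i) ->
    square_boundary rho s /\ normc (f i s) <= normc (f i 0).
  have [[b1 b2]|nb] := pselect (delay_ball tau g (t i) /\ delay_ball tau g1 (t i)); last by exists 0.
  have [|s bs fs] := @square_minimum_principle R (f i) rho rho0; last by exists s.
  move=> z [z1 z2 _ _]; have Re_iw : Re (iw i + z) = Re z by rewrite ReD add0r.
  have dI : \det (internal_char S delta (t i) (iw i + z)) != 0.
    by apply: reg => //; rewrite Re_iw; lra.
  have [cT tT] := transfer_regular u w dI; split.
  - move=> F FF Fz; apply: ccvgB; last exact: ccvg_cst.
    exact: (ccontinuous_shift cT FF Fz).
  - by apply: taylor2D; [exact: taylor2_shift tT | exact: taylor2_cst].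
  - apply/negP; rewrite subr_eq0 => /eqP Tw.
    have := noroot (t i) (iw i + z) b1; rewrite Re_iw (critical_root dI Tw) eqxx.
    by move=> /(_ _)/negP; apply => //; lra.
have [V [UV oV]] := @ultra_infty.
have near_s : \forall i \near V, square_boundary rho (s i) /\ normc (f i (s i)) <= normc (f i 0).
  by apply: oV; apply: filterS t_ball => i /sP.
have [||z [bz Vz]] := @ccompact_square_boundary R rho (s @ V).
- exact: ultra_fmap.
- by apply: filterS near_s => i [].
have {}Vz : ccvg V s z by exact: Vz.
have tV k : (fun i => t i 0 k) @ V --> tau' 0 k by apply: cvg_trans (tF k); apply: cvg_app.
have limf (x : nat -> R[i]) (y : R[i]) : ccvg V x y -> (\forall i \near V, `|Im (x i)| <= rho) ->
    (fun i => normc (f i (x i))) @ V --> normc P.[cexp (- h%:C * y)].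
  move=> xy xrho; rewrite -PE; apply: cvg_normc; apply: ccvgB; last exact: ccvg_cst.
  apply: ccvg_inner; first exact: mcvg_cst.
  apply: mcvgM; last exact: mcvg_cst.
  have dV : dcvg V (fun=> delta) delta by exact: dcvg_cst.
  have [|k|_ TV] := transfer_limit_infinite (lam := fun i => iw i + x i) (t := t)
    (e := fun k => e k * cexp (- y * (tau' 0 k)%:C)) S dV; last exact: TV.
  - move=> b; apply: filterS2 (oV _ (near_frequency_lt (b + rho))) xrho => i ib ir.
    apply: lt_le_trans (ler_normc_Im _); rewrite ImD /=.
    apply: lt_le_trans (ler_norm _); move: ir; rewrite ler_norml; lra.
  - apply: (@ccvg_eq _ _ _ _ (fun i => e k * cexp (- x i * (t i 0 k)%:C))) => [i|].
      by rewrite -(te i k) -cexpD; congr cexp; rewrite -mulrDl opprD.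
    by apply: ccvgM; [exact: ccvg_cst | exact: ccvg_phases tV xy k].
have Ps : (fun i => normc (f i (s i))) @ V --> normc P.[cexp (- h%:C * z)].
  apply: limf => //; apply: filterS near_s => i [bs _].
  by rewrite -bs le_max lexx orbT.
have P1 : (fun i => normc (f i 0)) @ V --> (0 : R).
  have -> : (0 : R) = normc P.[cexp (- h%:C * 0)].
    rewrite -PE (_ : (fun k => _) = e) ?Nw ?subrr ?normc0 //.
    by apply/funext => k; rewrite oppr0 mul0r cexp0 mulr1.
  apply: limf; first exact: ccvg_cst.
  by apply: nearW => i; rewrite /= normr0 ltW.
have diff : (fun i => normc (f i 0) - normc (f i (s i))) @ V
    --> 0 - normc P.[cexp (- h%:C * z)] by exact: cvgB.
have : 0 <= 0 - normc P.[cexp (- h%:C * z)].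
  by apply: cvg_near_ge diff _; apply: filterS near_s => i [_]; rewrite subr_ge0.
by rewrite sub0r oppr_ge0 leNgt normc_gt0 nz.
Qed.

End CriticalPerturbation.

(** * Robust strong norm and distance to instability *)

Theorem theorem1 (R : realType) (n m p K L : nat) (q r : 'I_L -> nat)
    (S : uncertain_system R n m p K q r)
    (dbar : 'I_L -> R) (tau : 'rV[R]_K)
    (n_gt0 : (0 < n)%N) (m_gt0 : (0 < m)%N) (p_gt0 : (0 < p)%N)
    (K_gt0 : (0 < K)%N) (L_gt0 : (0 < L)%N)
    (dbar_ge0 : forall l : 'I_L, 0 <= dbar l)
    (tau_gt0 : forall k : 'I_K, 0 < tau ord0 k)
    (stable : forall delta : uncertainty R q r,
       admissible dbar delta -> internally_exp_stable S delta tau) :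
  exists norm dist : \bar R,
    [/\ is_robust_strong_Hinf_norm S dbar tau norm,
        is_dist_ins S dbar tau dist &
        norm = (dist^-1)%E].
Proof.
have adm0 : admissible dbar ((fun l => 0) : uncertainty R q r).
  move=> l; rewrite /frobenius big1 ?sqrtr0 // => i _.
  by rewrite big1 // => j _; rewrite mxE expr0n.
have [delta [N [adm NX worst]]] := worst_limit_transfer m_gt0 tau_gt0 stable adm0.
pose v := sigma1 N; have v0 : 0 <= v by exact: sigma1_ge0.
have small D d : norm2 D * v < 1 -> admissible dbar d -> strongly_stable S d D tau.
  move=> Dv adm_d; have lim M : limit_transfer S d tau M -> sigma1 M <= v.
    move=> MX; rewrite -lee_fin; apply: le_trans (worst _ adm_d).
    exact: (limit_transfer_le_strong m_gt0 tau_gt0 MX).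
  exact: (small_gain_strongly_stable m_gt0 p_gt0 tau_gt0 (stable d adm_d) lim v0 Dv).
exists v%:E, (v%:E^-1)%E; split; last by rewrite inveK.
  split=> [|_ [d adm_d <-]]; last exact: worst.
  exists delta => //; apply/le_anti/andP; split; first exact: worst.
  exact: (limit_transfer_le_strong m_gt0 tau_gt0 NX).
have [vz|vn0] := eqVneq v 0.
  right; split; last by rewrite vz inve0.
  apply/seteqP; split=> // eps [_ [D _ [d adm_d]]]; apply; apply: small => //.
  by rewrite vz mulr0.
have v_gt0 : 0 < v by rewrite lt_def vn0.
left; exists v^-1; split.
- by rewrite inver (negPf vn0).
- split; first by rewrite invr_ge0.
  have [w [w1 Nw _]] := sigma1_attained N m_gt0.
  pose u := v^-1%:C *: (N *m w).
  have u1 : enorm u = 1.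
    by rewrite enormZ normc_real gtr0_norm ?invr_gt0 // Nw mulVf.
  have uN : inner u (N *m w) = v%:C.
    rewrite innerZl conjc_real inner_self Nw -real_complexM expr2 mulKf //.
  exists (rank1_perturbation u w v); first exact: norm2_rank1.
  exists delta => //; case: NX uN => [[omega ->]|[e [e1 ->]]] uN.
    exact: (critical_finite_frequency tau_gt0 (stable _ adm) w1 v_gt0 uN).
  exact: (critical_infinite_frequency m_gt0 tau_gt0 (stable _ adm) w1 v_gt0 e1 uN).
- move=> eps [eps0 [D De [d adm_d unstable]]]; rewrite leNgt; apply/negP => eps_lt.
  apply: unstable; apply: small => //.
  apply: (@le_lt_trans _ _ (eps * v)); first by rewrite ler_wpM2r.
  by rewrite -ltr_pdivlMr // mul1r.
Qed.
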